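(* Let $\psi(z)=(1+Dz)/(1+Ez)$ with $-1\le E<D\le1$, and suppose that $t_n=\prod_{k=2}^{n}\frac{D-(k-1)E}{k-1}>0$ for all $n\ge2$. (i) If $E=0$ and $D\ge\frac34\log3$, then for every $f\in\mathcal{S}^*(\psi)$ the class $S_f(\psi)$ (and also the class $\mathcal{S}^*(\psi)$) satisfies the Bohr-phenomenon for $|z|=r\le r_0$, where $r_0$ is the only real root of the equation $$1-re^{D(1+r)}=0.$$ (ii) If $E\ne0$ and $$3(1-E)^{\frac{D-E}{E}}\le(1+E/3)^{\frac{D-E}{E}},$$ then for every $f\in\mathcal{S}^*(\psi)$ the class $S_f(\psi)$ (and also the class $\mathcal{S}^*(\psi)$) satisfies the Bohr-phenomenon for $|z|=r\le r_0$, where $r_0$ is the only root in $(0,1)$ of the equation $$(1-E)^{\frac{D-E}{E}}-r(1+Er)^{\frac{D-E}{E}}=0.$$ The result is sharp for the function $f_0$ given by $f_0(z)=z(1+Ez)^{\frac{D-E}{E}}$ if $E\ne0$ and $f_0(z)=z\exp(Dz)$ if $E=0$.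
   Context: $\mathbb{D}=\{z:|z|<1\}$. $\mathcal{A}$ is the class of analytic functions $f(z)=z+\sum_{k\ge2}a_kz^k$ in $\mathbb{D}$. $\prec$ denotes subordination. $\mathcal{S}^*(\psi)=\{f\in\mathcal{A}:zf'(z)/f(z)\prec\psi(z)\}$. For fixed $f\in\mathcal{S}^*(\psi)$, $S_f(\psi)=\{g(z)=\sum_{k\ge1}b_kz^k\text{ analytic in }\mathbb{D}:g\prec f\}$. $S_f(\psi)$ satisfies the Bohr-phenomenon for $|z|=r\le\rho$ if $\sum_{k=1}^\infty|b_k|r^k\le d(f(0),\partial f(\mathbb{D}))$ for all $g=\sum b_kz^k\in S_f(\psi)$ and all $r\le\rho$, where $d$ is Euclidean distance; $\mathcal{S}^*(\psi)$ satisfies it if $r+\sum_{n\ge2}|a_n|r^n\le d(f(0),\partial f(\mathbb{D}))$ for all $f=z+\sum_{n\ge2} a_nz^n\in\mathcal{S}^*(\psi)$ and all $r\le\rho$. ''Sharp for $f_0$'' means that for $f=g=f_0$ the inequality fails for $r$ larger than $r_0$ (with $r<1$). *)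

(* Defs.v *)
From Stdlib Require Import Reals List.
From Coquelicot Require Import Coquelicot.
Open Scope R_scope.

Definition unit_disk (z : C) : Prop := Cmod z < 1.

Definition analytic_on (U : C -> Prop) (f : C -> C) : Prop :=
  forall z0 : C, U z0 ->
    exists c : nat -> C,
      @locally C_UniformSpace z0
        (fun z => @is_pseries C_AbsRing C_NormedModule c (z - z0)%C (f z)).

(* [a] is the sequence of Taylor coefficients of [f] at the origin:
   f z = sum_k a_k z^k throughout the disk. *)
Definition expansion (f : C -> C) (a : nat -> C) : Prop :=
  forall z : C, unit_disk z -> @is_pseries C_AbsRing C_NormedModule a z (f z).

(* F is subordinate to G: F = G o omega for a Schwarz function omega. *)
Definition subordinate (F G : C -> C) : Prop :=
  exists omega : C -> C,
    analytic_on unit_disk omega /\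
    omega (RtoC 0) = RtoC 0 /\
    (forall z, unit_disk z -> unit_disk (omega z)) /\
    (forall z, unit_disk z -> F z = G (omega z)).

Definition class_A (f : C -> C) : Prop :=
  analytic_on unit_disk f /\
  exists a : nat -> C, a 0%nat = RtoC 0 /\ a 1%nat = RtoC 1 /\ expansion f a.

(* z f'(z) / f(z), with the removable singularity at the origin filled in
   (the value is 1 for a normalized f). *)
Definition starlike_quotient (f : C -> C) (z : C) : C :=
  if Ceq_dec z (RtoC 0) then RtoC 1 else (z * C_derive f z / f z)%C.

(* As Cdiv is total, the absence of zeros of f in the punctured disk, which is
   needed for z f'(z) / f(z) to make sense, has to be required explicitly. *)
Definition class_Sstar (psi : C -> C) (f : C -> C) : Prop :=
  class_A f /\
  (forall z, unit_disk z -> z <> RtoC 0 -> f z <> RtoC 0) /\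
  subordinate (starlike_quotient f) psi.

Definition class_S (f : C -> C) (g : C -> C) : Prop :=
  analytic_on unit_disk g /\
  (exists b : nat -> C, b 0%nat = RtoC 0 /\ expansion g b) /\
  subordinate g f.

Definition disk_image (f : C -> C) (w : C) : Prop :=
  exists z : C, unit_disk z /\ w = f z.

(* Topological boundary: neither an interior point of A nor of its complement. *)
Definition boundary (A : C -> Prop) (w : C) : Prop :=
  ~ @locally C_UniformSpace w A /\ ~ @locally C_UniformSpace w (fun v => ~ A v).

Definition distance (p : C) (A : C -> Prop) : Rbar :=
  Glb_Rbar (fun x : R => exists w : C, A w /\ x = Cmod (w - p)%C).

(* d(f(0), boundary of f(D)) *)
Definition bohr_distance (f : C -> C) : Rbar :=
  distance (f (RtoC 0)) (boundary (disk_image f)).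

(* sum_{k>=1} |b_k| r^k, with value p_infty in case of divergence (r >= 0).  For
   f in the class A, where a_1 = 1, this is r + sum_{n>=2} |a_n| r^n. *)
Definition majorant (b : nat -> C) (r : R) : Rbar :=
  Lim_seq (fun n => sum_n_m (fun k => Cmod (b k) * r ^ k) 1 n).

Definition bohr_S (f : C -> C) (rho : R) : Prop :=
  forall (g : C -> C) (b : nat -> C), class_S f g -> expansion g b ->
  forall r : R, 0 <= r <= rho -> Rbar_le (majorant b r) (bohr_distance f).

Definition bohr_Sstar (psi : C -> C) (rho : R) : Prop :=
  forall (f : C -> C) (a : nat -> C), class_Sstar psi f -> expansion f a ->
  forall r : R, 0 <= r <= rho -> Rbar_le (majorant a r) (bohr_distance f).

(* Sharpness for f0: f = f0 is admissible for the class S*(psi), g = f = f0 is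
   admissible for S_f(psi), and the (common) Bohr inequality fails for r > r0. *)
Definition sharp_for (psi : C -> C) (f0 : C -> C) (r0 : R) : Prop :=
  class_Sstar psi f0 /\ class_S f0 f0 /\
  forall a : nat -> C, expansion f0 a ->
  forall r : R, r0 < r < 1 -> ~ Rbar_le (majorant a r) (bohr_distance f0).

Definition Cexp (z : C) : C :=
  (exp (Re z) * cos (Im z), exp (Re z) * sin (Im z)).

(* Principal argument, in (-PI, PI] for z <> 0. *)
Definition Carg (z : C) : R :=
  if Rle_dec 0 (Im z) then acos (Re z / Cmod z) else - acos (Re z / Cmod z).

Definition Clog (z : C) : C := (ln (Cmod z), Carg z).

(* Principal branch of z^p. *)
Definition Cpower (z : C) (p : R) : C := Cexp (RtoC p * Clog z)%C.

Definition janowski (D E : R) (z : C) : C :=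
  ((RtoC 1 + RtoC D * z) / (RtoC 1 + RtoC E * z))%C.

Definition janowski_f0 (D E : R) (z : C) : C :=
  if Req_dec_T E 0
  then (z * Cexp (RtoC D * z))%C
  else (z * Cpower (RtoC 1 + RtoC E * z) ((D - E) / E))%C.

(* prod_{k=2}^n (D - (k-1) E) / (k-1); note that seq 2 (n-1) = [2; ...; n]. *)
Definition janowski_t (D E : R) (n : nat) : R :=
  fold_right Rmult 1
    (map (fun k => (D - (INR k - 1) * E) / (INR k - 1)) (seq 2 (n - 1))).

(* Main.v *)
Require Import Defs.
From Stdlib Require Import Reals Lra Lia Classical ClassicalEpsilon List Ranalysis5.
From Coquelicot Require Import Coquelicot.
Open Scope R_scope.

(** Let h0 (z) = f0 (z) / z.  It solves (1 + E z) h0' = (D - E) h0 with h0 (0) = 1, and eta is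
its restriction to the real axis.  Positivity of all the products t_n forces E <= 0, so the
Taylor coefficients of h0 are positive and f0 (r) = r eta (r) is the majorant series of f0.
The claim is that, for every f in the class, the majorant series of f at r <= 1/3 is at most
r eta (r), while every boundary point of f (D) has modulus at least eta (-1) = - f0 (-1).
The number r0 is where r eta (r) reaches eta (-1); the hypotheses (D >= (3/4) log 3, respectively
the inequality between powers) say exactly that r0 <= 1/3.

Upper bound.  Write a Schwarz function as omega (z) = z phi (z) with phi ~ sum c_k z^k.  Then
|phi| <= 1, Wiener's inequality gives |c_n| <= 1 - |c_0|^2, and hence sum |c_k| r^k <= 1 for
r <= 1/3, which is Bohr's theorem ([bohr_inequality]).  Since partial majorants are
submultiplicative, composing with omega does not increase the majorant at such r: if g is
subordinate to f, its majorant is at most that of f ([subordinate_partial_majorant]).  The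
individual coefficients of f are not bounded by those of f0 (take z exp (D z^2 / 2) for E = 0 and D < 1),
but the same inequality applied to z f'/f = (1 + D omega) / (1 + E omega) shows that the majorant T
of f (z) / z satisfies (1 + E r) T' <= (D - E) T on [0, 1/3].  Comparison with the equation
for eta gives T <= eta ([starlike_majorant]).

Lower bound.  Along a ray, the derivative of log |f (z) / z| is the real part of
(D - E) phi / (1 + E z phi) times a unit number, which is smallest for f0 on the negative axis;
so |f (z)| >= |z| eta (- |z|) ([growth]).  As f' has no zero, f is open, and a maximality
argument on the segment from 0 to w shows that f (D) contains the disk of radius eta (-1)
([covering], [bohr_distance_ge]).

Sharpness.  f0 maps the upper half plane part of the disk into the upper half plane, by a
comparison of the angles of the triangle with vertices 0, 1, - E z ([f0_upper_half_plane]).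
Hence the real values of f0 stay above - eta (-1), which is then a boundary point of f0 (D)
([f0_bohr_distance_le]), whereas the majorant of f0 at r > r0 exceeds eta (-1).

The Schwarz functions involved are only given by local power series.  The estimates for them are
derived from finite Taylor expansions with bounded remainder
(jets) at each point, a maximum principle for functions with such expansions, and averages over
roots of unity. *)

(** * Finite Taylor expansions *)

Lemma Rlt_Rmin x a b : x < Rmin a b -> x < a /\ x < b.
Proof. apply Rmin_Rgt_l. Qed.

(** F (z) = a_0 + a_1 z + ... + a_(n-1) z^(n-1) + O (z^n) near 0.  The expansion is peeled off one
term at a time, F = a_0 + z F1, so that products, inverses and compositions are treated by
induction on the order, without manipulating truncated sums. *)
Fixpoint jet (n : nat) (F : C -> C) (a : nat -> C) : Prop :=
  match n with
  | O => exists K d, 0 < d /\ forall z, Cmod z < d -> Cmod (F z) <= K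
  | S m => exists F1 d, 0 < d /\
      (forall z, Cmod z < d -> F z = (a 0%nat + z * F1 z)%C) /\
      jet m F1 (fun k => a (S k))
  end.

(** Recursion on the first factor: it follows the decomposition F G = a_0 G + z F1 G. *)
Fixpoint cauchy_product (a b : nat -> C) (n : nat) : C :=
  match n with
  | O => (a 0%nat * b 0%nat)%C
  | S m => (a 0%nat * b (S m) + cauchy_product (fun k => a (S k)) b m)%C
  end.

(** The sum of |a_k| r^k over k < n in Horner form, which matches the recursion of [jet]. *)
Fixpoint partial_majorant (n : nat) (r : R) (a : nat -> C) : R :=
  match n with
  | O => 0
  | S m => Cmod (a 0%nat) + r * partial_majorant m r (fun k => a (S k))
  end.

Lemma jet_ext_coef n : forall F a b,
  (forall k, (k < n)%nat -> a k = b k) -> jet n F a -> jet n F b.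
Proof.
  induction n as [|n IH]; intros F a b Hab; simpl; [easy|].
  intros (F1 & d & Hd & HF & H). exists F1, d. split; [easy|]. split.
  - intros z Hz. rewrite <- (Hab 0%nat) by lia. now apply HF.
  - apply (IH F1 (fun k => a (S k))); [|easy]. intros k Hk. apply Hab. lia.
Qed.

Lemma jet_ext n F G a d :
  0 < d -> (forall z, Cmod z < d -> F z = G z) -> jet n F a -> jet n G a.
Proof.
  intros Hd HFG. destruct n as [|n]; simpl.
  - intros (K & d' & Hd' & H). exists K, (Rmin d d'). split.
    + now apply Rmin_glb_lt.
    + intros z Hz. rewrite <- HFG. apply H.
      eapply Rlt_le_trans; [exact Hz | apply Rmin_r].
      eapply Rlt_le_trans; [exact Hz | apply Rmin_l].
  - intros (F1 & d' & Hd' & HF & H). exists F1, (Rmin d d'). split; [|split; [|easy]].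
    + now apply Rmin_glb_lt.
    + intros z Hz. rewrite <- HFG. apply HF.
      eapply Rlt_le_trans; [exact Hz | apply Rmin_r].
      eapply Rlt_le_trans; [exact Hz | apply Rmin_l].
Qed.

Lemma jet_bounded n : forall F a, jet n F a ->
  exists K d, 0 < d /\ forall z, Cmod z < d -> Cmod (F z) <= K.
Proof.
  induction n as [|n IH]; intros F a; simpl; [easy|].
  intros (F1 & d & Hd & HF & H). destruct (IH _ _ H) as (K & d' & Hd' & HK).
  exists (Cmod (a 0%nat) + d' * K), (Rmin d d'). split; [now apply Rmin_glb_lt|].
  intros z Hz. destruct (Rlt_Rmin _ _ _ Hz) as [Hz1 Hz2]. rewrite HF by easy.
  eapply Rle_trans; [apply Cmod_triangle|]. rewrite Cmod_mult.
  assert (H0 := HK z Hz2). assert (H1 := Cmod_ge_0 z). assert (H2 := Cmod_ge_0 (F1 z)).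
  nra.
Qed.

Lemma jet_weaken n : forall F a, jet (S n) F a -> jet n F a.
Proof.
  induction n as [|n IH]; intros F a H.
  - exact (jet_bounded 1 F a H).
  - destruct H as (F1 & d & Hd & HF & H). exists F1, d. repeat split; try easy.
    now apply IH.
Qed.

Lemma jet_le n m F a : (m <= n)%nat -> jet n F a -> jet m F a.
Proof.
  induction 1 as [|n H IH]; [easy|]. intros H1. apply IH. now apply jet_weaken.
Qed.

Lemma jet_at_0 n F a : jet (S n) F a -> F 0 = a 0%nat.
Proof.
  intros (F1 & d & Hd & HF & H). rewrite HF. ring. now rewrite Cmod_0.
Qed.

Lemma jet_const n : forall c, jet n (fun _ => c) (fun k => match k with O => c | _ => RtoC 0 end).
Proof.
  induction n as [|n IH]; intros c.
  - exists (Cmod c), 1. split; [lra|]. intros; lra.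
  - exists (fun _ => RtoC 0), 1. split; [lra|]. split.
    + intros; ring.
    + apply jet_ext_coef with (2 := IH (RtoC 0)). now intros [|k].
Qed.

Lemma jet_plus n : forall F G a b,
  jet n F a -> jet n G b -> jet n (fun z => F z + G z)%C (fun k => a k + b k)%C.
Proof.
  induction n as [|n IH]; intros F G a b.
  - intros (K & d & Hd & H) (K' & d' & Hd' & H'). exists (K + K'), (Rmin d d').
    split; [now apply Rmin_glb_lt|]. intros z Hz.
    destruct (Rlt_Rmin _ _ _ Hz) as [Hz1 Hz2].
    eapply Rle_trans; [apply Cmod_triangle|]. apply Rplus_le_compat; auto.
  - intros (F1 & d & Hd & HF & H) (G1 & d' & Hd' & HG & H').
    exists (fun z => F1 z + G1 z)%C, (Rmin d d'). split; [now apply Rmin_glb_lt|].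
    split; [|now apply (IH F1 G1 (fun k => a (S k)) (fun k => b (S k)))]. intros z Hz.
    destruct (Rlt_Rmin _ _ _ Hz) as [Hz1 Hz2].
    rewrite HF, HG by easy. ring.
Qed.

Lemma jet_scal n c : forall F a, jet n F a -> jet n (fun z => c * F z)%C (fun k => c * a k)%C.
Proof.
  induction n as [|n IH]; intros F a.
  - intros (K & d & Hd & H). exists (Cmod c * K), d. split; [easy|]. intros z Hz.
    rewrite Cmod_mult. apply Rmult_le_compat_l; [apply Cmod_ge_0|auto].
  - intros (F1 & d & Hd & HF & H). exists (fun z => c * F1 z)%C, d. split; [easy|].
    split; [|now apply (IH F1 (fun k => a (S k)))].
    intros z Hz. rewrite HF by easy. ring.
Qed.

Lemma jet_shift n F a : jet n F a ->
  jet (S n) (fun z => z * F z)%C (fun k => match k with O => RtoC 0 | S k => a k end).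
Proof.
  intros H. exists F, 1. split; [lra|]. split; [|easy]. intros; ring.
Qed.

(** With F = a_0 + z F1 and G = b_0 + z G1, the product is a_0 b_0 + z (a_0 G1 + F1 G), and
both terms of the parenthesis are known to the order n. *)
Lemma jet_mult n : forall F G a b,
  jet n F a -> jet n G b -> jet n (fun z => F z * G z)%C (cauchy_product a b).
Proof.
  induction n as [|n IH]; intros F G a b.
  - intros (K & d & Hd & H) (K' & d' & Hd' & H'). exists (K * K'), (Rmin d d').
    split; [now apply Rmin_glb_lt|]. intros z Hz.
    destruct (Rlt_Rmin _ _ _ Hz) as [Hz1 Hz2].
    rewrite Cmod_mult. apply Rmult_le_compat; auto using Cmod_ge_0.
  - intros (F1 & d & Hd & HF & H) HG0. assert (HG' := jet_weaken _ _ _ HG0).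
    destruct HG0 as (G1 & d' & Hd' & HG & H').
    exists (fun z => a 0%nat * G1 z + F1 z * G z)%C, (Rmin d d').
    split; [now apply Rmin_glb_lt|]. split.
    + intros z Hz.
      destruct (Rlt_Rmin _ _ _ Hz) as [Hz1 Hz2].
      rewrite HF, HG by easy. simpl. ring.
    + apply (jet_plus n _ _ (fun k => a 0%nat * b (S k))%C
               (cauchy_product (fun k => a (S k)) b)).
      * now apply (jet_scal n (a 0%nat) G1 (fun k => b (S k))).
      * now apply IH.
Qed.

Lemma jet_inv n : forall F a, jet (S n) F a -> a 0%nat <> 0 ->
  exists b, jet (S n) (fun z => / F z)%C b /\ b 0%nat = (/ a 0%nat)%C.
Proof.
  (* 1/F = 1/a0 - z (F1 / a0) (1/F), and 1/F is known to one order less *)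
  assert (Hinv0 : forall F a, jet 1 F a -> a 0%nat <> 0 ->
      exists K d, 0 < d /\ forall z, Cmod z < d -> F z <> 0 /\ Cmod (/ F z) <= K).
  { intros F a (F1 & d & Hd & HF & (K & d' & Hd' & HK)) Ha.
    assert (Ha' : 0 < Cmod (a 0%nat)) by now apply Cmod_gt_0.
    assert (HK' : 0 <= Rabs K) by apply Rabs_pos.
    set (e := Cmod (a 0%nat) / 2 / (Rabs K + 1)).
    assert (He : 0 < e) by (unfold e; apply Rdiv_lt_0_compat; lra).
    exists (2 / Cmod (a 0%nat)), (Rmin (Rmin d d') e).
    split; [repeat apply Rmin_glb_lt; easy|]. intros z Hz.
    destruct (Rlt_Rmin _ _ _ Hz) as [Hz0 Hz3].
    destruct (Rlt_Rmin _ _ _ Hz0) as [Hz1 Hz2].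
    assert (HL : Cmod (a 0%nat) / 2 <= Cmod (F z)).
    { assert (Cmod (a 0%nat) <= Cmod (F z) + Cmod (z * F1 z)).
      { replace (a 0%nat) with (F z + - (z * F1 z))%C.
        eapply Rle_trans; [apply Cmod_triangle|]. rewrite Cmod_opp. lra.
        rewrite HF by easy. ring. }
      assert (Cmod (z * F1 z) <= Cmod (a 0%nat) / 2).
      { rewrite Cmod_mult.
        assert (H1 := HK z Hz2). assert (H2 := Rle_abs K). assert (H3 := Cmod_ge_0 z).
        apply Rle_trans with (e * (Rabs K + 1)).
        - apply Rmult_le_compat; try lra; apply Cmod_ge_0.
        - unfold e. right. field. lra. }
      lra. }
    assert (HF0 : F z <> 0). { apply Cmod_gt_0. lra. }
    split; [easy|]. rewrite Cmod_inv by easy.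
    replace (2 / Cmod (a 0%nat)) with (/ (Cmod (a 0%nat) / 2)) by (field; lra).
    apply Rinv_le_contravar; lra. }
  induction n as [|n IH]; intros F a H Ha.
  - destruct (Hinv0 F a H Ha) as (K & d & Hd & HK).
    destruct H as (F1 & d' & Hd' & HF & (K' & d'' & Hd'' & HK')).
    exists (fun k => / a 0%nat)%C. split; [|easy].
    exists (fun z => - (/ a 0%nat) * (F1 z * / F z))%C, (Rmin d d'). split; [now apply Rmin_glb_lt|].
    split.
    + intros z Hz.
      destruct (Rlt_Rmin _ _ _ Hz) as [Hz1 Hz2].
      destruct (HK z Hz1) as [HFz _]. rewrite HF in HFz |- * by easy. field. easy.
    + apply (jet_scal 0 _ _ (fun _ => RtoC 0)).
      apply (jet_mult 0 _ _ (fun _ => RtoC 0) (fun _ => RtoC 0)).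
      * exists K', d''. easy.
      * exists K, d. split; [easy|]. intros z Hz. now apply HK.
  - destruct (IH F a (jet_weaken _ _ _ H) Ha) as (b & Hb & Hb0).
    destruct (Hinv0 F a (jet_le (S (S n)) 1 F a ltac:(lia) H) Ha) as (K & d & Hd & HK).
    destruct H as (F1 & d' & Hd' & HF & H).
    exists (fun k => match k with O => (/ a 0%nat)%C | S k =>
       (- (/ a 0%nat) * (cauchy_product (fun k => a (S k)) b k))%C end). split; [|easy].
    exists (fun z => - (/ a 0%nat) * (F1 z * / F z))%C, (Rmin d d'). split; [now apply Rmin_glb_lt|].
    split.
    + intros z Hz.
      destruct (Rlt_Rmin _ _ _ Hz) as [Hz1 Hz2].
      destruct (HK z Hz1) as [HFz _]. rewrite HF in HFz |- * by easy. field. easy.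
    + apply (jet_scal (S n)). now apply (jet_mult (S n)).
Qed.

Lemma jet_rot n c : Cmod c <= 1 -> forall F a, jet n F a ->
  jet n (fun z => F (c * z))%C (fun k => c ^ k * a k)%C.
Proof.
  intros Hc. assert (Hcz : forall z d, Cmod z < d -> Cmod (c * z) < d).
  { intros z d Hz. rewrite Cmod_mult. assert (H := Cmod_ge_0 z). assert (H' := Cmod_ge_0 c). nra. }
  induction n as [|n IH]; intros F a.
  - intros (K & d & Hd & H). exists K, d. split; [easy|]. intros z Hz. auto.
  - intros (F1 & d & Hd & HF & H). exists (fun z => c * F1 (c * z))%C, d. split; [easy|]. split.
    + intros z Hz. rewrite HF by auto. simpl. ring.
    + assert (H1 := jet_scal n c _ _ (IH _ _ H)). apply jet_ext_coef with (2 := H1).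
      intros k _. simpl. ring.
Qed.

Lemma partial_majorant_nonneg n r : 0 <= r -> forall a, 0 <= partial_majorant n r a.
Proof.
  intros Hr. induction n as [|n IH]; intros a; simpl; [lra|].
  assert (H := IH (fun k => a (S k))). assert (H' := Cmod_ge_0 (a 0%nat)). nra.
Qed.

Lemma partial_majorant_S n r : 0 <= r -> forall a, partial_majorant n r a <= partial_majorant (S n) r a.
Proof.
  intros Hr. induction n as [|n IH]; intros a.
  - apply (partial_majorant_nonneg 1 r Hr).
  - assert (H := IH (fun k => a (S k))). simpl in *. nra.
Qed.

Lemma partial_majorant_ext n r : forall a b, (forall k, (k < n)%nat -> Cmod (a k) = Cmod (b k)) -> partial_majorant n r a = partial_majorant n r b.
Proof.
  induction n as [|n IH]; intros a b Hab; simpl; [easy|].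
  rewrite (Hab 0%nat) by lia. f_equal. f_equal. apply IH. intros k Hk. apply Hab. lia.
Qed.

Lemma partial_majorant_plus n r : 0 <= r -> forall a b, partial_majorant n r (fun k => a k + b k)%C <= partial_majorant n r a + partial_majorant n r b.
Proof.
  intros Hr. induction n as [|n IH]; intros a b; simpl; [lra|].
  assert (H := IH (fun k => a (S k)) (fun k => b (S k))). simpl in H.
  assert (H' := Cmod_triangle (a 0%nat) (b 0%nat)). nra.
Qed.

Lemma partial_majorant_scal n r c : forall a, partial_majorant n r (fun k => c * a k)%C = Cmod c * partial_majorant n r a.
Proof.
  induction n as [|n IH]; intros a; simpl; [ring|].
  rewrite (IH (fun k => a (S k))), Cmod_mult. ring.
Qed.

Lemma partial_majorant_mult n r : 0 <= r -> forall a b,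
  partial_majorant n r (cauchy_product a b) <= partial_majorant n r a * partial_majorant n r b.
Proof.
  intros Hr. induction n as [|n IH]; intros a b; [simpl; lra|].
  assert (H := IH (fun k => a (S k)) b).
  change (partial_majorant (S n) r (cauchy_product a b)) with (Cmod (a 0%nat * b 0%nat)%C + r *
    partial_majorant n r (fun k => a 0%nat * b (S k) + cauchy_product (fun k => a (S k)) b k)%C).
  assert (H1 := partial_majorant_plus n r Hr (fun k => a 0%nat * b (S k))%C (cauchy_product (fun k => a (S k)) b)).
  rewrite (partial_majorant_scal n r (a 0%nat) (fun k => b (S k))) in H1.
  assert (H2 := partial_majorant_S n r Hr b). simpl in *. rewrite Cmod_mult.
  assert (Ha := Cmod_ge_0 (a 0%nat)). assert (Hb := Cmod_ge_0 (b 0%nat)).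
  assert (Ha1 := partial_majorant_nonneg n r Hr (fun k => a (S k))).
  assert (Hb1 := partial_majorant_nonneg n r Hr (fun k => b (S k))).
  set (A := partial_majorant n r (fun k => a (S k))) in *. set (B := partial_majorant n r (fun k => b (S k))) in *.
  set (X := partial_majorant n r b) in *.
  assert (A * X <= A * (Cmod (b 0%nat) + r * B)) by now apply Rmult_le_compat_l.
  assert (r * (A * X) <= r * (A * (Cmod (b 0%nat) + r * B))) by now apply Rmult_le_compat_l.
  assert (r * partial_majorant n r (fun k => a 0%nat * b (S k) + cauchy_product (fun k => a (S k)) b k)%C
     <= r * (Cmod (a 0%nat) * B + A * X)) by (apply Rmult_le_compat_l; lra).
  nra.
Qed.

(** Composition with z phi (z), the form taken by a Schwarz function: if F = a_0 + u F1 then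
F (z phi) = a_0 + z phi F1 (z phi).  By submultiplicativity each step multiplies the majorant
of F1 (z phi) by at most that of phi, so it does not grow when the majorant of phi is at most 1. *)
Lemma jet_comp n : forall F a phi c, jet n F a -> jet (pred n) phi c ->
  exists e, jet n (fun z => F (z * phi z))%C e /\
    ((0 < n)%nat -> e 0%nat = a 0%nat) /\ ((1 < n)%nat -> e 1%nat = (c 0%nat * a 1%nat)%C) /\
    forall r, 0 <= r -> partial_majorant (pred n) r c <= 1 -> partial_majorant n r e <= partial_majorant n r a.
Proof.
  assert (Hsmall : forall n phi c d, jet n phi c -> 0 < d ->
    exists d', 0 < d' /\ forall z, Cmod z < d' -> Cmod (z * phi z) < d).
  { intros m phi c d H Hd. destruct (jet_bounded _ _ _ H) as (K & d' & Hd' & HK).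
    assert (HK' : 0 <= Rabs K) by apply Rabs_pos.
    exists (Rmin d' (d / (Rabs K + 1))). split.
    - apply Rmin_glb_lt; [easy|]. apply Rdiv_lt_0_compat; lra.
    - intros z Hz. destruct (Rlt_Rmin _ _ _ Hz) as [Hz1 Hz2].
      assert (H1 := HK z Hz1). assert (H2 := Rle_abs K). rewrite Cmod_mult.
      assert (H3 := Cmod_ge_0 z). assert (H4 := Cmod_ge_0 (phi z)).
      apply Rle_lt_trans with (Cmod z * (Rabs K + 1)); [apply Rmult_le_compat_l; lra|].
      replace d with (d / (Rabs K + 1) * (Rabs K + 1)) by (field; lra).
      apply Rmult_lt_compat_r; lra. }
  induction n as [|n IH]; intros F a phi c HF Hphi.
  - exists (fun _ => RtoC 0). split; [|split; [lia|split; [lia|simpl; intros; lra]]].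
    destruct HF as (K & d & Hd & HK). destruct (Hsmall _ _ _ d Hphi Hd) as (d' & Hd' & H').
    exists K, d'. split; [easy|]. intros z Hz. apply HK. auto.
  - simpl in Hphi. destruct HF as (F1 & d & Hd & HF & H).
    destruct (IH F1 (fun k => a (S k)) phi c H (jet_le n (pred n) _ _ ltac:(lia) Hphi))
      as (e & He & He0 & He1 & Hr).
    destruct (Hsmall _ _ _ d Hphi Hd) as (d' & Hd' & H').
    exists (fun k => match k with O => a 0%nat | S k => cauchy_product c e k end).
    split; [|split; [easy|split]].
    + exists (fun z => phi z * F1 (z * phi z))%C, d'. split; [easy|]. split.
      * intros z Hz. rewrite HF by auto. simpl. ring.
      * now apply jet_mult.
    + intros Hn. simpl. rewrite He0 by lia. easy.
    + intros r Hr0 Hc. simpl pred in Hc.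
      assert (Hc' : partial_majorant (pred n) r c <= 1).
      { destruct n as [|n]; [simpl; lra|]. simpl pred.
        assert (X := partial_majorant_S n r Hr0 c). lra. }
      assert (H1 := Hr r Hr0 Hc'). assert (H2 := partial_majorant_mult n r Hr0 c e).
      change (Cmod (a 0%nat) + r * partial_majorant n r (cauchy_product c e)
              <= Cmod (a 0%nat) + r * partial_majorant n r (fun k => a (S k))).
      apply Rplus_le_compat_l, Rmult_le_compat_l; [easy|].
      assert (H3 := partial_majorant_nonneg n r Hr0 e). assert (H4 := partial_majorant_nonneg n r Hr0 c). nra.
Qed.

Lemma Cmod_small_eq (x : C) (K d : R) :
  0 < d -> (forall s, 0 < s < d -> Cmod x <= s * K) -> x = 0.
Proof.
  intros Hd H. apply Cmod_eq_0. assert (Hx := Cmod_ge_0 x).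
  destruct (Rle_lt_or_eq_dec _ _ Hx) as [Hx'|]; [exfalso|easy].
  assert (HK := Rabs_pos K). assert (HK' := Rle_abs K).
  assert (He : 0 < Cmod x / 2 / (Rabs K + 1)) by (apply Rdiv_lt_0_compat; lra).
  set (s := Rmin (d / 2) (Cmod x / 2 / (Rabs K + 1))).
  assert (Hs : 0 < s) by (apply Rmin_glb_lt; lra).
  assert (Hs1 : s <= d / 2) by apply Rmin_l.
  assert (Hs2 : s <= Cmod x / 2 / (Rabs K + 1)) by apply Rmin_r.
  assert (H1 := H s ltac:(lra)).
  assert (s * (Rabs K + 1) <= Cmod x / 2).
  { apply Rle_trans with (Cmod x / 2 / (Rabs K + 1) * (Rabs K + 1)).
    - apply Rmult_le_compat_r; lra.
    - right. field. lra. }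
  nra.
Qed.

(** The constant terms agree because both remainders are O (z); then divide by z.  Agreement
off 0 suffices for this, so that quotients by z may be compared directly. *)
Lemma jet_unique n : forall (F G : C -> C) a b d, 0 < d ->
  (forall z : C, z <> RtoC 0 -> Cmod z < d -> F z = G z) ->
  jet n F a -> jet n G b -> forall k, (k < n)%nat -> a k = b k.
Proof.
  induction n as [|n IH]; intros F G a b d Hd HFG HF HG k Hk; [lia|].
  destruct HF as (F1 & d1 & Hd1 & HF & HF'). destruct HG as (G1 & d2 & Hd2 & HG & HG').
  destruct (jet_bounded _ _ _ HF') as (K1 & d3 & Hd3 & HK1).
  destruct (jet_bounded _ _ _ HG') as (K2 & d4 & Hd4 & HK2).
  set (m := Rmin (Rmin d d1) (Rmin d2 (Rmin d3 d4))).
  assert (Hm : 0 < m) by (repeat apply Rmin_glb_lt; easy).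
  assert (Hm' : m <= d /\ m <= d1 /\ m <= d2 /\ m <= d3 /\ m <= d4).
  { unfold m. repeat split.
    - eapply Rle_trans; [apply Rmin_l|apply Rmin_l].
    - eapply Rle_trans; [apply Rmin_l|apply Rmin_r].
    - eapply Rle_trans; [apply Rmin_r|apply Rmin_l].
    - eapply Rle_trans; [apply Rmin_r|]. eapply Rle_trans; [apply Rmin_r|apply Rmin_l].
    - eapply Rle_trans; [apply Rmin_r|]. eapply Rle_trans; [apply Rmin_r|apply Rmin_r]. }
  assert (H0 : a 0%nat = b 0%nat).
  { apply Ceq_minus. apply (Cmod_small_eq _ (K1 + K2) m Hm). intros s Hs.
    assert (Hcs : Cmod (RtoC s) = s) by (rewrite Cmod_R; apply Rabs_pos_eq; lra).
    assert (Hs0 : RtoC s <> 0) by (intros E; apply RtoC_inj in E; lra).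
    replace (a 0%nat - b 0%nat)%C with (RtoC s * (G1 s + - F1 s))%C.
    - rewrite Cmod_mult, Hcs. apply Rmult_le_compat_l; [lra|].
      eapply Rle_trans; [apply Cmod_triangle|]. rewrite Cmod_opp.
      assert (X1 := HK1 s ltac:(lra)). assert (X2 := HK2 s ltac:(lra)). lra.
    - assert (X := HFG s Hs0 ltac:(lra)). rewrite HF, HG in X by lra.
      transitivity ((b 0%nat + s * G1 s) - (a 0%nat + s * F1 s) + (a 0%nat - b 0%nat))%C; [ring|].
      rewrite X. ring. }
  destruct k as [|k]; [easy|].
  apply (IH F1 G1 (fun k => a (S k)) (fun k => b (S k)) m Hm); try easy; [|lia].
  intros z Hz Hzm. assert (X := HFG z Hz ltac:(lra)). rewrite HF, HG, H0 in X by lra.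
  replace (F1 z) with ((b 0%nat + z * F1 z - b 0%nat) / z)%C by (field; easy).
  rewrite X. field. easy.
Qed.

Lemma jet_tail n : forall F a m, jet (n + m) F a ->
  (forall k, (k < n)%nat -> a k = RtoC 0) ->
  exists G d, 0 < d /\ (forall z, Cmod z < d -> F z = (z ^ n * G z)%C) /\ jet m G (fun k => a (n + k)%nat).
Proof.
  induction n as [|n IH]; intros F a m H Ha.
  - exists F, 1. split; [lra|]. split; [intros; simpl; ring|easy].
  - destruct H as (F1 & d & Hd & HF & H).
    destruct (IH F1 (fun k => a (S k)) m H) as (G & d' & Hd' & HG & HG').
    { intros k Hk. apply Ha. lia. }
    exists G, (Rmin d d'). split; [now apply Rmin_glb_lt|]. split; [|easy].
    intros z Hz.
    destruct (Rlt_Rmin _ _ _ Hz) as [Hz1 Hz2].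
    rewrite HF, HG, (Ha 0%nat) by (easy || lia). simpl. ring.
Qed.

(** * Power series and complex derivatives *)

Notation ps := (@is_pseries C_AbsRing C_NormedModule).

(** Neighbourhoods in C are defined by squares; the estimates below use disks. *)
Lemma locally_Cmod (z : C) (P : C -> Prop) :
  @locally C_UniformSpace z P <->
  exists d, 0 < d /\ forall w, Cmod (w - z) < d -> P w.
Proof.
  split.
  - intros [e He]. exists e. split; [apply cond_pos|]. intros w Hw. apply He.
    apply C_NormedModule_mixin_compat1. exact Hw.
  - intros (d & Hd & H).
    assert (Hs : 0 < sqrt 2) by (apply sqrt_lt_R0; lra).
    assert (He : 0 < d / sqrt 2) by (apply Rdiv_lt_0_compat; lra).
    exists (mkposreal _ He). intros w Hw. apply H.
    apply (C_NormedModule_mixin_compat2 z w (mkposreal _ He)) in Hw. simpl in Hw.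
    replace (sqrt 2 * (d / sqrt 2)) with d in Hw by (field; lra). exact Hw.
Qed.

Lemma ps_unique (a : nat -> C) (z l l' : C) : ps a z l -> ps a z l' -> l = l'.
Proof.
  intros H H'. eapply (@filterlim_locally_unique nat C_AbsRing C_NormedModule eventually _ _ _ _ H H').
Qed.

Lemma ps_eq_series (a : nat -> C) (z l : C) :
  ps a z l <-> @is_series C_AbsRing C_NormedModule (fun k => a k * z ^ k)%C l.
Proof.
  assert (E : forall k, @scal C_AbsRing C_NormedModule (@pow_n C_AbsRing z k) (a k) = (a k * z ^ k)%C).
  { intros k. replace (@pow_n C_AbsRing z k) with (z ^ k)%C.
    - apply Cmult_comm.
    - induction k as [|k IH]; [easy|]. simpl. now rewrite IH. }
  split; apply is_series_ext; intros k; [|symmetry]; apply E.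
Qed.

Lemma series_terms_bounded (u : nat -> C) (l : C) :
  @is_series C_AbsRing C_NormedModule u l -> exists K, forall k, Cmod (u k) <= K.
Proof.
  intros H. destruct (@filterlim_bounded C_AbsRing C_NormedModule (sum_n u)) as [M HM].
  { exists l. exact H. }
  assert (HM' : forall n, Cmod (sum_n u n) <= M) by (intros n; exact (HM n)).
  exists (2 * M). intros k.
  assert (H0 : 0 <= M) by (eapply Rle_trans; [apply Cmod_ge_0|apply (HM' 0%nat)]).
  destruct k as [|k].
  - assert (X := HM' 0%nat). rewrite sum_O in X. lra.
  - assert (X := HM' (S k)). rewrite sum_Sn in X. assert (Y := HM' k).
    replace (u (S k)) with ((sum_n u k + u (S k)) + - sum_n u k)%C by ring.
    eapply Rle_trans; [apply Cmod_triangle|]. rewrite Cmod_opp.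
    change (plus (sum_n u k) (u (S k))) with (sum_n u k + u (S k))%C in X. lra.
Qed.

Lemma series_norm_le (u : nat -> C) (l : C) (v : nat -> R) s :
  @is_series C_AbsRing C_NormedModule u l -> is_series v s ->
  (forall k, Cmod (u k) <= v k) -> Cmod l <= s.
Proof.
  intros Hu Hv Huv.
  assert (H1 : is_lim_seq (fun n => Cmod (sum_n u n)) (Cmod l)).
  { apply (filterlim_comp _ _ _ (sum_n u) (@norm C_AbsRing C_NormedModule) eventually
       (@locally C_UniformSpace l) (Rbar_locally (Cmod l))); [exact Hu|].
    apply (@filterlim_norm C_AbsRing C_NormedModule). }
  assert (H2 : is_lim_seq (sum_n v) s) by exact Hv.
  apply (is_lim_seq_le _ _ (Cmod l) s) with (2 := H1) (3 := H2).
  intros n. induction n as [|n IH].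
  - rewrite !sum_O. apply Huv.
  - rewrite !sum_Sn. eapply Rle_trans; [apply Cmod_triangle|].
    apply Rplus_le_compat; [exact IH|apply Huv].
Qed.

Lemma series_ex (u : nat -> C) (v : nat -> R) :
  (forall k, Cmod (u k) <= v k) -> ex_series v ->
  exists l : C, @is_series C_AbsRing C_NormedModule u l.
Proof.
  intros H Hv. destruct (@ex_series_le C_AbsRing C_CompleteNormedModule u v) as [l Hl]; [|exact Hv|].
  - intros k. exact (H k).
  - exists l. exact Hl.
Qed.

(** Abel's lemma: bounded terms on the circle of radius rho give a geometric majorant inside. *)
Lemma ps_geometric (a : nat -> C) rho K (z : C) : 0 < rho -> (forall k, Cmod (a k) * rho ^ k <= K) ->
  Cmod z < rho -> exists l : C, ps a z l /\ Cmod l <= K / (1 - Cmod z / rho).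
Proof.
  intros Hrho HK Hz. set (q := Cmod z / rho).
  assert (Hq : 0 <= q < 1).
  { unfold q. split; [apply Rdiv_le_0_compat; [apply Cmod_ge_0|lra]|].
    apply (Rmult_lt_reg_r rho); [easy|]. unfold Rdiv. rewrite Rmult_assoc, Rinv_l; lra. }
  assert (Hle : forall k, Cmod (a k * z ^ k)%C <= K * q ^ k).
  { intros k. rewrite Cmod_mult, Cmod_pow.
    replace (Cmod z) with (rho * q) by (unfold q; field; lra). rewrite Rpow_mult_distr.
    rewrite <- Rmult_assoc. apply Rmult_le_compat_r; [apply pow_le; lra|apply HK]. }
  assert (Hg : is_series (fun k => K * q ^ k) (K * / (1 - q))).
  { apply (@is_series_scal R_AbsRing R_NormedModule K). apply is_series_geom.
    rewrite Rabs_pos_eq; lra. }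
  destruct (series_ex (fun k => a k * z ^ k)%C (fun k => K * q ^ k) Hle) as [l Hl].
  { eexists. exact Hg. }
  exists l. split; [now apply ps_eq_series|].
  exact (series_norm_le _ _ _ _ Hl Hg Hle).
Qed.

Lemma ps_bounded (a : nat -> C) (z l : C) : ps a z l -> exists K, forall k, Cmod (a k) * Cmod z ^ k <= K.
Proof.
  intros H. apply ps_eq_series, series_terms_bounded in H. destruct H as [K HK].
  exists K. intros k. rewrite <- Cmod_pow, <- Cmod_mult. apply HK.
Qed.

Lemma ps_at_0 (a : nat -> C) (l : C) : ps a (RtoC 0) l -> l = a 0%nat.
Proof.
  intros H. apply (ps_unique a (RtoC 0)); [easy|]. apply (@is_pseries_0 C_AbsRing C_NormedModule).
Qed.

(** The remainder of a power series after its first term is z times a power series. *)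
Lemma ps_jet n : forall (f : C -> C) (a : nat -> C) rho, 0 < rho ->
  (forall z, Cmod z < rho -> ps a z (f z)) -> jet n f a.
Proof.
  induction n as [|n IH]; intros f a rho Hrho H.
  - assert (Hc : Cmod (RtoC (rho / 2)) = rho / 2) by (rewrite Cmod_R; apply Rabs_pos_eq; lra).
    destruct (ps_bounded a (RtoC (rho / 2)) (f (RtoC (rho / 2)))) as [K HK]; [apply H; lra|].
    rewrite Hc in HK. assert (HK0 : 0 <= K).
    { eapply Rle_trans; [|apply (HK 0%nat)]. simpl. assert (X := Cmod_ge_0 (a 0%nat)). lra. }
    exists (K * 2), (rho / 4). split; [lra|]. intros z Hz.
    destruct (ps_geometric a (rho / 2) K z) as (l & Hl & Hlk); [lra|easy|lra|].
    rewrite (ps_unique _ _ _ _ (H z ltac:(lra)) Hl). eapply Rle_trans; [exact Hlk|].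
    unfold Rdiv at 1. apply Rmult_le_compat_l; [easy|].
    replace 2 with (/ (/ 2)) at 2 by field. apply Rinv_le_contravar; [lra|].
    assert (Cmod z / (rho / 2) <= / 2); [|lra].
    apply (Rmult_le_reg_r (rho / 2)); [lra|]. unfold Rdiv at 1. rewrite Rmult_assoc, Rinv_l; lra.
  - set (F1 := fun z : C => if Ceq_dec z (RtoC 0) then a 1%nat else ((f z - a 0%nat) / z)%C).
    exists F1, rho. split; [easy|]. split.
    + intros z Hz. unfold F1. destruct (Ceq_dec z (RtoC 0)) as [E|E].
      * rewrite E in *. rewrite (ps_at_0 _ _ (H _ Hz)). ring.
      * field. easy.
    + apply (IH _ _ rho Hrho). intros z Hz. unfold F1. destruct (Ceq_dec z (RtoC 0)) as [E|E].
      * rewrite E. apply (@is_pseries_0 C_AbsRing C_NormedModule (fun k => a (S k))).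
      * assert (X := @is_pseries_decr_1 C_AbsRing C_NormedModule a z (/ z)%C (f z)
                      (Cinv_l z E) (H z Hz)).
        replace ((f z - a 0%nat) / z)%C with (/ z * (f z + - a 0%nat))%C; [exact X|].
        field. easy.
Qed.

Lemma analytic_jet U f z0 : analytic_on U f -> U z0 ->
  exists a, forall n, jet n (fun h => f (z0 + h)%C) a.
Proof.
  intros H H0. destruct (H z0 H0) as [c Hc]. apply locally_Cmod in Hc.
  destruct Hc as (d & Hd & Hc). exists c. intros n. apply (ps_jet n _ _ d Hd).
  intros z Hz. assert (X := Hc (z0 + z)%C). replace (z0 + z - z0)%C with z in X by ring. auto.
Qed.

(** Differentiability with quadratic remainder.  All functions in play have it, and the rules of
calculus are then instances of the operations on jets. *)
Definition cderiv (f : C -> C) (z l : C) : Prop :=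
  exists a, jet 2 (fun h => f (z + h)%C) a /\ a 1%nat = l.

Lemma cderiv_quadratic f z l : cderiv f z l <->
  exists K d, 0 < d /\ forall h, Cmod h < d -> Cmod (f (z + h) - f z - l * h)%C <= K * Cmod h ^ 2.
Proof.
  split.
  - intros (a & H & Hl). assert (Ha := jet_at_0 _ _ _ H). simpl in Ha. rewrite Cplus_0_r in Ha.
    destruct H as (F1 & d & Hd & HF & (F2 & d' & Hd' & HF2 & (K & d'' & Hd'' & HK))).
    exists K, (Rmin d (Rmin d' d'')). split; [repeat apply Rmin_glb_lt; easy|].
    intros h Hh.
    destruct (Rlt_Rmin _ _ _ Hh) as [Hz1 Hz0].
    destruct (Rlt_Rmin _ _ _ Hz0) as [Hz2 Hz3].
    rewrite HF, HF2, <- Ha, Hl by easy.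
    replace (f z + h * (l + h * F2 h) - f z - l * h)%C with (F2 h * h ^ 2)%C by ring.
    rewrite Cmod_mult, Cmod_pow. apply Rmult_le_compat_r; [apply pow2_ge_0|auto].
  - intros (K & d & Hd & HK).
    exists (fun k => match k with O => f z | S O => l | _ => RtoC 0 end). split; [|easy].
    set (F2 := fun h : C => if Ceq_dec h (RtoC 0) then RtoC 0 else ((f (z + h) - f z - l * h) / h ^ 2)%C).
    exists (fun h => l + h * F2 h)%C, d. split; [easy|]. split.
    + intros h Hh. unfold F2. destruct (Ceq_dec h (RtoC 0)) as [E|E].
      * rewrite E. rewrite Cplus_0_r. ring.
      * simpl. field. easy.
    + exists F2, 1. split; [lra|]. split; [easy|]. exists (Rabs K), d. split; [easy|].
      intros h Hh. unfold F2. destruct (Ceq_dec h (RtoC 0)) as [E|E].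
      * rewrite Cmod_0. apply Rabs_pos.
      * assert (X := HK h Hh). rewrite Cmod_div, Cmod_pow by now apply Cpow_nz.
        assert (Hh0 : 0 < Cmod h) by now apply Cmod_gt_0.
        assert (0 < Cmod h ^ 2) by now apply pow_lt.
        apply (Rmult_le_reg_r (Cmod h ^ 2)); [easy|].
        unfold Rdiv. rewrite Rmult_assoc, Rinv_l, Rmult_1_r by lra.
        eapply Rle_trans; [exact X|]. apply Rmult_le_compat_r; [lra|apply Rle_abs].
Qed.

Lemma cderiv_C_derive f z l : cderiv f z l -> C_derive f z = l.
Proof.
  intros H. apply cderiv_quadratic in H. destruct H as (K & d & Hd & HK).
  apply is_C_lim_unique. intros P HP. apply locally_Cmod in HP. destruct HP as (e & He & HP).
  apply locally_Cmod. assert (HK0 := Rabs_pos K). assert (HK1 := Rle_abs K).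
  exists (Rmin d (e / (Rabs K + 1))). split.
  { apply Rmin_glb_lt; [easy|]. apply Rdiv_lt_0_compat; lra. }
  intros w Hw Hwz. apply HP.
  destruct (Rlt_Rmin _ _ _ Hw) as [Hw1 Hw2].
  assert (E : (w - z)%C <> RtoC 0) by now apply Cminus_eq_contra.
  assert (X := HK (w - z)%C Hw1). replace (z + (w - z))%C with w in X by ring.
  replace ((f w - f z) / (w - z) - l)%C with ((f w - f z - l * (w - z)) / (w - z))%C by (field; easy).
  rewrite Cmod_div by easy. assert (E0 : 0 < Cmod (w - z)%C) by now apply Cmod_gt_0.
  set (m := Cmod (w - z)%C) in *.
  apply Rle_lt_trans with (K * m).
  - apply (Rmult_le_reg_r m); [easy|]. unfold Rdiv. rewrite Rmult_assoc, Rinv_l by lra. nra.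
  - apply Rle_lt_trans with ((Rabs K + 1) * m); [nra|].
    replace e with ((Rabs K + 1) * (e / (Rabs K + 1))) by (field; lra).
    apply Rmult_lt_compat_l; lra.
Qed.

Lemma cderiv_ext f g z l d : 0 < d -> (forall h, Cmod h < d -> f (z + h)%C = g (z + h)%C) ->
  cderiv f z l -> cderiv g z l.
Proof.
  intros Hd H (a & Ha & Hl). exists a. split; [|easy]. now apply jet_ext with (3 := Ha) (d := d).
Qed.

Lemma cderiv_const c z : cderiv (fun _ => c) z (RtoC 0).
Proof. eexists. split; [apply jet_const|easy]. Qed.

Lemma cderiv_id z : cderiv (fun z => z) z (RtoC 1).
Proof.
  apply cderiv_quadratic. exists 0, 1. split; [lra|]. intros h _.
  replace (z + h - z - RtoC 1 * h)%C with (RtoC 0) by ring. rewrite Cmod_0. lra.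
Qed.

Lemma cderiv_plus f g z l m : cderiv f z l -> cderiv g z m -> cderiv (fun z => f z + g z)%C z (l + m)%C.
Proof.
  intros (a & Ha & <-) (b & Hb & <-). eexists. split; [apply (jet_plus 2 _ _ _ _ Ha Hb)|easy].
Qed.

Lemma cderiv_mult f g z l m : cderiv f z l -> cderiv g z m ->
  cderiv (fun z => f z * g z)%C z (l * g z + f z * m)%C.
Proof.
  intros (a & Ha & <-) (b & Hb & <-). eexists. split; [apply (jet_mult 2 _ _ _ _ Ha Hb)|].
  assert (Ha0 := jet_at_0 _ _ _ Ha). assert (Hb0 := jet_at_0 _ _ _ Hb). simpl in Ha0, Hb0.
  rewrite Cplus_0_r in Ha0, Hb0. rewrite Ha0, Hb0. simpl. ring.
Qed.

Lemma cderiv_comp f g z l m : cderiv f (g z) l -> cderiv g z m -> cderiv (fun z => f (g z)) z (l * m)%C.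
Proof.
  intros (a & Ha & <-) (b & Hb & <-).
  assert (Hb0 := jet_at_0 _ _ _ Hb). simpl in Hb0. rewrite Cplus_0_r in Hb0.
  destruct Hb as (G1 & d & Hd & HG & Hb).
  destruct (jet_comp 2 _ _ _ _ Ha Hb) as (e & He & _ & He1 & _).
  exists e. split; [|rewrite He1 by lia; ring].
  apply jet_ext with (3 := He) (d := d); [easy|].
  intros h Hh. rewrite HG, Hb0 by easy. easy.
Qed.

(** * Differentiation of power series *)

(** The carrier of a goal about series is a projection of a structure, under which [ring] does
not see the field C. *)
Ltac Cring := cbv beta; match goal with |- @eq _ ?x ?y => change (@eq C x y); ring end.

Ltac Cfield := cbv beta; match goal with |- @eq _ ?x ?y => change (@eq C x y); field end.

Lemma series_square_geometric q : 0 <= q < 1 -> ex_series (fun n => INR n ^ 2 * q ^ n).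
Proof.
  intros Hq.
  assert (Hr : CV_radius (fun _ => 1) = 1).
  { rewrite (CV_radius_finite_DAlembert _ 1).
    - now rewrite Rinv_1.
    - intros; lra.
    - lra.
    - apply is_lim_seq_ext with (u := fun _ => 1); [|apply is_lim_seq_const].
      intros _. unfold Rdiv. rewrite Rinv_1, Rmult_1_r, Rabs_R1. easy. }
  assert (H : ex_pseries (PS_derive (PS_derive (fun _ => 1))) q).
  { apply ex_pseries_derive. rewrite CV_radius_derive, Hr. simpl. rewrite Rabs_pos_eq; lra. }
  apply ex_pseries_R in H.
  apply (@ex_series_le R_AbsRing R_CompleteNormedModule _ (fun n => PS_derive (PS_derive (fun _ => 1)) n * q ^ n));
    [|exact H].
  intros n. change (norm (INR n ^ 2 * q ^ n)) with (Rabs (INR n ^ 2 * q ^ n)).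
  assert (Hn := pos_INR n). assert (Hqn : 0 <= q ^ n) by (apply pow_le; lra).
  rewrite Rabs_pos_eq by (apply Rmult_le_pos; [apply pow2_ge_0|easy]).
  unfold PS_derive. apply Rmult_le_compat_r; [easy|]. rewrite !S_INR. nra.
Qed.

(** Induction on the exponent; the factor s on the left avoids the exponent n - 1 on the right. *)
Lemma pow_increment_bound (z h : C) s n : Cmod z <= s -> Cmod (z + h)%C <= s ->
  Cmod ((z + h) ^ S n - z ^ S n - INR (S n) * z ^ n * h)%C * s <= INR (S n) ^ 2 * s ^ n * Cmod h ^ 2.
Proof.
  intros Hz Hzh. assert (Hs : 0 <= s) by (eapply Rle_trans; [apply Cmod_ge_0|exact Hz]).
  assert (Hh := Cmod_ge_0 h).
  induction n as [|n IH].
  - replace ((z + h) ^ 1 - z ^ 1 - INR 1 * z ^ 0 * h)%C with (RtoC 0) by (simpl; ring).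
    rewrite Cmod_0. simpl. nra.
  - replace ((z + h) ^ S (S n) - z ^ S (S n) - INR (S (S n)) * z ^ S n * h)%C
      with ((z + h) * ((z + h) ^ S n - z ^ S n - INR (S n) * z ^ n * h) + INR (S n) * z ^ n * h ^ 2)%C
      by (rewrite (S_INR (S n)), RtoC_plus; simpl; ring).
    set (X := ((z + h) ^ S n - z ^ S n - INR (S n) * z ^ n * h)%C) in *.
    assert (HX := Cmod_ge_0 X).
    assert (Hzn : Cmod z ^ n <= s ^ n) by (apply pow_incr; split; [apply Cmod_ge_0|easy]).
    assert (Hsn : 0 <= s ^ n) by now apply pow_le.
    assert (Hn := pos_INR (S n)).
    assert (H1 : Cmod ((z + h) * X + INR (S n) * z ^ n * h ^ 2)%C
                 <= s * Cmod X + INR (S n) * s ^ n * Cmod h ^ 2).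
    { eapply Rle_trans; [apply Cmod_triangle|]. rewrite !Cmod_mult, !Cmod_pow, Cmod_R, Rabs_pos_eq by easy.
      apply Rplus_le_compat; [now apply Rmult_le_compat_r|].
      apply Rmult_le_compat_r; [apply pow2_ge_0|]. now apply Rmult_le_compat_l. }
    assert (H2 : s * (Cmod X * s) <= s * (INR (S n) ^ 2 * s ^ n * Cmod h ^ 2)) by now apply Rmult_le_compat_l.
    apply Rle_trans with ((s * Cmod X + INR (S n) * s ^ n * Cmod h ^ 2) * s); [now apply Rmult_le_compat_r|].
    rewrite (S_INR (S n)). set (N := INR (S n)) in *. rewrite <- (tech_pow_Rmult s n).
    assert (H3 : 0 <= s * s ^ n * Cmod h ^ 2) by (apply Rmult_le_pos; [now apply Rmult_le_pos|apply pow2_ge_0]).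
    nra.
Qed.

(** Sum the bound on ((z + h)^n - z^n - n z^(n-1) h) against the coefficients: the result is
quadratic in h because sum n^2 q^n converges for q < 1. *)
Lemma ps_derivative (a : nat -> C) rho K (f : C -> C) : 0 < rho ->
  (forall k, Cmod (a k) * rho ^ k <= K) ->
  (forall z, Cmod z < rho -> ps a z (f z)) ->
  forall z, Cmod z < rho ->
  exists l : C, ps (fun k => INR (S k) * a (S k))%C z l /\ cderiv f z l.
Proof.
  intros Hrho HK Hf z Hz.
  set (s := (Cmod z + rho) / 2). assert (Hz0 := Cmod_ge_0 z).
  assert (Hs : Cmod z < s < rho) by (unfold s; lra).
  set (q := s / rho).
  assert (Hq : 0 <= q < 1).
  { unfold q. split; [apply Rdiv_le_0_compat; lra|].
    apply (Rmult_lt_reg_r rho); [easy|]. unfold Rdiv. rewrite Rmult_assoc, Rinv_l; lra. }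
  assert (HK0 : 0 <= K).
  { eapply Rle_trans; [|apply (HK 0%nat)]. simpl. assert (X := Cmod_ge_0 (a 0%nat)). lra. }
  assert (Has : forall n, Cmod (a n) * s ^ n <= K * q ^ n).
  { intros n. replace s with (rho * q) by (unfold q; field; lra). rewrite Rpow_mult_distr, <- Rmult_assoc.
    apply Rmult_le_compat_r; [apply pow_le; lra|apply HK]. }
  destruct (series_square_geometric q Hq) as [Q HQ].
  assert (HQ' : is_series (fun n => K / s * (INR n ^ 2 * q ^ n)) (K / s * Q)).
  { apply (@is_series_scal R_AbsRing R_NormedModule). exact HQ. }
  assert (Hd : exists l : C, ps (fun k => INR (S k) * a (S k))%C z l).
  { destruct (series_ex (fun k => INR (S k) * a (S k) * z ^ k)%C
       (fun n => K / s * (INR (S n) ^ 2 * q ^ S n))) as [l Hl].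
    - intros n. rewrite !Cmod_mult, Cmod_pow, Cmod_R, Rabs_pos_eq by apply pos_INR.
      apply (Rmult_le_reg_r s); [lra|].
      replace (K / s * (INR (S n) ^ 2 * q ^ S n) * s) with (INR (S n) ^ 2 * (K * q ^ S n)) by (field; lra).
      assert (X := Has (S n)). rewrite <- tech_pow_Rmult in X.
      assert (Hzn : Cmod z ^ n <= s ^ n) by (apply pow_incr; lra).
      assert (Hn : 1 <= INR (S n)) by (rewrite S_INR; assert (Y := pos_INR n); lra).
      assert (Ha := Cmod_ge_0 (a (S n))).
      apply Rle_trans with (INR (S n) * (K * q ^ S n)).
      + rewrite !Rmult_assoc. apply Rmult_le_compat_l; [lra|].
        eapply Rle_trans; [|exact X]. apply Rmult_le_compat_l; [easy|].
        rewrite Rmult_comm. apply Rmult_le_compat_l; lra.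
      + apply Rmult_le_compat_r; [|nra]. apply Rmult_le_pos; [easy|apply pow_le; lra].
    - assert (Y : ex_series (fun n => K / s * (INR n ^ 2 * q ^ n))) by (eexists; exact HQ').
      apply (ex_series_incr_1 (fun n => K / s * (INR n ^ 2 * q ^ n))) in Y. exact Y.
    - exists l. apply ps_eq_series. exact Hl. }
  destruct Hd as [l Hl]. exists l. split; [easy|].
  apply cderiv_quadratic. exists (K / s * Q / s), (s - Cmod z). split; [lra|].
  intros h Hh.
  assert (Hzh : Cmod (z + h)%C < s) by (eapply Rle_lt_trans; [apply Cmod_triangle|lra]).
  set (u := fun n => (a n * ((z + h) ^ n - z ^ n - (match n with O => RtoC 0 | S m => INR n * z ^ m end) * h))%C).
  assert (Hu : @is_series C_AbsRing C_NormedModule u (f (z + h) - f z - l * h)%C).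
  { assert (H1 := proj1 (ps_eq_series _ _ _) (Hf (z + h)%C ltac:(lra))).
    assert (H2 := proj1 (ps_eq_series _ _ _) (Hf z ltac:(lra))).
    assert (H3 : @is_series C_AbsRing C_NormedModule
      (fun n => a n * (match n with O => RtoC 0 | S m => INR n * z ^ m end))%C l).
    { apply is_series_decr_1.
      replace (plus l _) with l.
      - apply ps_eq_series in Hl. apply is_series_ext with (2 := Hl). intros n. Cring.
      - change (l = l + - (a 0%nat * RtoC 0))%C. ring. }
    apply (@is_series_scal C_AbsRing C_NormedModule h) in H3.
    assert (H4 := is_series_minus _ _ _ _ (is_series_minus _ _ _ _ H1 H2) H3).
    apply is_series_ext with (a := fun n => (a n * (z + h) ^ n + - (a n * z ^ n)
      + - (h * (a n * (match n with O => RtoC 0 | S m => INR n * z ^ m end))))%C).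
    - intros n. unfold u. Cring.
    - assert (E : (f (z + h) - f z - l * h = f (z + h) + - f z + - (h * l))%C) by ring.
      rewrite E. exact H4. }
  assert (HR : is_series (fun n => Cmod h ^ 2 / s * (K / s * (INR n ^ 2 * q ^ n))) (Cmod h ^ 2 / s * (K / s * Q))).
  { apply (@is_series_scal R_AbsRing R_NormedModule). exact HQ'. }
  replace (K / s * Q / s * Cmod h ^ 2) with (Cmod h ^ 2 / s * (K / s * Q)) by (field; lra).
  apply (series_norm_le u _ _ _ Hu HR). intros [|n].
  - unfold u. replace (a 0%nat * _)%C with (RtoC 0) by (simpl; ring). rewrite Cmod_0. simpl. lra.
  - unfold u. rewrite Cmod_mult. apply (Rmult_le_reg_r (s ^ 2)); [apply pow_lt; lra|].
    replace (Cmod h ^ 2 / s * (K / s * (INR (S n) ^ 2 * q ^ S n)) * s ^ 2)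
      with (INR (S n) ^ 2 * Cmod h ^ 2 * (K * q ^ S n)) by (field; lra).
    assert (X := pow_increment_bound z h s n ltac:(lra) ltac:(lra)).
    assert (Y := Has (S n)). rewrite <- tech_pow_Rmult in Y.
    set (e := Cmod ((z + h) ^ S n - z ^ S n - INR (S n) * z ^ n * h)%C) in *.
    assert (Ha := Cmod_ge_0 (a (S n))).
    apply Rle_trans with (INR (S n) ^ 2 * Cmod h ^ 2 * (Cmod (a (S n)) * (s * s ^ n))).
    + replace (Cmod (a (S n)) * e * s ^ 2) with (Cmod (a (S n)) * s * (e * s)) by ring.
      replace (INR (S n) ^ 2 * Cmod h ^ 2 * (Cmod (a (S n)) * (s * s ^ n)))
        with (Cmod (a (S n)) * s * (INR (S n) ^ 2 * s ^ n * Cmod h ^ 2)) by ring.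
      apply Rmult_le_compat_l; [apply Rmult_le_pos; lra|easy].
    + apply Rmult_le_compat_l; [|easy]. apply Rmult_le_pos; apply pow2_ge_0.
Qed.

(** * The maximum principle *)

(** If no point of K were maximal, every point would have a neighbourhood on which u stays below
a value taken elsewhere on K; finitely many of these cover K, and the largest of the
corresponding values is then exceeded by itself. *)
Lemma compact_maximum (K : C -> Prop) (u : C -> R) (r : R) :
  (exists z, K z) ->
  (forall z, K z -> Cmod z <= r) ->
  (forall z, ~ K z -> exists d, 0 < d /\ forall w, Cmod (w - z)%C < d -> ~ K w) ->
  (forall z, K z -> forall e, 0 < e ->
     exists d, 0 < d /\ forall w, Cmod (w - z)%C < d -> u w < u z + e) ->
  exists z, K z /\ forall w, K w -> u w <= u z.
Proof.
  intros [k0 Hk0] Hr Hcl Hu. apply NNPP. intros Hno.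
  assert (Hup : forall z, K z -> exists z', K z' /\ u z < u z').
  { intros z Hz. apply NNPP. intros H. apply Hno. exists z. split; [easy|]. intros w Hw.
    apply Rnot_lt_le. intros Hlt. apply H. now exists w. }
  assert (Hp : forall z, exists p : R * C, 0 < fst p /\
    (K z -> K (snd p) /\ forall w, Cmod (w - z)%C < fst p -> u w < u (snd p)) /\
    (~ K z -> forall w, Cmod (w - z)%C < fst p -> ~ K w)).
  { intros z. destruct (classic (K z)) as [Hz|Hz].
    - destruct (Hup z Hz) as (z' & Hz' & Hlt).
      destruct (Hu z Hz (u z' - u z) ltac:(lra)) as (d & Hd & H). exists (d, z').
      split; [easy|]. split; [|easy]. intros _. split; [easy|]. intros w Hw.
      assert (X := H w Hw). simpl. lra.
    - destruct (Hcl z Hz) as (d & Hd & H). exists (d, z). split; [easy|]. now split. }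
  set (p := fun z => proj1_sig (constructive_indefinite_description _ (Hp z))).
  assert (Hps : forall z, 0 < fst (p z) /\
    (K z -> K (snd (p z)) /\ forall w, Cmod (w - z)%C < fst (p z) -> u w < u (snd (p z))) /\
    (~ K z -> forall w, Cmod (w - z)%C < fst (p z) -> ~ K w)).
  { intros z. exact (proj2_sig (constructive_indefinite_description _ (Hp z))). }
  assert (Hd2 : forall z, 0 < fst (p z) / 2) by (intros z; assert (X := proj1 (Hps z)); lra).
  apply (compactness_list 2 (- r, (- r, tt)) (r, (r, tt))
    (fun t => mkposreal _ (Hd2 (fst t, fst (snd t))))).
  intros [l Hl].
  assert (Hm : exists m, K m /\ forall t, In t l -> K (fst t, fst (snd t)) ->
            u (snd (p (fst t, fst (snd t)))) <= u m).
  { clear Hl. induction l as [|t l (m & Hm & IH)]; [now exists k0|].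
    destruct (classic (K (fst t, fst (snd t)) /\ u m < u (snd (p (fst t, fst (snd t)))))) as [[Ht Hlt]|Hn].
    - exists (snd (p (fst t, fst (snd t)))). split; [now apply Hps|].
      intros t' [<-|Ht'] HK; [lra|]. assert (X := IH t' Ht' HK). lra.
    - exists m. split; [easy|]. intros t' [<-|Ht'] HK; [|now apply IH].
      apply Rnot_lt_le. intros Hlt. now apply Hn. }
  destruct Hm as (m & Hm & Hmax).
  assert (Hbox : forall x y : R, Rabs x <= Cmod m -> Rabs x <= r).
  { intros x _ Hx. eapply Rle_trans; [exact Hx|]. now apply Hr. }
  assert (H1 : Rabs (fst m) <= r) by (apply (Hbox _ 0), (re_le_Cmod m)).
  assert (H2 : Rabs (snd m) <= r).
  { apply (Hbox _ 0). eapply Rle_trans; [|apply Rmax_Cmod]. apply Rmax_r. }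
  apply Rabs_le_between in H1. apply Rabs_le_between in H2.
  destruct (Hl (fst m, (snd m, tt))) as ([t1 [t2 []]] & Ht & _ & Hc1 & Hc2 & _); [simpl; tauto|].
  simpl in Hc1, Hc2. set (t := (t1, t2) : C) in *.
  assert (Hclose : Cmod (m - t)%C < fst (p t)).
  { apply Rle_lt_trans with (Rabs (fst m - t1) + Rabs (snd m - t2)).
    - replace (m - t)%C with (RtoC (fst m - t1) + Ci * RtoC (snd m - t2))%C.
      + eapply Rle_trans; [apply Cmod_triangle|]. rewrite Cmod_mult, Cmod_Ci, !Cmod_R. lra.
      + unfold t. destruct m as [m1 m2]. apply injective_projections; simpl; ring.
    - lra. }
  destruct (Hps t) as (_ & HK & HnK).
  destruct (classic (K t)) as [Kt|Kt].
  - assert (X := proj2 (HK Kt) m Hclose). assert (Y := Hmax _ Ht Kt). simpl in Y. fold t in Y. lra.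
  - now apply (HnK Kt m Hclose).
Qed.

Lemma closed_disk_closed r (z : C) : ~ Cmod z <= r ->
  exists d, 0 < d /\ forall w, Cmod (w - z)%C < d -> ~ Cmod w <= r.
Proof.
  intros Hz. exists (Cmod z - r). split; [lra|]. intros w Hw Hwr.
  assert (X := Cmod_triangle w (z - w)%C). replace (w + (z - w))%C with z in X by ring.
  replace (z - w)%C with (- (w - z))%C in X by ring. rewrite Cmod_opp in X. lra.
Qed.

Definition has_jet n (G : C -> C) (z : C) := exists a, jet n (fun h => G (z + h)%C) a.

Lemma has_jet_continuous (G : C -> C) z e : has_jet 1 G z -> 0 < e ->
  exists d, 0 < d /\ forall w, Cmod (w - z)%C < d -> Cmod (G w - G z)%C < e.
Proof.
  intros [a Ha] He. assert (Ha0 := jet_at_0 _ _ _ Ha). simpl in Ha0. rewrite Cplus_0_r in Ha0.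
  destruct Ha as (F1 & d & Hd & HF & (K & d' & Hd' & HK)).
  assert (HK0 := Rabs_pos K). assert (HK1 := Rle_abs K).
  exists (Rmin (Rmin d d') (e / (Rabs K + 1))). split.
  { repeat apply Rmin_glb_lt; try easy. apply Rdiv_lt_0_compat; lra. }
  intros w Hw. set (h := (w - z)%C) in *.
  destruct (Rlt_Rmin _ _ _ Hw) as [Hw1 Hw2].
  destruct (Rlt_Rmin _ _ _ Hw1) as [Hw3 Hw4].
  assert (X := HF h Hw3). replace (z + h)%C with w in X by (unfold h; ring).
  rewrite X, Ha0. replace (a 0%nat + h * F1 h - a 0%nat)%C with (h * F1 h)%C by ring.
  rewrite Cmod_mult. assert (Y := HK h Hw4). assert (Z := Cmod_ge_0 h).
  apply Rle_lt_trans with (Cmod h * (Rabs K + 1)); [apply Rmult_le_compat_l; lra|].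
  replace e with (e / (Rabs K + 1) * (Rabs K + 1)) by (field; lra).
  apply Rmult_lt_compat_r; lra.
Qed.

Lemma has_jet_le n m G z : (m <= n)%nat -> has_jet n G z -> has_jet m G z.
Proof. intros H [a Ha]. exists a. now apply jet_le with n. Qed.

Lemma has_jet_mult n F G z : has_jet n F z -> has_jet n G z -> has_jet n (fun z => F z * G z)%C z.
Proof. intros [a Ha] [b Hb]. eexists. apply (jet_mult n _ _ _ _ Ha Hb). Qed.

Lemma has_jet_plus n F G z : has_jet n F z -> has_jet n G z -> has_jet n (fun z => F z + G z)%C z.
Proof. intros [a Ha] [b Hb]. eexists. apply (jet_plus n _ _ _ _ Ha Hb). Qed.

Lemma has_jet_const n c z : has_jet n (fun _ => c) z.
Proof. eexists. apply (jet_const n c). Qed.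

Lemma has_jet_id n z : has_jet n (fun z => z) z.
Proof.
  assert (X := jet_plus n _ _ _ _ (jet_const n z) (jet_weaken n _ _ (jet_shift n _ _ (jet_const n (RtoC 1))))).
  eexists. apply jet_ext with (3 := X) (d := 1); [lra|]. intros; ring.
Qed.

Lemma has_jet_inv n F z : has_jet (S n) F z -> F z <> RtoC 0 -> has_jet (S n) (fun z => / F z)%C z.
Proof.
  intros [a Ha] H0. assert (X := jet_at_0 _ _ _ Ha). simpl in X. rewrite Cplus_0_r in X. rewrite X in H0.
  destruct (jet_inv n _ a Ha H0) as (b & Hb & _). now exists b.
Qed.

Lemma has_jet_ext n F G z d : 0 < d -> (forall w, Cmod (w - z)%C < d -> F w = G w) ->
  has_jet n F z -> has_jet n G z.
Proof.
  intros Hd H [a Ha]. exists a. apply jet_ext with (3 := Ha) (d := d); [easy|].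
  intros h Hh. apply H. now replace (z + h - z)%C with h by ring.
Qed.

Lemma has_jet_rot n F z c : Cmod c <= 1 -> has_jet n F (c * z)%C -> has_jet n (fun z => F (c * z))%C z.
Proof.
  intros Hc [a Ha]. eexists. apply jet_ext with (3 := jet_rot n c Hc _ _ Ha) (d := 1); [lra|].
  intros h _. simpl. f_equal. ring.
Qed.

(** The average of h and h^2 over the four points s, -s, i s, -i s vanishes, so the average of
Re G over them differs from Re G (z) by O (s^3), while that of e |w|^2 exceeds its value at z
by e s^2. *)
Lemma no_interior_maximum (G : C -> C) e z d : 0 < e -> 0 < d -> has_jet 3 G z ->
  (forall w, Cmod (w - z)%C < d ->
     Re (G w) + e * Cmod w ^ 2 <= Re (G z) + e * Cmod z ^ 2) -> False.
Proof.
  intros He Hd [a Ha] Hmax.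
  assert (Ha0 := jet_at_0 _ _ _ Ha). simpl in Ha0. rewrite Cplus_0_r in Ha0.
  destruct Ha as (F1 & d1 & Hd1 & H1 & (F2 & d2 & Hd2 & H2 & (F3 & d3 & Hd3 & H3 & (K & d4 & Hd4 & HK)))).
  assert (HK0 := Rabs_pos K). assert (HK1 := Rle_abs K).
  set (s := Rmin (Rmin (Rmin d d1) (Rmin d2 d3)) (Rmin d4 (e / (Rabs K + 1))) / 2).
  assert (Hs : 0 < s).
  { unfold s. apply Rdiv_lt_0_compat; [|lra]. repeat apply Rmin_glb_lt; try easy.
    apply Rdiv_lt_0_compat; lra. }
  assert (Hs' : s < d /\ s < d1 /\ s < d2 /\ s < d3 /\ s < d4 /\ s < e / (Rabs K + 1)).
  { assert (A1 := Rmin_l (Rmin (Rmin d d1) (Rmin d2 d3)) (Rmin d4 (e / (Rabs K + 1)))).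
    assert (A2 := Rmin_r (Rmin (Rmin d d1) (Rmin d2 d3)) (Rmin d4 (e / (Rabs K + 1)))).
    assert (A3 := Rmin_l (Rmin d d1) (Rmin d2 d3)). assert (A4 := Rmin_r (Rmin d d1) (Rmin d2 d3)).
    assert (A5 := Rmin_l d d1). assert (A6 := Rmin_r d d1).
    assert (A7 := Rmin_l d2 d3). assert (A8 := Rmin_r d2 d3).
    assert (A9 := Rmin_l d4 (e / (Rabs K + 1))). assert (A10 := Rmin_r d4 (e / (Rabs K + 1))).
    unfold s in *. lra. }
  destruct Hs' as (S0 & S1 & S2 & S3 & S4 & S5).
  assert (Hstep : forall h, Cmod h = s ->
     Re (G z + a 1%nat * h + a 2%nat * h ^ 2)%C - s ^ 3 * K + e * Cmod (z + h)%C ^ 2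
      <= Re (G z) + e * Cmod z ^ 2).
  { intros h Hh. eapply Rle_trans; [|apply (Hmax (z + h)%C)].
    - apply Rplus_le_compat_r. rewrite H1, H2, H3 by lra. rewrite <- Ha0.
      replace (G z + h * (a 1%nat + h * (a 2%nat + h * F3 h)))%C with
        ((G z + a 1%nat * h + a 2%nat * h ^ 2) + h ^ 3 * F3 h)%C by ring.
      assert (X := re_le_Cmod (h ^ 3 * F3 h)%C). apply Rabs_le_between in X.
      assert (Y : Cmod (h ^ 3 * F3 h)%C <= s ^ 3 * K).
      { rewrite Cmod_mult, Cmod_pow, Hh. apply Rmult_le_compat_l; [apply pow_le; lra|apply HK; lra]. }
      rewrite (re_plus (G z + a 1%nat * h + a 2%nat * h ^ 2)%C). lra.
    - replace (z + h - z)%C with h by ring. lra. }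
  assert (Hcs : Cmod (RtoC s) = s) by (rewrite Cmod_R; apply Rabs_pos_eq; lra).
  assert (X1 := Hstep (RtoC s) Hcs).
  assert (X2 := Hstep (- RtoC s)%C ltac:(now rewrite Cmod_opp)).
  assert (X3 := Hstep (Ci * s)%C ltac:(rewrite Cmod_mult, Cmod_Ci, Hcs; ring)).
  assert (X4 := Hstep (- (Ci * s))%C ltac:(rewrite Cmod_opp, Cmod_mult, Cmod_Ci, Hcs; ring)).
  rewrite !Cmod2_alt in *. destruct z as [x y]. destruct (G (x, y)) as [g1 g2].
  destruct (a 1%nat) as [b1 b2]. destruct (a 2%nat) as [c1 c2]. simpl in X1, X2, X3, X4.
  assert (HX : e * s ^ 2 <= s ^ 3 * K) by nra.
  assert (s * (Rabs K + 1) < e).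
  { apply Rlt_le_trans with (e / (Rabs K + 1) * (Rabs K + 1)).
    - apply Rmult_lt_compat_r; lra.
    - right. field. lra. }
  assert (Hs2 : 0 < s ^ 2) by now apply pow_lt.
  assert (s * K < e) by (apply Rle_lt_trans with (s * (Rabs K + 1)); [apply Rmult_le_compat_l; lra|easy]).
  assert (Hlt := Rmult_lt_compat_l (s ^ 2) (s * K) e Hs2 ltac:(easy)).
  replace (s ^ 3 * K) with (s ^ 2 * (s * K)) in HX by ring. lra.
Qed.

(** Adding e |z|^2 rules out interior maxima of the real part; let e tend to 0. *)
Theorem maximum_principle (G : C -> C) r M : r < 1 ->
  (forall z, unit_disk z -> has_jet 3 G z) ->
  (forall z, Cmod z = r -> Cmod (G z) <= M) ->
  forall z, Cmod z <= r -> Cmod (G z) <= M.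
Proof.
  intros Hr HG HM z Hz.
  assert (HM0 : 0 <= M).
  { eapply Rle_trans; [apply Cmod_ge_0|apply (HM (RtoC r))].
    rewrite Cmod_R. apply Rabs_pos_eq. assert (X := Cmod_ge_0 z). lra. }
  destruct (Ceq_dec (G z) (RtoC 0)) as [E|E]; [rewrite E, Cmod_0; easy|].
  assert (E' : 0 < Cmod (G z)) by now apply Cmod_gt_0.
  (* lam turns G z into |G z|, so that a bound on a real part is enough *)
  set (lam := (Cconj (G z) / Cmod (G z))%C).
  assert (Hc0 : RtoC (Cmod (G z)) <> RtoC 0) by (intros X; apply RtoC_inj in X; lra).
  assert (Hlam : Cmod lam = 1).
  { unfold lam. rewrite Cmod_div, Cmod_conj, Cmod_R, Rabs_pos_eq by (easy || apply Cmod_ge_0). field. lra. }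
  assert (Hlz : (lam * G z)%C = RtoC (Cmod (G z))).
  { unfold lam. transitivity ((G z * Cconj (G z)) / Cmod (G z))%C; [field; easy|].
    rewrite <- Cmod2_conj, RtoC_pow. field. easy. }
  apply Rnot_lt_le. intros Hlt. assert (Hz0 := Cmod_ge_0 z).
  set (e := (Cmod (G z) - M) / 2). assert (He : 0 < e) by (unfold e; lra).
  set (u := fun w => Re (lam * G w)%C + e * Cmod w ^ 2).
  assert (HlG : forall w, unit_disk w -> has_jet 3 (fun w => lam * G w)%C w).
  { intros w Hw. apply has_jet_mult; [apply has_jet_const|auto]. }
  destruct (compact_maximum (fun w => Cmod w <= r) u r) as (m & Hm & Hmax).
  - now exists z.
  - easy.
  - apply closed_disk_closed.
  - intros w Hw eps Heps.
    assert (J : has_jet 1 (fun w => lam * G w)%C w).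
    { apply has_jet_le with 3%nat; [lia|]. apply HlG. unfold unit_disk. lra. }
    destruct (has_jet_continuous _ w (eps / 2) J ltac:(lra)) as (d & Hd & H).
    set (d' := Rmin 1 (eps / 2 / (e * 4))).
    assert (Hd' : 0 < d') by (apply Rmin_glb_lt; [lra|]; repeat apply Rdiv_lt_0_compat; lra).
    exists (Rmin d d'). split; [now apply Rmin_glb_lt|]. intros v Hv.
    destruct (Rlt_Rmin _ _ _ Hv) as [Hv1 Hv2].
    destruct (Rlt_Rmin _ _ _ Hv2) as [Hv3 Hv4].
    assert (X := H v Hv1). assert (Y := re_le_Cmod (lam * G v - lam * G w)%C).
    apply Rabs_le_between in Y. unfold u.
    assert (Re (lam * G v)%C = Re (lam * G w)%C + Re (lam * G v - lam * G w)%C) by (rewrite <- re_plus; f_equal; ring).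
    assert (Hvw : Cmod v <= Cmod w + Cmod (v - w)%C).
    { replace v with (w + (v - w))%C at 1 by ring. apply Cmod_triangle. }
    assert (Hv0 := Cmod_ge_0 v). assert (Hw0 := Cmod_ge_0 w). assert (Hvw0 := Cmod_ge_0 (v - w)%C).
    set (t := Cmod (v - w)%C) in *.
    assert (Cmod v ^ 2 <= (Cmod w + t) ^ 2) by (apply pow_incr; lra).
    assert ((Cmod w + t) ^ 2 <= Cmod w ^ 2 + 3 * t) by nra.
    assert (e * (4 * t) < eps / 2).
    { apply Rlt_le_trans with (e * (4 * (eps / 2 / (e * 4)))); [nra|]. right. field. lra. }
    nra.
  - destruct (Rle_lt_or_eq_dec _ _ Hm) as [Hlt'|Heq].
    + apply (no_interior_maximum (fun w => lam * G w)%C e m (r - Cmod m) He ltac:(lra)).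
      * apply HlG. unfold unit_disk. lra.
      * intros w Hw. apply Hmax.
        replace w with (m + (w - m))%C by ring. eapply Rle_trans; [apply Cmod_triangle|]. lra.
    + assert (X := Hmax z Hz). unfold u in X. rewrite Hlz, re_RtoC in X.
      assert (Y := re_le_Cmod (lam * G m)%C). apply Rabs_le_between in Y.
      rewrite Cmod_mult, Hlam in Y. assert (Z := HM m Heq).
      assert (Hr0 : 0 <= r) by lra. rewrite Heq in X.
      assert (0 <= e * Cmod z ^ 2) by (apply Rmult_le_pos; [lra|apply pow2_ge_0]).
      assert (r ^ 2 <= 1) by (rewrite <- (pow1 2); apply pow_incr; lra).
      assert (e * r ^ 2 <= e * 1) by (apply Rmult_le_compat_l; lra).
      assert (Cmod (G z) = M + 2 * e) by (unfold e; lra). lra.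
Qed.

(** * Schwarz functions and Bohr's inequality *)

Lemma bernoulli n t : 0 <= t <= 1 -> 1 - INR n * t <= (1 - t) ^ n.
Proof.
  intros Ht. induction n as [|n IH]; [simpl; lra|].
  rewrite S_INR. simpl pow. assert (Hn := pos_INR n).
  apply Rle_trans with ((1 - t) * (1 - INR n * t)); [nra|].
  apply Rmult_le_compat_l; lra.
Qed.

(** Used to let a radius r tend to 1 in bounds obtained on the circle of radius r. *)
Lemma le_1_of_scaled m x n : x < 1 -> (forall r, 0 < r < 1 -> x < r -> m * r ^ n <= 1) -> m <= 1.
Proof.
  intros Hx H. apply Rnot_lt_le. intros Hm.
  assert (Hn := pos_INR n).
  set (t := Rmin (Rmin (1 / 2) ((1 - x) / 2)) ((m - 1) / (2 * m * (INR n + 1)))).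
  assert (Ht : 0 < t).
  { unfold t. repeat apply Rmin_glb_lt; try lra. apply Rdiv_lt_0_compat; [lra|].
    apply Rmult_lt_0_compat; lra. }
  assert (T1 := Rmin_l (Rmin (1 / 2) ((1 - x) / 2)) ((m - 1) / (2 * m * (INR n + 1)))).
  assert (T2 := Rmin_r (Rmin (1 / 2) ((1 - x) / 2)) ((m - 1) / (2 * m * (INR n + 1)))).
  assert (T3 := Rmin_l (1 / 2) ((1 - x) / 2)). assert (T4 := Rmin_r (1 / 2) ((1 - x) / 2)).
  fold t in T1, T2.
  assert (X := H (1 - t) ltac:(lra) ltac:(lra)).
  assert (Y : 1 - INR n * t <= (1 - t) ^ n).
  { apply bernoulli. lra. }
  assert (Z : m * ((INR n + 1) * t) <= (m - 1) / 2).
  { apply Rle_trans with (m * ((INR n + 1) * ((m - 1) / (2 * m * (INR n + 1))))).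
    - apply Rmult_le_compat_l; [lra|]. apply Rmult_le_compat_l; lra.
    - right. field. lra. }
  assert (m * (1 - INR n * t) <= m * (1 - t) ^ n) by (apply Rmult_le_compat_l; lra).
  nra.
Qed.

Definition schwarz_function (omega : C -> C) : Prop :=
  analytic_on unit_disk omega /\ omega (RtoC 0) = RtoC 0 /\
  (forall z, unit_disk z -> unit_disk (omega z)).

Lemma has_jet_pow k n z : has_jet k (fun z => z ^ n)%C z.
Proof.
  induction n as [|n IH]; [apply (has_jet_const k (RtoC 1))|].
  apply (has_jet_mult k (fun z => z) (fun z => z ^ n)%C); [apply has_jet_id|easy].
Qed.

Lemma unit_disk_0 : unit_disk (RtoC 0).
Proof. unfold unit_disk. rewrite Cmod_0. lra. Qed.

(** F (z) / z^n with its singularity at 0 removed: a_n is the first coefficient that survives. *)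
Definition divided (F : C -> C) (a : nat -> C) (n : nat) (z : C) : C :=
  if Ceq_dec z (RtoC 0) then a n else (F z / z ^ n)%C.

Lemma jet_divided F a n m : jet (n + S m) F a -> (forall k, (k < n)%nat -> a k = RtoC 0) ->
  jet (S m) (divided F a n) (fun k => a (n + k)%nat).
Proof.
  intros Ha Hz. destruct (jet_tail n F a (S m) Ha Hz) as (G & d & Hd & HF & HJ).
  apply jet_ext with (3 := HJ) (d := d); [easy|]. intros h Hh.
  unfold divided. destruct (Ceq_dec h (RtoC 0)) as [->|Eh].
  - rewrite (jet_at_0 _ _ _ HJ). f_equal. lia.
  - rewrite HF by easy. field. now apply Cpow_nz.
Qed.

Lemma has_jet_divided F a n : (forall z, unit_disk z -> has_jet 3 F z) ->
  jet (n + 3) F a -> (forall k, (k < n)%nat -> a k = RtoC 0) ->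
  forall z, unit_disk z -> has_jet 3 (divided F a n) z.
Proof.
  intros HF Ha Hz z Hzd. destruct (Ceq_dec z (RtoC 0)) as [->|E].
  - eexists. apply jet_ext with (3 := jet_divided F a n 2 Ha Hz) (d := 1); [lra|].
    intros h _. f_equal. ring.
  - apply has_jet_ext with (F := fun z => (F z * / z ^ n)%C) (d := Cmod z).
    + now apply Cmod_gt_0.
    + intros w Hw. unfold divided. destruct (Ceq_dec w (RtoC 0)) as [->|_]; [|easy].
      replace (RtoC 0 - z)%C with (- z)%C in Hw by ring. rewrite Cmod_opp in Hw. lra.
    + apply has_jet_mult; [auto|]. apply has_jet_inv; [apply has_jet_pow|now apply Cpow_nz].
Qed.

Lemma mult_divided_1 F a (z : C) : F (RtoC 0) = RtoC 0 -> F z = (z * divided F a 1 z)%C.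
Proof.
  intros H0. unfold divided. destruct (Ceq_dec z (RtoC 0)) as [->|E].
  - rewrite H0. ring.
  - field. easy.
Qed.

(** The maximum principle for omega (z) / z on the circle of radius r gives the bound 1 / r; let r
tend to 1. *)
Theorem schwarz_lemma omega : schwarz_function omega ->
  exists phi c, (forall z, unit_disk z -> omega z = z * phi z)%C /\
    (forall z, unit_disk z -> Cmod (phi z) <= 1) /\
    (forall z, unit_disk z -> has_jet 3 phi z) /\ (forall n, jet n phi c).
Proof.
  intros (Ha & H0 & Hu). destruct (analytic_jet _ _ _ Ha unit_disk_0) as [a Haj].
  assert (Hj : forall n, jet n omega a).
  { intros n. apply jet_ext with (3 := Haj n) (d := 1); [lra|]. intros h _. f_equal. ring. }
  assert (Ha0 : a 0%nat = RtoC 0) by (rewrite <- (jet_at_0 0 _ _ (Hj 1%nat)); easy).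
  assert (Hlow : forall k, (k < 1)%nat -> a k = RtoC 0) by (intros k Hk; now replace k with 0%nat by lia).
  set (phi := divided omega a 1).
  assert (Hphi : forall z, unit_disk z -> has_jet 3 phi z).
  { apply has_jet_divided; [|apply Hj|easy].
    intros z Hz. destruct (analytic_jet _ _ _ Ha Hz) as [b Hb]. now exists b. }
  assert (Hw : forall z, (omega z = z * phi z)%C) by (intros z; now apply mult_divided_1).
  exists phi, (fun k => a (S k)). split; [easy|]. split; [|split; [easy|]].
  - intros z Hz. apply (le_1_of_scaled _ (Cmod z) 1 Hz). intros r Hr Hzr.
    replace 1 with (1 / r * r) by (field; lra). rewrite pow_1. apply Rmult_le_compat_r; [lra|].
    apply (maximum_principle phi r (1 / r) ltac:(lra) Hphi); [|lra].
    intros w Hwr. assert (Hwd : unit_disk w) by (unfold unit_disk; lra).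
    apply (Rmult_le_reg_l r); [lra|]. rewrite <- Hwr at 1. rewrite <- Cmod_mult, <- Hw.
    assert (X := Hu w Hwd). unfold unit_disk in X. replace (r * (1 / r)) with 1 by (field; lra). lra.
  - intros n. apply jet_weaken. exact (jet_divided omega a 1 n (Hj _) Hlow).
Qed.

Fixpoint csum (n : nat) (u : nat -> C) : C :=
  match n with O => RtoC 0 | S m => (csum m u + u m)%C end.

Lemma csum_geometric n w : ((w - RtoC 1) * csum n (fun j => w ^ j) = w ^ n - RtoC 1)%C.
Proof.
  induction n as [|n IH]; simpl; [ring|].
  transitivity ((w - RtoC 1) * csum n (fun j => w ^ j) + (w - RtoC 1) * w ^ n)%C; [ring|].
  rewrite IH. ring.
Qed.

Lemma csum_scal n c u : csum n (fun j => c * u j)%C = (c * csum n u)%C.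
Proof. induction n as [|n IH]; simpl; [ring|]. rewrite IH. ring. Qed.

Lemma csum_ext n u v : (forall j, u j = v j) -> csum n u = csum n v.
Proof. intros H. induction n as [|n IH]; simpl; [easy|]. now rewrite IH, H. Qed.

Lemma csum_one n : csum n (fun _ => RtoC 1) = RtoC (INR n).
Proof. induction n as [|n IH]; [easy|]. rewrite S_INR, RtoC_plus. simpl. now rewrite IH. Qed.

Lemma csum_Cmod n u B : (forall j, Cmod (u j) <= B) -> Cmod (csum n u) <= INR n * B.
Proof.
  intros H. induction n as [|n IH].
  - simpl. rewrite Cmod_0. lra.
  - rewrite S_INR. simpl. eapply Rle_trans; [apply Cmod_triangle|]. assert (X := H n). lra.
Qed.

Lemma jet_csum m n F a : (forall j, jet m (F j) (a j)) ->
  jet m (fun z => csum n (fun j => F j z)) (fun k => csum n (fun j => a j k)).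
Proof.
  intros H. induction n as [|n IH]; simpl.
  - apply jet_ext_coef with (2 := jet_const m (RtoC 0)). now intros [|k].
  - now apply jet_plus.
Qed.

Lemma has_jet_csum m n F z : (forall j, has_jet m (F j) z) -> has_jet m (fun z => csum n (fun j => F j z)) z.
Proof.
  intros H. induction n as [|n IH]; simpl; [apply has_jet_const|]. now apply has_jet_plus.
Qed.

Definition cis (x : R) : C := (cos x, sin x).

Lemma cis_pow x n : (cis x ^ n)%C = cis (INR n * x).
Proof.
  induction n as [|n IH].
  - unfold cis. simpl. rewrite Rmult_0_l, cos_0, sin_0. easy.
  - rewrite S_INR. simpl. rewrite IH. unfold cis.
    replace ((INR n + 1) * x) with (x + INR n * x) by ring. rewrite cos_plus, sin_plus.
    apply injective_projections; simpl; ring.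
Qed.

Lemma Cmod_cis x : Cmod (cis x) = 1.
Proof.
  unfold Cmod, cis. simpl. replace (cos x * (cos x * 1) + sin x * (sin x * 1)) with 1.
  - apply sqrt_1.
  - assert (X := sin2_cos2 x). unfold Rsqr in X. lra.
Qed.

Lemma primitive_root n : (1 <= n)%nat -> exists w : C,
  Cmod w = 1 /\ (w ^ n)%C = RtoC 1 /\ forall k, (0 < k < n)%nat -> (w ^ k)%C <> RtoC 1.
Proof.
  intros Hn. assert (HnR : 0 < INR n) by (apply lt_0_INR; lia).
  exists (cis (2 * PI / INR n)). split; [apply Cmod_cis|]. split.
  - rewrite cis_pow. replace (INR n * (2 * PI / INR n)) with (2 * PI) by (field; lra).
    unfold cis. now rewrite cos_2PI, sin_2PI.
  - intros k Hk H. rewrite cis_pow in H.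
    assert (HkR : 0 < INR k < INR n) by (split; [apply lt_0_INR|apply lt_INR]; lia).
    assert (Hpi := PI_RGT_0).
    set (y := INR k * PI / INR n).
    assert (Hy : 0 < y < PI).
    { unfold y. split.
      - apply Rdiv_lt_0_compat; [apply Rmult_lt_0_compat|]; lra.
      - apply (Rmult_lt_reg_r (INR n)); [easy|]. unfold Rdiv. rewrite Rmult_assoc, Rinv_l by lra. nra. }
    replace (INR k * (2 * PI / INR n)) with (2 * y) in H by (unfold y; field; lra).
    apply (f_equal fst) in H. simpl in H. rewrite cos_2a_sin in H.
    assert (X := sin_gt_0 y ltac:(lra) ltac:(lra)). nra.
Qed.

Lemma schwarz_pick_ineq (a w : C) : Cmod a < 1 -> Cmod w < 1 ->
  Cmod (w - a)%C <= Cmod (RtoC 1 - Cconj a * w)%C.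
Proof.
  intros Ha Hw.
  assert (Ha2 : Cmod a ^ 2 < 1) by (assert (X := Cmod_ge_0 a); nra).
  assert (Hw2 : Cmod w ^ 2 < 1) by (assert (X := Cmod_ge_0 w); nra).
  apply Rsqr_incr_0; try apply Cmod_ge_0. rewrite !Rsqr_pow2.
  rewrite !Cmod2_alt in *. destruct a as [a1 a2]. destruct w as [w1 w2]. simpl in *.
  assert (0 <= (1 - (a1 ^ 2 + a2 ^ 2)) * (1 - (w1 ^ 2 + w2 ^ 2))) by (apply Rmult_le_pos; simpl; lra).
  simpl in *. nra.
Qed.

(** The average of phi over the rotations by n-th roots of unity is c_0 + c_n z^n + ... and is
still bounded by kappa.  Moving c_0 to 0 by a disk automorphism and dividing by z^n gives a
function whose value at 0 is c_n / (1 - |c_0|^2); by the maximum principle it is at most 1.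
The bound kappa < 1 keeps the denominator of the automorphism away from 0. *)
Lemma wiener_strict (phi : C -> C) c kappa n : (1 <= n)%nat -> 0 < kappa < 1 ->
  (forall z, unit_disk z -> has_jet 3 phi z) -> (forall m, jet m phi c) ->
  (forall z, unit_disk z -> Cmod (phi z) <= kappa) ->
  Cmod (c n) <= 1 - Cmod (c 0%nat) ^ 2.
Proof.
  intros Hn Hk Hphi Hc HM. assert (HnR : 1 <= INR n) by (apply (le_INR 1); lia).
  destruct (primitive_root n Hn) as (w & Hw1 & Hwn & Hwk).
  assert (Hwj : forall j, Cmod (w ^ j)%C = 1) by (intros j; rewrite Cmod_pow, Hw1; apply pow1).
  set (av := fun z => (RtoC (/ INR n) * csum n (fun j => phi (w ^ j * z)%C))%C).
  set (p := fun k => (RtoC (/ INR n) * csum n (fun j => (w ^ j) ^ k * c k)%C)%C).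
  assert (Hp : forall m, jet m av p).
  { intros m. apply jet_scal.
    apply (jet_csum m n (fun j z => phi (w ^ j * z)%C) (fun j k => (w ^ j) ^ k * c k)%C).
    intros j. apply jet_rot; [rewrite Hwj; lra|apply Hc]. }
  assert (Hin : RtoC (INR n) <> RtoC 0) by (intros X; apply RtoC_inj in X; lra).
  assert (Hp1 : forall k, (w ^ k)%C = RtoC 1 -> p k = c k).
  { intros k Hwk1. unfold p.
    rewrite (csum_ext _ _ (fun j => c k * RtoC 1)%C).
    - rewrite csum_scal, csum_one, RtoC_inv by lra. field. easy.
    - intros j. rewrite <- Cpow_mult_r, Nat.mul_comm, Cpow_mult_r, Hwk1, Cpow_1_l. ring. }
  assert (Hp0 : p 0%nat = c 0%nat) by now apply Hp1.
  assert (Hpn : p n = c n) by now apply Hp1.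
  assert (Hpk : forall k, (0 < k < n)%nat -> p k = RtoC 0).
  { intros k Hkn. unfold p. rewrite (csum_ext _ _ (fun j => c k * (w ^ k) ^ j)%C).
    - rewrite (csum_scal n (c k) (fun j => (w ^ k) ^ j)%C). replace (csum n (fun j => (w ^ k) ^ j)%C) with (RtoC 0); [ring|].
      assert (X := csum_geometric n (w ^ k)%C).
      rewrite <- Cpow_mult_r, Nat.mul_comm, Cpow_mult_r, Hwn, Cpow_1_l in X.
      replace (RtoC 1 - RtoC 1)%C with (RtoC 0) in X by ring.
      assert (Y : (w ^ k - RtoC 1)%C <> RtoC 0) by now apply Cminus_eq_contra, Hwk.
      replace (csum n (fun j => (w ^ k) ^ j)%C) with
        (((w ^ k - RtoC 1) * csum n (fun j => (w ^ k) ^ j)) / (w ^ k - RtoC 1))%C by (field; easy).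
      rewrite X. field. easy.
    - intros j. rewrite <- Cpow_mult_r, Nat.mul_comm, Cpow_mult_r. ring. }
  assert (Hrot : forall z j, unit_disk z -> unit_disk (w ^ j * z)%C).
  { intros z j Hz. unfold unit_disk. now rewrite Cmod_mult, Hwj, Rmult_1_l. }
  assert (Hav : forall z, unit_disk z -> has_jet 3 av z).
  { intros z Hz. apply has_jet_mult; [apply has_jet_const|].
    apply (has_jet_csum 3 n (fun j z => phi (w ^ j * z)%C)). intros j.
    apply has_jet_rot; [rewrite Hwj; lra|]. now apply Hphi, Hrot. }
  assert (HavM : forall z, unit_disk z -> Cmod (av z) <= kappa).
  { intros z Hz. unfold av. rewrite Cmod_mult, Cmod_R, Rabs_pos_eq by (left; apply Rinv_0_lt_compat; lra).
    apply (Rmult_le_reg_l (INR n)); [lra|]. rewrite <- Rmult_assoc, Rinv_r, Rmult_1_l by lra.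
    apply csum_Cmod. intros j. now apply HM, Hrot. }
  assert (Hc0 : Cmod (c 0%nat) <= kappa).
  { rewrite <- Hp0, <- (jet_at_0 0 _ _ (Hp 1%nat)). apply HavM, unit_disk_0. }
  set (num := fun z => (av z + - p 0%nat)%C).
  set (den := fun z => (RtoC 1 + - Cconj (p 0%nat) * av z)%C).
  assert (Hden : forall z, unit_disk z -> den z <> RtoC 0).
  { intros z Hz E. assert (X := HavM z Hz). unfold den in E.
    assert (Y : (Cconj (p 0%nat) * av z = RtoC 1)%C).
    { replace (Cconj (p 0%nat) * av z)%C with (RtoC 1 - (RtoC 1 + - Cconj (p 0%nat) * av z))%C by ring.
      rewrite E. ring. }
    apply (f_equal Cmod) in Y. rewrite Cmod_mult, Cmod_conj, Hp0, Cmod_1 in Y.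
    assert (Z := Cmod_ge_0 (c 0%nat)). assert (Z' := Cmod_ge_0 (av z)). nra. }
  set (pn := fun k : nat => match k with O => (p 0%nat + - p 0%nat)%C | S k => p (S k) end).
  assert (Hnum : jet (n + 3) num pn).
  { apply jet_ext_coef with (2 := jet_plus _ _ _ _ _ (Hp _) (jet_const _ (- p 0%nat)%C)).
    intros [|k] _; simpl; [easy|ring]. }
  set (q := divided num pn n).
  assert (Hq : forall z, unit_disk z -> has_jet 3 q z).
  { apply has_jet_divided; [|easy|].
    - intros z Hz. apply has_jet_plus; [auto|apply has_jet_const].
    - intros [|k] Hkn; unfold pn; [ring|]. apply Hpk. lia. }
  set (Q := fun z => (q z * / den z)%C).
  assert (HQ : forall z, unit_disk z -> has_jet 3 Q z).
  { intros z Hz. apply has_jet_mult; [auto|]. apply has_jet_inv; [|auto].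
    apply has_jet_plus; [apply has_jet_const|]. apply has_jet_mult; [apply has_jet_const|auto]. }
  assert (HQ0 : Cmod (Q (RtoC 0)) <= 1).
  { apply (le_1_of_scaled _ 0 n ltac:(lra)). intros r Hr _.
    assert (Hrn : 0 < r ^ n) by (apply pow_lt; lra).
    replace 1 with (/ r ^ n * r ^ n) by (field; lra). apply Rmult_le_compat_r; [lra|].
    apply (maximum_principle Q r (/ r ^ n) ltac:(lra) HQ); [|rewrite Cmod_0; lra].
    intros z Hz. assert (Hzd : unit_disk z) by (unfold unit_disk; lra).
    assert (Hz0 : z <> RtoC 0) by (apply Cmod_gt_0; lra).
    unfold Q, q, divided. destruct (Ceq_dec z (RtoC 0)) as [E|_]; [easy|].
    assert (Hdz := proj1 (Cmod_gt_0 _) (Hden z Hzd)).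
    rewrite Cmod_mult, Cmod_div, Cmod_pow, Hz, Cmod_inv by (now apply Cpow_nz || auto).
    assert (X : Cmod (num z) <= Cmod (den z)).
    { assert (Y := HavM z Hzd).
      replace (den z) with (RtoC 1 - Cconj (p 0%nat) * av z)%C by (unfold den; ring).
      apply (schwarz_pick_ineq (p 0%nat) (av z)); [rewrite Hp0|]; lra. }
    apply (Rmult_le_reg_r (r ^ n * Cmod (den z))); [now apply Rmult_lt_0_compat|].
    replace (Cmod (num z) / r ^ n * / Cmod (den z) * (r ^ n * Cmod (den z))) with (Cmod (num z)) by (field; lra).
    replace (/ r ^ n * (r ^ n * Cmod (den z))) with (Cmod (den z)) by (field; lra). easy. }
  assert (Hden0 : den (RtoC 0) = RtoC (1 - Cmod (c 0%nat) ^ 2)).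
  { unfold den. rewrite (jet_at_0 0 _ _ (Hp 1%nat)), Hp0, RtoC_minus, Cmod2_conj. ring. }
  unfold Q, q, divided in HQ0. destruct (Ceq_dec (RtoC 0) (RtoC 0)) as [_|E]; [|easy].
  replace (pn n) with (p n) in HQ0 by (destruct n; [lia|easy]).
  assert (Hpos : 0 < 1 - Cmod (c 0%nat) ^ 2) by (assert (X := Cmod_ge_0 (c 0%nat)); nra).
  rewrite Hpn, Hden0, Cmod_mult, Cmod_inv, Cmod_R, Rabs_pos_eq in HQ0 by
    (lra || (intros X; apply RtoC_inj in X; lra)).
  apply (Rmult_le_reg_r (/ (1 - Cmod (c 0%nat) ^ 2))); [now apply Rinv_0_lt_compat|].
  rewrite Rinv_r by lra. easy.
Qed.

(** Apply the strict version to (1 - t) phi and let t tend to 0. *)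
Theorem wiener_bound (phi : C -> C) c n : (1 <= n)%nat ->
  (forall z, unit_disk z -> has_jet 3 phi z) -> (forall m, jet m phi c) ->
  (forall z, unit_disk z -> Cmod (phi z) <= 1) ->
  Cmod (c n) <= 1 - Cmod (c 0%nat) ^ 2.
Proof.
  intros Hn Hphi Hc HM.
  assert (H : forall t, 0 < t < 1 -> Cmod (c n) <= 1 - Cmod (c 0%nat) ^ 2 + t * (2 * Cmod (c 0%nat) ^ 2 + Cmod (c n))).
  { intros t Ht.
    assert (Hct : Cmod (RtoC (1 - t)) = 1 - t) by (rewrite Cmod_R; apply Rabs_pos_eq; lra).
    assert (X := wiener_strict (fun z => (1 - t)%R * phi z)%C (fun k => (1 - t)%R * c k)%C (1 - t) n Hn ltac:(lra)).
    cbv beta in X. rewrite !Cmod_mult, Hct in X.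
    assert (Y : (1 - t) * Cmod (c n) <= 1 - ((1 - t) * Cmod (c 0%nat)) ^ 2).
    { apply X.
      - intros z Hz. apply has_jet_mult; [apply has_jet_const|auto].
      - intros m. now apply jet_scal.
      - intros z Hz. rewrite Cmod_mult, Hct. assert (Z := HM z Hz). nra. }
    assert (Z := pow2_ge_0 (Cmod (c 0%nat))). nra. }
  apply Rnot_lt_le. intros Hlt. set (A := 2 * Cmod (c 0%nat) ^ 2 + Cmod (c n)) in *.
  assert (HA : 0 <= A).
  { unfold A. assert (X := pow2_ge_0 (Cmod (c 0%nat))). assert (Y := Cmod_ge_0 (c n)). lra. }
  set (g := Cmod (c n) - (1 - Cmod (c 0%nat) ^ 2)).
  set (t := Rmin (1 / 2) (g / 2 / (A + 1))).
  assert (Hg : 0 < g) by (unfold g; lra).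
  assert (Ht : 0 < t) by (unfold t; apply Rmin_glb_lt; [lra|]; repeat apply Rdiv_lt_0_compat; lra).
  assert (T1 := Rmin_l (1 / 2) (g / 2 / (A + 1))). assert (T2 := Rmin_r (1 / 2) (g / 2 / (A + 1))).
  fold t in T1, T2. assert (X := H t ltac:(lra)).
  assert (t * (A + 1) <= g / 2).
  { apply Rle_trans with (g / 2 / (A + 1) * (A + 1)); [apply Rmult_le_compat_r; lra|]. right. field. lra. }
  unfold g in *. nra.
Qed.

(** The sum of (1/3)^k is 3/2. *)
Lemma partial_majorant_const_bound n r B : 0 <= r <= 1 / 3 -> 0 <= B ->
  forall a, (forall k, Cmod (a k) <= B) -> partial_majorant n r a <= 3 / 2 * B.
Proof.
  intros Hr HB. induction n as [|n IH]; intros a Ha; simpl; [lra|].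
  assert (X := IH (fun k => a (S k)) (fun k => Ha (S k))). assert (Y := Ha 0%nat).
  assert (Z := partial_majorant_nonneg n r ltac:(lra) (fun k => a (S k))). nra.
Qed.

(** |c_0| + (1 - |c_0|^2) (r / (1 - r)) is at most 1, because r / (1 - r) <= 1/2 when r <= 1/3. *)
Theorem bohr_inequality (phi : C -> C) c n r : 0 <= r <= 1 / 3 ->
  (forall z, unit_disk z -> has_jet 3 phi z) -> (forall m, jet m phi c) ->
  (forall z, unit_disk z -> Cmod (phi z) <= 1) -> partial_majorant n r c <= 1.
Proof.
  intros Hr Hphi Hc HM. destruct n as [|n]; [simpl; lra|]. simpl.
  assert (Hc0 : Cmod (c 0%nat) <= 1) by (rewrite <- (jet_at_0 0 _ _ (Hc 1%nat)); apply HM, unit_disk_0).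
  assert (Hc1 := Cmod_ge_0 (c 0%nat)).
  assert (X : partial_majorant n r (fun k => c (S k)) <= 3 / 2 * (1 - Cmod (c 0%nat) ^ 2)).
  { apply partial_majorant_const_bound; [easy|nra|]. intros k. apply (wiener_bound phi c (S k)); auto. lia. }
  assert (Y := partial_majorant_nonneg n r ltac:(lra) (fun k => c (S k))). nra.
Qed.

(** * Majorants of subordinate and starlike functions *)

Lemma expansion_jet f a n : expansion f a -> jet n f a.
Proof. intros H. apply (ps_jet n f a 1); [lra|]. exact H. Qed.

Lemma expansion_at_0 f a : expansion f a -> f (RtoC 0) = a 0%nat.
Proof. intros H. apply ps_at_0, H, unit_disk_0. Qed.

(** Bohr's inequality for the Schwarz function makes [jet_comp] applicable. *)
Lemma subordinate_partial_majorant f g a b n r : expansion f a -> expansion g b -> subordinate g f ->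
  0 <= r <= 1 / 3 -> partial_majorant n r b <= partial_majorant n r a.
Proof.
  intros Ha Hb (omega & Hom & H0 & Hu & Hg) Hr.
  destruct (schwarz_lemma omega) as (phi & c & Hphi & HM & HJ & Hc); [easy|].
  destruct (jet_comp n f a phi c (expansion_jet f a n Ha) (Hc _)) as (e & He & _ & _ & Hmaj).
  assert (E : forall k, (k < n)%nat -> b k = e k).
  { apply (jet_unique n g (fun z => f (z * phi z)%C) b e 1); [lra| |now apply expansion_jet|easy].
    intros z _ Hz. rewrite Hg, Hphi by easy. easy. }
  rewrite (partial_majorant_ext n r b e) by (intros k Hk; now rewrite E).
  apply Hmaj; [lra|]. now apply (bohr_inequality phi).
Qed.

Lemma Cmod_mult_R x (z : C) : 0 <= x -> Cmod (RtoC x * z)%C = x * Cmod z.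
Proof. intros Hx. now rewrite Cmod_mult, Cmod_R, Rabs_pos_eq. Qed.

Lemma expansion_derivative f a : expansion f a ->
  forall z, Cmod z < 1 / 2 ->
  cderiv f z (C_derive f z) /\ ps (fun k => INR (S k) * a (S k))%C z (C_derive f z).
Proof.
  intros Ha z Hz.
  assert (Hc : Cmod (RtoC (1 / 2)) = 1 / 2) by (rewrite Cmod_R; apply Rabs_pos_eq; lra).
  destruct (ps_bounded a (RtoC (1 / 2)) (f (RtoC (1 / 2)))) as [K HK].
  { apply Ha. unfold unit_disk. lra. }
  rewrite Hc in HK.
  destruct (ps_derivative a (1 / 2) K f ltac:(lra) HK) with (z := z) as (l & Hl & Hd); [|easy|].
  - intros w Hw. apply Ha. unfold unit_disk. lra.
  - now rewrite (cderiv_C_derive _ _ _ Hd).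
Qed.

Lemma one_plus_E_nonzero E (w : C) : -1 <= E <= 1 -> unit_disk w -> (RtoC 1 + RtoC E * w)%C <> RtoC 0.
Proof.
  intros HE Hw H. unfold unit_disk in Hw.
  assert (X : (RtoC E * w = - RtoC 1)%C).
  { replace (RtoC E * w)%C with ((RtoC 1 + RtoC E * w) - RtoC 1)%C by ring. rewrite H. ring. }
  apply (f_equal Cmod) in X. rewrite Cmod_opp, Cmod_1, Cmod_mult, Cmod_R in X.
  assert (Y : Rabs E <= 1) by (apply Rabs_le; lra). assert (Z := Cmod_ge_0 w).
  assert (Z' := Rabs_pos E). nra.
Qed.

Lemma starlike_equation D E f omega z : -1 <= E <= 1 ->
  f z <> RtoC 0 -> z <> RtoC 0 -> unit_disk (omega z) ->
  starlike_quotient f z = janowski D E (omega z) ->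
  (z * C_derive f z * (RtoC 1 + RtoC E * omega z) = f z * (RtoC 1 + RtoC D * omega z))%C.
Proof.
  intros HE Hf Hz Hw H. unfold starlike_quotient, janowski in H.
  destruct (Ceq_dec z (RtoC 0)) as [E0|_]; [easy|].
  assert (X := one_plus_E_nonzero E (omega z) HE Hw).
  transitivity (f z * (1 + E * omega z) * (z * C_derive f z / f z))%C; [field; easy|].
  rewrite H. field. easy.
Qed.

Lemma starlike_class_A psi f a : class_Sstar psi f -> expansion f a -> a 0%nat = RtoC 0 /\ a 1%nat = RtoC 1.
Proof.
  intros ((_ & a' & Ha'0 & Ha'1 & Ha') & _) Ha. split.
  - now rewrite <- (expansion_at_0 f a Ha), (expansion_at_0 f a' Ha').
  - rewrite <- Ha'1. apply (jet_unique 2 f f a a' 1); [lra|easy| | |lia]; now apply expansion_jet.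
Qed.

(** With h = f / z, the equation (1 + E omega) z f' = (1 + D omega) f becomes
f' - h = z phi (D h - E f'); compare coefficients. *)
Lemma starlike_recursion D E f a : -1 <= E <= 0 ->
  class_Sstar (janowski D E) f -> expansion f a ->
  exists c, (forall n r, 0 <= r <= 1 / 3 -> partial_majorant n r c <= 1) /\
  forall k, (INR (S k) * a (S (S k)) =
    cauchy_product c (fun j => RtoC (D - E - E * INR j) * a (S j)) k)%C.
Proof.
  intros HE Hf Ha. destruct (starlike_class_A _ f a Hf Ha) as [Ha0 _].
  destruct Hf as (_ & Hnz & (omega & Hom & H0 & Hu & Hq)).
  destruct (schwarz_lemma omega) as (phi & c & Hphi & HM & HJ & Hc); [easy|].
  exists c. split; [intros n r Hr; now apply (bohr_inequality phi)|].
  assert (Hfa : forall n, jet n f a) by (intros n; now apply expansion_jet).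
  set (h := divided f a 1).
  assert (Hh : forall n, jet n h (fun k => a (S k))).
  { intros n. apply jet_weaken, (jet_divided f a 1 n (Hfa _)). intros k Hk. now replace k with 0%nat by lia. }
  assert (Hd : forall n, jet n (C_derive f) (fun k => INR (S k) * a (S k))%C).
  { intros n. apply (ps_jet n _ _ (1 / 2)); [lra|]. intros z Hz. now apply expansion_derivative. }
  set (g := fun j => (RtoC (D - E - E * INR j) * a (S j))%C).
  assert (HR : forall n, jet n (fun z => phi z * (RtoC D * h z + - RtoC E * C_derive f z))%C (cauchy_product c g)).
  { intros n. apply jet_mult; [apply Hc|].
    assert (X := jet_plus n _ _ _ _ (jet_scal n (RtoC D) _ _ (Hh n)) (jet_scal n (- RtoC E)%C _ _ (Hd n))).
    apply jet_ext_coef with (2 := X). intros j _. unfold g.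
    rewrite S_INR, RtoC_plus, !RtoC_minus, RtoC_mult. ring. }
  intros k.
  assert (HL := jet_plus (S (S k)) _ _ _ _ (Hd (S (S k))) (jet_scal (S (S k)) (- RtoC 1)%C _ _ (Hh (S (S k))))).
  assert (HR' := jet_shift (S k) _ _ (HR (S k))).
  assert (Heq : forall z, z <> RtoC 0 -> Cmod z < 1 ->
    (C_derive f z + - RtoC 1 * h z = z * (phi z * (RtoC D * h z + - RtoC E * C_derive f z)))%C).
  { intros z Hz0 Hz.
    assert (X := starlike_equation D E f omega z ltac:(lra) (Hnz z Hz Hz0) Hz0 (Hu z Hz) (Hq z Hz)).
    rewrite (Hphi z Hz) in X. unfold h, divided. destruct (Ceq_dec z (RtoC 0)) as [E0|_]; [easy|].
    apply Ceq_minus. apply Ceq_minus in X.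
    transitivity ((z * C_derive f z * (1 + E * (z * phi z)) - f z * (1 + D * (z * phi z))) / z)%C.
    - field. easy.
    - rewrite X. field. easy. }
  assert (X := jet_unique _ _ _ _ _ 1 Rlt_0_1 Heq HL HR' (S k) ltac:(lia)).
  cbv beta iota in X. rewrite <- X. rewrite (S_INR (S k)), RtoC_plus. ring.
Qed.

Lemma partial_majorant_weights n r (v w : nat -> R) a : (forall k, 0 <= v k) -> (forall k, 0 <= w k) ->
  partial_majorant n r (fun k => RtoC (v k + w k) * a k)%C
  = partial_majorant n r (fun k => RtoC (v k) * a k)%C + partial_majorant n r (fun k => RtoC (w k) * a k)%C.
Proof.
  revert v w a. induction n as [|n IH]; intros v w a Hv Hw; simpl; [ring|].
  rewrite (IH (fun k => v (S k)) (fun k => w (S k)) (fun k => a (S k))) by easy.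
  rewrite !Cmod_mult_R; [ring|easy|easy|]. assert (X := Hv 0%nat). assert (Y := Hw 0%nat). lra.
Qed.

Definition partial_majorant_derivative n r a := partial_majorant n r (fun k => RtoC (INR (S k)) * a (S k))%C.

Lemma is_derive_partial_majorant n : forall r a, is_derive (fun r => partial_majorant (S n) r a) r (partial_majorant_derivative n r a).
Proof.
  induction n as [|n IH]; intros r a.
  - unfold partial_majorant_derivative. simpl. auto_derive; [easy|ring].
  - change (is_derive (fun r => Cmod (a 0%nat) + r * partial_majorant (S n) r (fun k => a (S k))) r (partial_majorant_derivative (S n) r a)).
    replace (partial_majorant_derivative (S n) r a) with (0 + (1 * partial_majorant (S n) r (fun k => a (S k)) + r * partial_majorant_derivative n r (fun k => a (S k)))).
    + apply (is_derive_plus (fun _ => Cmod (a 0%nat))); [apply (@is_derive_const R_AbsRing R_NormedModule)|].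
      apply (is_derive_mult (fun r => r) (fun r => partial_majorant (S n) r (fun k => a (S k)))).
      * apply (@is_derive_id R_AbsRing).
      * apply IH.
      * intros; apply Rmult_comm.
    + unfold partial_majorant_derivative.
      rewrite (partial_majorant_ext (S n) r (fun k => RtoC (INR (S k)) * a (S k))%C
                 (fun k => RtoC (1 + INR k) * a (S k))%C) by (intros; rewrite S_INR, Rplus_comm; easy).
      rewrite (partial_majorant_weights (S n) r (fun _ => 1) INR (fun k => a (S k))) by (intros; (lra || apply pos_INR)).
      rewrite (partial_majorant_ext (S n) r (fun k => RtoC 1 * a (S k))%C (fun k => a (S k))) by
        (intros; now rewrite Cmult_1_l).
      change (partial_majorant (S n) r (fun k => RtoC (INR k) * a (S k))%C) with
        (Cmod (RtoC (INR 0) * a 1%nat)%C + r * partial_majorant n r (fun k => RtoC (INR (S k)) * a (S (S k)))%C).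
      rewrite Cmod_mult_R by (simpl; lra). change (INR 0) with 0. ring.
Qed.

(** The recursion expresses the coefficients of z h' through a product with phi, whose majorant
is at most 1, and the factors D - E - E j are nonnegative, so they can be kept as weights:
T' <= (D - E) T - E r T' for the partial majorant T of h. *)
Lemma starlike_differential_inequality D E f a n r : -1 <= E <= 0 -> E < D -> 0 <= r <= 1 / 3 ->
  class_Sstar (janowski D E) f -> expansion f a ->
  (1 + E * r) * partial_majorant_derivative n r (fun k => a (S k)) <= (D - E) * partial_majorant (S n) r (fun k => a (S k)).
Proof.
  intros HE HED Hr Hf Ha.
  destruct (starlike_recursion D E f a HE Hf Ha) as (c & Hc & Hrec).
  set (h := fun k => a (S k)).
  set (g := fun j => (RtoC (D - E - E * INR j) * h j)%C) in *.
  set (V := partial_majorant_derivative n r h).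
  assert (H1 : V <= partial_majorant n r g).
  { unfold V, partial_majorant_derivative. rewrite (partial_majorant_ext n r _ (cauchy_product c g)).
    - eapply Rle_trans; [apply partial_majorant_mult; lra|].
      assert (X := Hc n r Hr). assert (Y := partial_majorant_nonneg n r ltac:(lra) g). nra.
    - intros k _. f_equal. apply Hrec. }
  assert (H2 : partial_majorant n r g = (D - E) * partial_majorant n r h + - E * partial_majorant n r (fun k => RtoC (INR k) * h k)%C).
  { unfold g. rewrite (partial_majorant_ext n r _ (fun j => RtoC ((D - E) + - E * INR j) * h j)%C).
    - rewrite (partial_majorant_weights n r (fun _ => D - E) (fun k => - E * INR k) h).
      + rewrite partial_majorant_scal, Cmod_R, Rabs_pos_eq by lra.
        rewrite (partial_majorant_ext n r (fun k => RtoC (- E * INR k) * h k)%C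
                   (fun k => RtoC (- E) * (RtoC (INR k) * h k))%C).
        * rewrite (partial_majorant_scal n r (RtoC (- E)) (fun k => RtoC (INR k) * h k)%C), Cmod_R, Rabs_pos_eq by lra. ring.
        * intros k _. rewrite RtoC_mult. f_equal. ring.
      + intros; lra.
      + intros k. assert (X := pos_INR k). nra.
    - intros k _. do 3 f_equal. ring. }
  assert (H3 : partial_majorant n r (fun k => RtoC (INR k) * h k)%C <= r * V).
  { eapply Rle_trans; [apply partial_majorant_S; lra|]. change (partial_majorant (S n) r (fun k => RtoC (INR k) * h k)%C) with
      (Cmod (RtoC (INR 0) * h 0%nat)%C + r * partial_majorant n r (fun k => RtoC (INR (S k)) * h (S k))%C).
    rewrite Cmod_mult_R by (simpl; lra). unfold V, partial_majorant_derivative. change (INR 0) with 0. lra. }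
  assert (H4 := partial_majorant_S n r ltac:(lra) h).
  assert (X : - E * partial_majorant n r (fun k => RtoC (INR k) * h k)%C <= - E * (r * V)) by (apply Rmult_le_compat_l; lra).
  assert (Y : (D - E) * partial_majorant n r h <= (D - E) * partial_majorant (S n) r h) by (apply Rmult_le_compat_l; lra).
  fold h. fold V. lra.
Qed.

(** f0 (x) / x on the real axis. *)
Definition eta (D E x : R) : R :=
  if Req_dec_T E 0 then exp (D * x) else Rpower (1 + E * x) ((D - E) / E).

Lemma eta_pos D E x : 0 < eta D E x.
Proof. unfold eta, Rpower. destruct (Req_dec_T E 0); apply exp_pos. Qed.

Lemma eta_0 D E : eta D E 0 = 1.
Proof.
  unfold eta, Rpower. destruct (Req_dec_T E 0).
  - now rewrite Rmult_0_r, exp_0.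
  - rewrite Rmult_0_r, Rplus_0_r, ln_1, Rmult_0_r, exp_0. easy.
Qed.

Lemma is_derive_eta D E x : 0 < 1 + E * x ->
  is_derive (eta D E) x ((D - E) / (1 + E * x) * eta D E x).
Proof.
  intros Hx. unfold eta. destruct (Req_dec_T E 0) as [->|HE].
  - auto_derive; [easy|]. field.
  - unfold Rpower. auto_derive; [easy|]. field. split; lra.
Qed.

(** The quotient T / eta is nonincreasing, as eta solves the equation
(1 + E x) eta' = (D - E) eta. *)
Lemma differential_inequality_eta (T T' : R -> R) D E : -1 <= E <= 0 ->
  (forall r, 0 <= r <= 1 / 3 -> is_derive T r (T' r)) ->
  (forall r, 0 <= r <= 1 / 3 -> (1 + E * r) * T' r <= (D - E) * T r) ->
  T 0 = 1 -> forall r, 0 <= r <= 1 / 3 -> T r <= eta D E r.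
Proof.
  intros HE HT Hineq HT0 r Hr.
  assert (Hd : forall x, 0 <= x <= r -> is_derive (fun x => T x / eta D E x) x
     ((T' x - (D - E) / (1 + E * x) * T x) / eta D E x)).
  { intros x Hx. assert (Hp := eta_pos D E x). assert (H1 : 0 < 1 + E * x) by nra.
    replace ((T' x - (D - E) / (1 + E * x) * T x) / eta D E x) with
      ((T' x * eta D E x - T x * ((D - E) / (1 + E * x) * eta D E x)) / (eta D E x ^ 2))
      by (field; split; lra).
    apply is_derive_div; [apply HT; lra|now apply is_derive_eta|lra]. }
  destruct (MVT_gen (fun x => T x / eta D E x) 0 r
     (fun x => (T' x - (D - E) / (1 + E * x) * T x) / eta D E x)) as (x & Hx & Heq).
  - intros x. rewrite Rmin_left, Rmax_right by lra. intros Hx. apply Hd. lra.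
  - intros x. rewrite Rmin_left, Rmax_right by lra. intros Hx.
    apply derivable_continuous_pt. eexists. apply is_derive_Reals, Hd. lra.
  - rewrite Rmin_left, Rmax_right in Hx by lra. rewrite eta_0, HT0 in Heq.
    assert (Hp := eta_pos D E x). assert (Hpr := eta_pos D E r). assert (H1 : 0 < 1 + E * x) by nra.
    assert (X : T' x - (D - E) / (1 + E * x) * T x <= 0).
    { apply (Rmult_le_reg_l (1 + E * x)); [easy|]. assert (Y := Hineq x ltac:(lra)).
      replace ((1 + E * x) * (T' x - (D - E) / (1 + E * x) * T x))
        with ((1 + E * x) * T' x - (D - E) * T x) by (field; lra). lra. }
    assert (Z : (T' x - (D - E) / (1 + E * x) * T x) / eta D E x <= 0).
    { unfold Rdiv at 1. assert (0 < / eta D E x) by now apply Rinv_0_lt_compat. nra. }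
    assert (W : T r / eta D E r <= 1) by nra.
    apply (Rmult_le_reg_r (/ eta D E r)); [now apply Rinv_0_lt_compat|].
    rewrite Rinv_r by lra. exact W.
Qed.

Theorem starlike_majorant D E f a n r : -1 <= E <= 0 -> E < D -> 0 <= r <= 1 / 3 ->
  class_Sstar (janowski D E) f -> expansion f a -> partial_majorant n r a <= r * eta D E r.
Proof.
  intros HE HED Hr Hf Ha.
  destruct (starlike_class_A _ f a Hf Ha) as [Ha0 Ha1].
  eapply Rle_trans; [apply partial_majorant_S; lra|]. eapply Rle_trans; [apply partial_majorant_S; lra|].
  change (Cmod (a 0%nat) + r * partial_majorant (S n) r (fun k => a (S k)) <= r * eta D E r).
  rewrite Ha0, Cmod_0, Rplus_0_l. apply Rmult_le_compat_l; [lra|].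
  apply (differential_inequality_eta (fun r => partial_majorant (S n) r (fun k => a (S k))) (fun r => partial_majorant_derivative n r (fun k => a (S k))) D E HE).
  - intros x _. apply is_derive_partial_majorant.
  - intros x Hx. now apply (starlike_differential_inequality D E f a).
  - simpl. rewrite Ha1, Cmod_1. ring.
  - easy.
Qed.

Lemma partial_majorant_sum n r a : partial_majorant (S n) r a = Cmod (a 0%nat) + sum_n_m (fun k => Cmod (a k) * r ^ k) 1 n.
Proof.
  assert (H : forall m b, partial_majorant (S m) r b = sum_n_m (fun k => Cmod (b k) * r ^ k) 0 m).
  { induction m as [|m IH]; intros b.
    - rewrite sum_n_n. simpl. ring.
    - rewrite sum_Sn_m by lia. simpl pow. rewrite Rmult_1_r.
      change (partial_majorant (S (S m)) r b) with (Cmod (b 0%nat) + r * partial_majorant (S m) r (fun k => b (S k))).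
      change plus with Rplus. f_equal. rewrite IH, <- sum_n_m_S.
      symmetry. rewrite (sum_n_m_ext _ (fun k => mult r (Cmod (b (S k)) * r ^ k))).
      + apply (@sum_n_m_mult_l R_Ring).
      + intros k. change (Cmod (b (S k)) * (r * r ^ k) = r * (Cmod (b (S k)) * r ^ k)). ring. }
  rewrite H, sum_Sn_m by lia. simpl pow. rewrite Rmult_1_r. easy.
Qed.

Lemma majorant_le b r B : (forall n, partial_majorant n r b <= B) -> Rbar_le (Defs.majorant b r) B.
Proof.
  intros H. rewrite <- (Lim_seq_const B). apply Lim_seq_le_loc. exists 0%nat. intros n _.
  assert (X := H (S n)). rewrite partial_majorant_sum in X. assert (Y := Cmod_ge_0 (b 0%nat)). lra.
Qed.

(** * Growth of starlike functions *)

Lemma is_derive_quadratic (F : R -> R) t l K d : 0 < d ->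
  (forall h, Rabs h < d -> Rabs (F (t + h) - F t - l * h) <= K * Rabs h ^ 2) ->
  is_derive F t l.
Proof.
  intros Hd H. apply is_derive_Reals. intros e He.
  assert (HK0 := Rabs_pos K). assert (HK1 := Rle_abs K).
  assert (Hm : 0 < Rmin d (e / (Rabs K + 1))).
  { apply Rmin_glb_lt; [easy|]. apply Rdiv_lt_0_compat; lra. }
  exists (mkposreal _ Hm). intros h Hh0 Hh. simpl in Hh.
  destruct (Rlt_Rmin _ _ _ Hh) as [H1 H2].
  assert (X := H h H1). assert (Y := Rabs_pos_lt h Hh0).
  replace ((F (t + h) - F t) / h - l) with ((F (t + h) - F t - l * h) / h) by (field; easy).
  rewrite Rabs_div by easy. apply (Rmult_lt_reg_r (Rabs h)); [easy|].
  unfold Rdiv at 1. rewrite Rmult_assoc, Rinv_l, Rmult_1_r by lra.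
  apply Rle_lt_trans with (1 := X).
  assert (Rabs h * (Rabs K + 1) < e).
  { replace e with (e / (Rabs K + 1) * (Rabs K + 1)) by (field; lra). apply Rmult_lt_compat_r; lra. }
  nra.
Qed.

(** Real and imaginary parts of a differentiable function have derivatives along lines, which
reduces growth estimates to real calculus. *)
Lemma is_derive_on_line (f : C -> C) (z v l : C) t : cderiv f (z + RtoC t * v)%C l ->
  is_derive (fun s : R => Re (f (z + RtoC s * v)%C)) t (Re (l * v)%C) /\
  is_derive (fun s : R => Im (f (z + RtoC s * v)%C)) t (Im (l * v)%C).
Proof.
  intros H. apply cderiv_quadratic in H. destruct H as (K & d & Hd & HK).
  assert (Hv0 := Cmod_ge_0 v). set (d' := d / (Cmod v + 1)).
  assert (Hd' : 0 < d') by (apply Rdiv_lt_0_compat; lra).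
  assert (Hb : forall h, Rabs h < d' ->
    Cmod (f (z + RtoC (t + h) * v) - f (z + RtoC t * v) - RtoC h * (l * v))%C <= K * Cmod v ^ 2 * Rabs h ^ 2).
  { intros h Hh. assert (Hhv : Cmod (RtoC h * v)%C < d).
    { rewrite Cmod_mult, Cmod_R. assert (X := Rabs_pos h).
      apply Rle_lt_trans with (Rabs h * (Cmod v + 1)); [nra|].
      replace d with (d' * (Cmod v + 1)) by (unfold d'; field; lra). apply Rmult_lt_compat_r; lra. }
    assert (X := HK _ Hhv). rewrite Cmod_mult, Cmod_R in X.
    replace (z + RtoC t * v + RtoC h * v)%C with (z + RtoC (t + h) * v)%C in X by (rewrite RtoC_plus; ring).
    replace (RtoC h * (l * v))%C with (l * (RtoC h * v))%C by ring.
    replace (K * Cmod v ^ 2 * Rabs h ^ 2) with (K * (Rabs h * Cmod v) ^ 2) by ring. exact X. }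
  split; apply is_derive_quadratic with (1 := Hd') (K := K * Cmod v ^ 2); intros h Hh;
    (eapply Rle_trans; [|apply (Hb h Hh)]).
  - replace (Re (f (z + RtoC (t + h) * v)%C) - Re (f (z + RtoC t * v)%C) - Re (l * v)%C * h) with
      (Re (f (z + RtoC (t + h) * v) - f (z + RtoC t * v) - RtoC h * (l * v))%C).
    + apply re_le_Cmod.
    + unfold Cminus. rewrite !re_plus, !re_opp, re_scal_l. ring.
  - replace (Im (f (z + RtoC (t + h) * v)%C) - Im (f (z + RtoC t * v)%C) - Im (l * v)%C * h) with
      (Im (f (z + RtoC (t + h) * v) - f (z + RtoC t * v) - RtoC h * (l * v))%C).
    + eapply Rle_trans; [|apply Rmax_Cmod]. apply Rmax_r.
    + unfold Cminus. rewrite !im_plus, !im_opp, im_scal_l. ring.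
Qed.

Lemma is_derive_Cmod2_on_line (f : C -> C) (z v l : C) t : cderiv f (z + RtoC t * v)%C l ->
  is_derive (fun s : R => Cmod (f (z + RtoC s * v)%C) ^ 2) t
    (2 * Re (Cconj (f (z + RtoC t * v)) * (l * v))%C).
Proof.
  intros H. destruct (is_derive_on_line f z v l t H) as [H1 H2].
  apply is_derive_ext with (f := fun s : R => Re (f (z + RtoC s * v)%C) * Re (f (z + RtoC s * v)%C)
      + Im (f (z + RtoC s * v)%C) * Im (f (z + RtoC s * v)%C)).
  { intros s. rewrite Cmod2_alt. simpl. ring. }
  set (w := f (z + RtoC t * v)%C) in *.
  replace (2 * Re (Cconj w * (l * v))%C) with
    ((Re (l * v)%C * Re w + Re w * Re (l * v)%C) + (Im (l * v)%C * Im w + Im w * Im (l * v)%C)).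
  - apply (@is_derive_plus R_AbsRing R_NormedModule).
    + apply (@is_derive_mult R_AbsRing _ _ t _ _ H1 H1). intros; apply Rmult_comm.
    + apply (@is_derive_mult R_AbsRing _ _ t _ _ H2 H2). intros; apply Rmult_comm.
  - rewrite (re_mult (Cconj w)), re_conj, im_conj. ring.
Qed.

Lemma monotone_of_derive (F F' : R -> R) a b : a <= b ->
  (forall x, a <= x <= b -> is_derive F x (F' x)) ->
  (forall x, a < x < b -> 0 <= F' x) -> F a <= F b.
Proof.
  intros Hab Hd Hpos. destruct (Rle_lt_or_eq_dec _ _ Hab) as [Hlt|Heq]; [|rewrite Heq; lra].
  destruct (MVT_cor2 F F' a b Hlt) as (c & Hc1 & Hc2).
  - intros c Hc. now apply is_derive_Reals, Hd.
  - assert (X := Hpos c Hc2). nra.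
Qed.

Lemma analytic_cderiv f z : analytic_on unit_disk f -> unit_disk z -> cderiv f z (C_derive f z).
Proof.
  intros Hf Hz. destruct (analytic_jet _ _ _ Hf Hz) as [a Ha].
  assert (H : cderiv f z (a 1%nat)) by (exists a; split; [apply Ha|easy]).
  now rewrite (cderiv_C_derive _ _ _ H).
Qed.

(** The real part of v / (1 + E t v) over |v| <= 1 is smallest at v = -1, where it is
- 1 / (1 - E t).  After clearing the denominators, with e = E t, the difference of the two sides
is (1 + e) (1 + Re v) - e (1 - |v|^2), and -1 <= e <= 0. *)
Lemma disk_image_real_part E t (v : C) : -1 <= E <= 0 -> 0 <= t < 1 -> Cmod v <= 1 ->
  - Cmod (RtoC 1 + RtoC (E * t) * v)%C ^ 2 <= (1 - E * t) * Re (v * Cconj (RtoC 1 + RtoC (E * t) * v))%C.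
Proof.
  intros HE Ht Hv. assert (Hv2 : Cmod v ^ 2 <= 1) by (rewrite <- (pow1 2); apply pow_incr; split; [apply Cmod_ge_0|easy]).
  assert (He : 0 <= - (E * t) <= 1) by nra. set (e := E * t) in *. clearbody e.
  rewrite Cmod2_alt in *. destruct v as [x y]. simpl in *.
  assert (Hx : -1 <= x <= 1) by nra.
  assert (0 <= (1 + e) * (1 + x)) by (apply Rmult_le_pos; lra).
  assert (0 <= - e * (1 - (x * (x * 1) + y * (y * 1)))) by (apply Rmult_le_pos; lra). nra.
Qed.

(** Along the ray through z, q = f / z satisfies q' = (D - E) phi q / (1 + E z phi), so the
logarithmic derivative of |q (t v)|^2 is at least that of eta (- t)^2; both functions are 1
at t = 0. *)
Theorem growth D E f z : -1 <= E <= 0 -> E < D -> class_Sstar (janowski D E) f -> unit_disk z ->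
  Cmod z * eta D E (- Cmod z) <= Cmod (f z).
Proof.
  intros HE HED Hf Hz. assert (Hf' := Hf).
  destruct Hf' as ((Han & a & Ha0 & Ha1 & Ha) & Hnz & (omega & Hom & H0 & Hu & Hq)).
  destruct (schwarz_lemma omega) as (phi & c & Hphi & HM & HJ & Hc); [easy|].
  destruct (Ceq_dec z (RtoC 0)) as [->|Hz0].
  { rewrite Cmod_0, Rmult_0_l. apply Cmod_ge_0. }
  set (q := divided f a 1).
  assert (Hqj : forall w, unit_disk w -> has_jet 3 q w).
  { apply has_jet_divided; [|now apply expansion_jet|].
    - intros w Hw. destruct (analytic_jet _ _ _ Han Hw) as [b Hb]. now exists b.
    - intros k Hk. now replace k with 0%nat by lia. }
  assert (Hqd : forall w, unit_disk w -> cderiv q w (C_derive q w)).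
  { intros w Hw. destruct (Hqj w Hw) as [b Hb]. apply jet_weaken in Hb.
    assert (X : cderiv q w (b 1%nat)) by now exists b.
    now rewrite (cderiv_C_derive _ _ _ X). }
  assert (Hfq : forall w : C, (f w = w * q w)%C).
  { intros w. apply mult_divided_1. now rewrite (expansion_at_0 f a Ha). }
  assert (Hqeq : forall w, unit_disk w -> w <> RtoC 0 ->
    (C_derive q w * (RtoC 1 + RtoC E * (w * phi w)) = RtoC (D - E) * phi w * q w)%C).
  { intros w Hw Hw0.
    assert (X := starlike_equation D E f omega w ltac:(lra) (Hnz w Hw Hw0) Hw0 (Hu w Hw) (Hq w Hw)).
    assert (Hfd : (C_derive f w = RtoC 1 * q w + w * C_derive q w)%C).
    { apply cderiv_C_derive. apply cderiv_ext with (f := fun w => (w * q w)%C) (d := 1); [lra| |].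
      - intros h _. now rewrite Hfq.
      - apply (cderiv_mult (fun w => w) q); [apply cderiv_id|auto]. }
    rewrite Hfd, (Hphi w Hw), (Hfq w) in X. apply Ceq_minus. apply Ceq_minus in X.
    transitivity ((w * (1 * q w + w * C_derive q w) * (1 + E * (w * phi w)) - w * q w * (1 + D * (w * phi w))) / (w * w))%C.
    - rewrite RtoC_minus. field. easy.
    - rewrite X. field. easy. }
  set (rho := Cmod z). assert (Hrho : 0 < rho) by now apply Cmod_gt_0.
  assert (Hrho1 : rho < 1) by exact Hz.
  assert (Hrc : RtoC rho <> RtoC 0) by (intros X; apply RtoC_inj in X; lra).
  set (v := (z / rho)%C).
  assert (Hv : Cmod v = 1).
  { unfold v. rewrite Cmod_div, Cmod_R, Rabs_pos_eq by (easy || lra). fold rho. field. lra. }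
  assert (Hvz : (RtoC 0 + RtoC rho * v)%C = z) by (unfold v; field; easy).
  assert (Htv : forall t, 0 <= t < 1 -> unit_disk (RtoC 0 + RtoC t * v)%C).
  { intros t Ht. unfold unit_disk. rewrite Cplus_0_l, Cmod_mult, Hv, Cmod_R, Rabs_pos_eq; lra. }
  set (u := fun t : R => Cmod (q (RtoC 0 + RtoC t * v)%C) ^ 2).
  set (u' := fun t : R => 2 * Re (Cconj (q (RtoC 0 + RtoC t * v)) * (C_derive q (RtoC 0 + RtoC t * v) * v))%C).
  assert (Hud : forall t, 0 <= t <= rho -> is_derive u t (u' t)).
  { intros t Ht. apply is_derive_Cmod2_on_line. apply Hqd, Htv. lra. }
  assert (Hum : forall t, 0 < t < rho -> - (2 * (D - E)) * u t <= (1 - E * t) * u' t).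
  { intros t Ht. set (w := (RtoC 0 + RtoC t * v)%C). assert (Hw : unit_disk w) by (apply Htv; lra).
    assert (Htc : RtoC t <> RtoC 0) by (intros X; apply RtoC_inj in X; lra).
    assert (Hw0 : w <> RtoC 0).
    { intros X. apply (f_equal Cmod) in X. unfold w in X.
      rewrite Cplus_0_l, Cmod_mult, Hv, Cmod_R, Rabs_pos_eq, Cmod_0 in X; lra. }
    assert (X := Hqeq w Hw Hw0).
    set (p := (v * phi w)%C).
    assert (Hp : Cmod p <= 1) by (unfold p; rewrite Cmod_mult, Hv, Rmult_1_l; now apply HM).
    set (A := (RtoC 1 + RtoC (E * t) * p)%C).
    replace (RtoC 1 + RtoC E * (w * phi w))%C with A in X
      by (unfold A, p, w; rewrite RtoC_mult; ring).
    assert (HA : 0 < Cmod A ^ 2).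
    { apply pow_lt, Cmod_gt_0. unfold A. rewrite RtoC_mult.
      replace (RtoC 1 + RtoC E * RtoC t * p)%C with (RtoC 1 + RtoC E * (RtoC t * p))%C by ring.
      apply one_plus_E_nonzero; [lra|]. unfold unit_disk. rewrite Cmod_mult, Cmod_R, Rabs_pos_eq by lra.
      assert (Y := Cmod_ge_0 p). nra. }
    assert (Y := disk_image_real_part E t p HE ltac:(lra) Hp). fold A in Y.
    assert (Hre : Cmod A ^ 2 * Re (Cconj (q w) * (C_derive q w * v))%C
                  = (D - E) * Cmod (q w) ^ 2 * Re (p * Cconj A)%C).
    { rewrite <- !re_scal_l. f_equal. rewrite RtoC_mult, !Cmod2_conj.
      transitivity (Cconj A * Cconj (q w) * v * (C_derive q w * A))%C; [ring|].
      rewrite X. unfold p. ring. }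
    apply (Rmult_le_reg_l (Cmod A ^ 2)); [easy|].
    unfold u, u'. fold w.
    replace (Cmod A ^ 2 * ((1 - E * t) * (2 * Re (Cconj (q w) * (C_derive q w * v))%C))) with
      ((1 - E * t) * 2 * (Cmod A ^ 2 * Re (Cconj (q w) * (C_derive q w * v))%C)) by ring.
    rewrite Hre.
    assert (Z : 0 <= 2 * (D - E) * Cmod (q w) ^ 2) by (apply Rmult_le_pos; [lra|apply pow2_ge_0]).
    assert (W := Rmult_le_compat_l _ _ _ Z Y). lra. }
  set (m := fun t => eta D E (- t)).
  assert (Hmd : forall t, 0 <= t <= rho -> is_derive m t (- ((D - E) / (1 - E * t) * m t))).
  { intros t Ht. unfold m. assert (H1 : 0 < 1 + E * (- t)) by nra.
    assert (X := is_derive_comp (eta D E) (fun t => - t) t _ _ (is_derive_eta D E (- t) H1)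
                  (@is_derive_opp R_AbsRing R_NormedModule (fun t => t) t 1 (@is_derive_id R_AbsRing t))).
    replace (- ((D - E) / (1 - E * t) * eta D E (- t))) with
      (scal (opp 1) ((D - E) / (1 + E * - t) * eta D E (- t))); [exact X|].
    replace (1 - E * t) with (1 + E * - t) by ring.
    change (- 1 * ((D - E) / (1 + E * - t) * eta D E (- t)) = - ((D - E) / (1 + E * - t) * eta D E (- t))). ring. }
  assert (Hmp : forall t, 0 < m t) by (intros t; apply eta_pos).
  assert (Hmono : u 0 / (m 0 * m 0) <= u rho / (m rho * m rho)).
  { apply (monotone_of_derive (fun t => u t / (m t * m t)) (fun t => (u' t * (m t * m t) -
       u t * (- ((D - E) / (1 - E * t) * m t) * m t + m t * - ((D - E) / (1 - E * t) * m t))) / (m t * m t) ^ 2)).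
    - lra.
    - intros t Ht. assert (X := Hmp t). apply (is_derive_div u (fun t => m t * m t) t).
      + now apply Hud.
      + apply (@is_derive_mult R_AbsRing m m t _ _ (Hmd t Ht) (Hmd t Ht)). intros; apply Rmult_comm.
      + apply Rgt_not_eq. nra.
    - intros t Ht. assert (X := Hmp t). assert (H1 : 0 < 1 - E * t) by nra.
      assert (Y := Hum t Ht).
      apply Rdiv_le_0_compat; [|apply pow_lt; nra].
      replace (u' t * (m t * m t) - u t * (- ((D - E) / (1 - E * t) * m t) * m t + m t * - ((D - E) / (1 - E * t) * m t)))
        with (((1 - E * t) * u' t + 2 * (D - E) * u t) * ((m t * m t) / (1 - E * t))) by (field; lra).
      apply Rmult_le_pos; [lra|]. apply Rdiv_le_0_compat; nra. }
  assert (Hu0 : u 0 = 1).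
  { unfold u, q, divided. destruct (Ceq_dec _ _) as [_|X]; [|contradict X; ring]. rewrite Ha1, Cmod_1. ring. }
  assert (Hm0 : m 0 = 1) by (unfold m; rewrite Ropp_0; apply eta_0).
  rewrite Hu0, Hm0 in Hmono. unfold u in Hmono. rewrite Hvz in Hmono.
  assert (X := Hmp rho).
  assert (Hsq : m rho * m rho <= Cmod (q z) ^ 2).
  { apply (Rmult_le_reg_r (/ (m rho * m rho))); [apply Rinv_0_lt_compat; nra|].
    rewrite Rinv_r by nra. unfold Rdiv in Hmono. lra. }
  rewrite (Hfq z), Cmod_mult. fold rho. apply Rmult_le_compat_l; [lra|].
  change (m rho <= Cmod (q z)). assert (Y := Cmod_ge_0 (q z)). nra.
Qed.

(** * Covering and the distance to the boundary *)

Lemma Cmod_triangle_rev (x y : C) : Cmod x - Cmod y <= Cmod (x - y)%C.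
Proof.
  assert (X := Cmod_triangle (x - y) y). replace (x - y + y)%C with x in X by ring. lra.
Qed.

Lemma Cmod_minus_sym (x y : C) : Cmod (x - y)%C = Cmod (y - x)%C.
Proof. rewrite <- Cmod_opp. f_equal. ring. Qed.

Lemma cderiv_continuous f z l e : cderiv f z l -> 0 < e ->
  exists d, 0 < d /\ forall w, Cmod (w - z)%C < d -> Cmod (f w - f z)%C < e.
Proof.
  intros (a & Ha & _). apply has_jet_continuous. exists a. now apply jet_weaken.
Qed.

(** A short Newton step towards a solution of f = w decreases |f - w|. *)
Lemma newton_descent f z l w : cderiv f z l -> l <> RtoC 0 -> f z <> w ->
  forall d, 0 < d -> exists z', Cmod (z' - z)%C < d /\ Cmod (f z' - w)%C < Cmod (f z - w)%C.
Proof.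
  intros H Hl Hfw d Hd. apply cderiv_quadratic in H. destruct H as (K & d1 & Hd1 & HK).
  set (g := (f z - w)%C). assert (Hg : 0 < Cmod g) by now apply Cmod_gt_0, Cminus_eq_contra.
  assert (Hl' : 0 < Cmod l) by now apply Cmod_gt_0.
  set (G := Cmod g / Cmod l). assert (HG : 0 < G) by now apply Rdiv_lt_0_compat.
  assert (HK0 := Rabs_pos K). assert (HK1 := Rle_abs K).
  set (s := Rmin (Rmin (1 / 2) (Cmod g / ((Rabs K + 1) * G ^ 2) / 2)) (Rmin d d1 / G / 2)).
  assert (Hdd : 0 < Rmin d d1) by now apply Rmin_glb_lt.
  assert (HG2 : 0 < (Rabs K + 1) * G ^ 2) by (apply Rmult_lt_0_compat; [lra|now apply pow_lt]).
  assert (Hs : 0 < s).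
  { unfold s. repeat apply Rmin_glb_lt; try lra; repeat apply Rdiv_lt_0_compat; lra. }
  assert (S1 : s <= 1 / 2) by (eapply Rle_trans; [apply Rmin_l|apply Rmin_l]).
  assert (S2 : s <= Cmod g / ((Rabs K + 1) * G ^ 2) / 2) by (eapply Rle_trans; [apply Rmin_l|apply Rmin_r]).
  assert (S3 : s <= Rmin d d1 / G / 2) by apply Rmin_r.
  set (h := (- RtoC s * g / l)%C).
  assert (Hh : Cmod h = s * G).
  { unfold h, G. rewrite Cmod_div, Cmod_mult, Cmod_opp, Cmod_R, Rabs_pos_eq by (easy || lra). field. lra. }
  assert (Hhd : Cmod h < Rmin d d1).
  { rewrite Hh. apply Rle_lt_trans with (Rmin d d1 / G / 2 * G); [apply Rmult_le_compat_r; lra|].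
    replace (Rmin d d1 / G / 2 * G) with (Rmin d d1 / 2) by (field; lra). lra. }
  exists (z + h)%C. split.
  - replace (z + h - z)%C with h by ring. eapply Rlt_le_trans; [exact Hhd|apply Rmin_l].
  - assert (X := HK h ltac:(eapply Rlt_le_trans; [exact Hhd|apply Rmin_r])).
    fold g. replace (f (z + h) - w)%C with (RtoC (1 - s) * g + (f (z + h) - f z - l * h))%C.
    + eapply Rle_lt_trans; [apply Cmod_triangle|]. rewrite Cmod_mult_R by lra.
      assert (K * Cmod h ^ 2 < s * Cmod g).
      { rewrite Hh. apply Rle_lt_trans with (s * (s * ((Rabs K + 1) * G ^ 2))).
        - replace (K * (s * G) ^ 2) with (K * (s ^ 2 * G ^ 2)) by ring.
          replace (s * (s * ((Rabs K + 1) * G ^ 2))) with ((Rabs K + 1) * (s ^ 2 * G ^ 2)) by ring.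
          apply Rmult_le_compat_r; [|lra]. apply Rmult_le_pos; apply pow2_ge_0.
        - apply Rmult_lt_compat_l; [easy|].
          apply Rle_lt_trans with (Cmod g / ((Rabs K + 1) * G ^ 2) / 2 * ((Rabs K + 1) * G ^ 2)).
          + apply Rmult_le_compat_r; lra.
          + replace (Cmod g / ((Rabs K + 1) * G ^ 2) / 2 * ((Rabs K + 1) * G ^ 2)) with (Cmod g / 2).
            * lra.
            * field. split; lra. }
      lra.
    + unfold h, g. rewrite RtoC_minus. field. easy.
Qed.

(** Minimise |f - w| on a small closed disk around z1.  On its circle f is far from f z1, hence
from w, so the minimum is attained inside; there it is 0, since otherwise a Newton step would
decrease it. *)
Theorem open_mapping f z1 d0 : unit_disk z1 -> 0 < d0 ->
  (forall z, unit_disk z -> exists l, l <> RtoC 0 /\ cderiv f z l) ->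
  exists e, 0 < e /\ forall w, Cmod (w - f z1)%C < e ->
    exists z, unit_disk z /\ Cmod (z - z1)%C < d0 /\ f z = w.
Proof.
  intros Hz1 Hd0 Hf. destruct (Hf z1 Hz1) as (l & Hl & Hfl).
  apply cderiv_quadratic in Hfl. destruct Hfl as (K & d & Hd & HK).
  assert (Hl' : 0 < Cmod l) by now apply Cmod_gt_0.
  assert (HK0 := Rabs_pos K). assert (HK1 := Rle_abs K). unfold unit_disk in Hz1.
  set (s := Rmin (Rmin d0 (1 - Cmod z1)) (Rmin d (Cmod l / (Rabs K + 1))) / 2).
  assert (Hs : 0 < s).
  { unfold s. apply Rdiv_lt_0_compat; [|lra]. repeat apply Rmin_glb_lt; try lra. apply Rdiv_lt_0_compat; lra. }
  assert (Hs' : s < d0 /\ s < 1 - Cmod z1 /\ s < d /\ s <= Cmod l / (Rabs K + 1) / 2).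
  { assert (A1 := Rmin_l (Rmin d0 (1 - Cmod z1)) (Rmin d (Cmod l / (Rabs K + 1)))).
    assert (A2 := Rmin_r (Rmin d0 (1 - Cmod z1)) (Rmin d (Cmod l / (Rabs K + 1)))).
    assert (A3 := Rmin_l d0 (1 - Cmod z1)). assert (A4 := Rmin_r d0 (1 - Cmod z1)).
    assert (A5 := Rmin_l d (Cmod l / (Rabs K + 1))). assert (A6 := Rmin_r d (Cmod l / (Rabs K + 1))).
    unfold s in *. lra. }
  destruct Hs' as (S1 & S2 & S3 & S4).
  assert (Hcirc : forall z, Cmod (z - z1)%C = s -> Cmod l * s / 2 <= Cmod (f z - f z1)%C).
  { intros z Hz. assert (X := HK (z - z1)%C ltac:(lra)). rewrite Hz in X.
    replace (z1 + (z - z1))%C with z in X by ring.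
    assert (Y := Cmod_triangle_rev (l * (z - z1))%C (l * (z - z1) - (f z - f z1))%C).
    replace (l * (z - z1) - (l * (z - z1) - (f z - f z1)))%C with (f z - f z1)%C in Y by ring.
    rewrite (Cmod_minus_sym (l * (z - z1))), Cmod_mult, Hz in Y.
    assert (K * s ^ 2 <= Cmod l * s / 2).
    { assert (s * (Rabs K + 1) <= Cmod l / 2).
      { apply Rle_trans with (Cmod l / (Rabs K + 1) / 2 * (Rabs K + 1)); [apply Rmult_le_compat_r; lra|].
        right. field. lra. }
      nra. }
    lra. }
  set (e := Cmod l * s / 4). assert (He : 0 < e) by (unfold e; nra).
  exists e. split; [easy|]. intros w Hw.
  destruct (compact_maximum (fun z => Cmod (z - z1)%C <= s) (fun z => - Cmod (f z - w)%C) 1) as (m & Hm & Hmax).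
  - exists z1. replace (z1 - z1)%C with (RtoC 0) by ring. rewrite Cmod_0. lra.
  - intros z Hz. replace z with (z1 + (z - z1))%C by ring. eapply Rle_trans; [apply Cmod_triangle|]. lra.
  - intros z Hz. destruct (closed_disk_closed s (z - z1)%C Hz) as (d' & Hd' & H). exists d'. split; [easy|].
    intros v Hv. apply H. replace (v - z1 - (z - z1))%C with (v - z)%C by ring. easy.
  - intros z Hz e' He'. destruct (Hf z) as (l' & _ & Hfz).
    { unfold unit_disk. replace z with (z1 + (z - z1))%C by ring. eapply Rle_lt_trans; [apply Cmod_triangle|]. lra. }
    destruct (cderiv_continuous f z l' e' Hfz He') as (d' & Hd' & H). exists d'. split; [easy|].
    intros v Hv. assert (X := H v Hv). assert (Y := Cmod_triangle_rev (f z - w)%C (f z - f v)%C).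
    replace (f z - w - (f z - f v))%C with (f v - w)%C in Y by ring. rewrite (Cmod_minus_sym (f z) (f v)) in Y. lra.
  - assert (Hmd : unit_disk m).
    { unfold unit_disk. replace m with (z1 + (m - z1))%C by ring. eapply Rle_lt_trans; [apply Cmod_triangle|]. lra. }
    exists m. split; [easy|]. split; [lra|]. apply NNPP. intros Hne.
    assert (H1 := Hmax z1). replace (z1 - z1)%C with (RtoC 0) in H1 by ring. rewrite Cmod_0 in H1.
    assert (H1' := H1 ltac:(lra)). rewrite (Cmod_minus_sym w) in Hw.
    destruct (Rle_lt_or_eq_dec _ _ Hm) as [Hlt|Heq].
    + destruct (Hf m Hmd) as (l' & Hl0 & Hfm).
      destruct (newton_descent f m l' w Hfm Hl0 Hne (s - Cmod (m - z1)%C) ltac:(lra)) as (z' & Hz' & Hd').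
      assert (X := Hmax z'). assert (Cmod (z' - z1)%C <= s); [|lra].
      replace (z' - z1)%C with ((z' - m) + (m - z1))%C by ring. eapply Rle_trans; [apply Cmod_triangle|]. lra.
    + assert (X := Hcirc m Heq).
      assert (Y := Cmod_triangle_rev (f m - f z1)%C (w - f z1)%C).
      replace (f m - f z1 - (w - f z1))%C with (f m - w)%C in Y by ring.
      rewrite (Cmod_minus_sym w) in Y. unfold e in *. lra.
Qed.

(** The distance from v to the segment [0, w] is attained, hence positive. *)
Lemma segment_closed (w v : C) : ~ (exists t, 0 <= t <= 1 /\ v = (RtoC t * w)%C) ->
  exists e, 0 < e /\ forall v', Cmod (v' - v)%C < e -> ~ (exists t, 0 <= t <= 1 /\ v' = (RtoC t * w)%C).
Proof.
  intros Hv.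
  destruct (continuity_ab_min (fun t => (Re v - t * Re w) ^ 2 + (Im v - t * Im w) ^ 2) 0 1) as (t0 & Hmin & Ht0);
    [lra|intros; reg|].
  assert (Hd : forall t, Cmod (v - RtoC t * w)%C ^ 2 = (Re v - t * Re w) ^ 2 + (Im v - t * Im w) ^ 2).
  { intros t. rewrite Cmod2_alt. unfold Cminus. rewrite re_plus, im_plus, re_opp, im_opp, re_scal_l, im_scal_l. ring. }
  exists (Cmod (v - RtoC t0 * w)%C). split.
  - apply Cmod_gt_0. intros E. apply Hv. exists t0. split; [easy|]. now apply Ceq_minus.
  - intros v' Hv' (t & Ht & ->). assert (X := Hmin t Ht). cbv beta in X. rewrite <- !Hd in X.
    rewrite Cmod_minus_sym in Hv'.
    assert (Y := Cmod_ge_0 (v - RtoC t * w)%C). assert (Z := Cmod_ge_0 (v - RtoC t0 * w)%C). nra.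
Qed.

Lemma starlike_derivative_nonzero D E f z : -1 <= E <= 0 -> -1 <= D <= 1 ->
  class_Sstar (janowski D E) f -> unit_disk z -> exists l, l <> RtoC 0 /\ cderiv f z l.
Proof.
  intros HE HD Hf Hz.
  destruct Hf as ((Han & a & Ha0 & Ha1 & Ha) & Hnz & (omega & Hom & H0 & Hu & Hq)).
  exists (C_derive f z). split; [|now apply analytic_cderiv].
  destruct (Ceq_dec z (RtoC 0)) as [->|Hz0].
  - rewrite (cderiv_C_derive f (RtoC 0) (RtoC 1)).
    + intros X. apply RtoC_inj in X. lra.
    + exists a. split; [|easy]. apply jet_ext with (3 := expansion_jet f a 2 Ha) (d := 1); [lra|].
      intros h _. f_equal. ring.
  - intros X.
    assert (Y := starlike_equation D E f omega z ltac:(lra) (Hnz z Hz Hz0) Hz0 (Hu z Hz) (Hq z Hz)).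
    rewrite X in Y. replace (z * 0 * (1 + E * omega z))%C with (RtoC 0) in Y by ring.
    symmetry in Y. revert Y. apply Cmult_neq_0; [now apply Hnz|].
    apply one_plus_E_nonzero; [easy|now apply Hu].
Qed.

Lemma radial_limit D E e : -1 <= E <= 0 -> 0 < e ->
  exists x, 0 < x < 1 /\ Rabs (x * eta D E (- x) - eta D E (-1)) < e.
Proof.
  intros HE He.
  assert (Hc : continuity_pt (fun x => - x * eta D E x) (-1)).
  { apply continuity_pt_mult; [reg|]. apply derivable_continuous_pt. eexists.
    apply is_derive_Reals, is_derive_eta. lra. }
  destruct (Hc e He) as (al & Hal & H).
  set (x := Rmin (1 / 2) (al / 2)).
  assert (Hx : 0 < x) by (apply Rmin_glb_lt; lra).
  assert (Hx1 : x <= 1 / 2) by apply Rmin_l. assert (Hx2 : x <= al / 2) by apply Rmin_r.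
  exists (1 - x). split; [lra|].
  assert (X := H (- (1 - x))). simpl in X. unfold R_dist in X.
  replace ((1 - x) * eta D E (- (1 - x)) - eta D E (-1)) with
    (- - (1 - x) * eta D E (- (1 - x)) - - -1 * eta D E (-1)) by ring.
  apply X. split.
  - split; [exact I|]. lra.
  - replace (- (1 - x) - -1) with x by ring. rewrite Rabs_pos_eq; lra.
Qed.

(** Among the points of a closed disk that f maps into the segment [0, w], take one where |f| is
largest.  By the growth estimate it is an interior point, so if its image were not w, openness
of f would provide a point mapped further along the segment. *)
Theorem covering D E f w : -1 <= E <= 0 -> E < D <= 1 -> class_Sstar (janowski D E) f ->
  Cmod w < eta D E (-1) -> exists z, unit_disk z /\ f z = w.
Proof.
  intros HE HD Hf Hw.
  assert (Hf0 : f (RtoC 0) = RtoC 0).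
  { destruct Hf as ((_ & a & Ha0 & _ & Ha) & _). now rewrite (expansion_at_0 f a Ha). }
  destruct (Ceq_dec w (RtoC 0)) as [->|Hw0]; [exists (RtoC 0); split; [apply unit_disk_0|easy]|].
  assert (Hwpos : 0 < Cmod w) by now apply Cmod_gt_0.
  assert (Hder : forall z, unit_disk z -> exists l, l <> RtoC 0 /\ cderiv f z l).
  { intros z Hz. apply (starlike_derivative_nonzero D E); (easy || lra). }
  (* |f| > |w| on the circle of radius R, so points mapped into [0, w] stay inside it *)
  destruct (radial_limit D E (eta D E (-1) - Cmod w) HE ltac:(lra)) as (R & HR & Hlim).
  apply Rabs_def2 in Hlim. assert (HwR : Cmod w < R * eta D E (- R)) by lra.
  set (K := fun z : C => Cmod z <= R /\ exists t, 0 <= t <= 1 /\ f z = (RtoC t * w)%C).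
  destruct (compact_maximum K (fun z => Cmod (f z)) R) as (m & (HmR & t & Ht & Hfm) & Hmax).
  - exists (RtoC 0). split; [rewrite Cmod_0; lra|]. exists 0. split; [lra|]. rewrite Hf0. ring.
  - now intros z [Hz _].
  - intros z Hz. destruct (Rle_lt_dec (Cmod z) R) as [HzR|HzR].
    + destruct (segment_closed w (f z)) as (e & He & H); [intros X; now apply Hz|].
      destruct (Hder z) as (l & _ & Hl); [unfold unit_disk; lra|].
      destruct (cderiv_continuous f z l e Hl He) as (d & Hd & Hcont). exists d. split; [easy|].
      intros v Hv [_ X]. now apply (H (f v)); [apply Hcont|].
    + destruct (closed_disk_closed R z) as (d & Hd & H); [lra|]. exists d. split; [easy|].
      intros v Hv [X _]. now apply (H v Hv).
  - intros z [HzR _] e He. destruct (Hder z) as (l & _ & Hl); [unfold unit_disk; lra|].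
    destruct (cderiv_continuous f z l e Hl He) as (d & Hd & Hcont). exists d. split; [easy|].
    intros v Hv. assert (X := Hcont v Hv). assert (Y := Cmod_triangle_rev (f v) (f z)). lra.
  - destruct (Rle_lt_or_eq_dec _ _ (proj2 Ht)) as [Htlt|Hteq].
    2: { exists m. split; [unfold unit_disk; lra|]. rewrite Hfm, Hteq. ring. }
    exfalso.
    assert (Hfmn : Cmod (f m) = t * Cmod w) by (rewrite Hfm; apply Cmod_mult_R; lra).
    assert (HmR' : Cmod m < R).
    { destruct (Rle_lt_or_eq_dec _ _ HmR) as [X|X]; [easy|]. exfalso.
      assert (Y := growth D E f m HE (proj1 HD) Hf ltac:(unfold unit_disk; lra)). rewrite X in Y. nra. }
    destruct (open_mapping f m (R - Cmod m)) as (e & He & H); [unfold unit_disk; lra|lra|easy|].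
    set (s := Rmin (1 - t) (e / 2 / Cmod w)).
    assert (Hs : 0 < s) by (apply Rmin_glb_lt; [lra|repeat apply Rdiv_lt_0_compat; lra]).
    assert (Hs1 : s <= 1 - t) by apply Rmin_l. assert (Hs2 : s <= e / 2 / Cmod w) by apply Rmin_r.
    destruct (H (RtoC (t + s) * w)%C) as (z & Hz & Hzm & Hfz).
    { rewrite Hfm. replace (RtoC (t + s) * w - RtoC t * w)%C with (RtoC s * w)%C by (rewrite RtoC_plus; ring).
      rewrite Cmod_mult_R by lra.
      apply Rle_lt_trans with (e / 2 / Cmod w * Cmod w); [apply Rmult_le_compat_r; lra|].
      replace (e / 2 / Cmod w * Cmod w) with (e / 2) by (field; lra). lra. }
    assert (HKz : K z).
    { split; [|exists (t + s); split; [lra|easy]].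
      replace z with (m + (z - m))%C by ring. eapply Rle_trans; [apply Cmod_triangle|]. lra. }
    assert (X := Hmax z HKz). rewrite Hfmn, Hfz, Cmod_mult_R in X by lra. nra.
Qed.

(** Points of modulus less than eta (-1) are interior to the image. *)
Theorem bohr_distance_ge D E f : -1 <= E <= 0 -> E < D <= 1 -> class_Sstar (janowski D E) f ->
  Rbar_le (eta D E (-1)) (bohr_distance f).
Proof.
  intros HE HD Hf.
  assert (Hf0 : f (RtoC 0) = RtoC 0).
  { destruct Hf as ((_ & a & Ha0 & _ & Ha) & _). now rewrite (expansion_at_0 f a Ha). }
  unfold bohr_distance, distance.
  destruct (Glb_Rbar_correct (fun x : R => exists w : C, boundary (disk_image f) w /\ x = Cmod (w - f (RtoC 0))%C))
    as [_ Hglb].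
  apply Hglb. intros x (w & (Hw & _) & ->). rewrite Hf0. replace (w - RtoC 0)%C with w by ring.
  simpl. apply Rnot_lt_le. intros Hlt. apply Hw. apply (proj2 (locally_Cmod w (disk_image f))).
  exists (eta D E (-1) - Cmod w). split; [lra|]. intros v Hv.
  destruct (covering D E f v HE HD Hf) as (z & Hz & Hfz).
  - replace v with (w + (v - w))%C by ring. eapply Rle_lt_trans; [apply Cmod_triangle|]. lra.
  - now exists z.
Qed.

(** * The complex exponential and logarithm *)

Lemma Cexp_0 : Cexp (RtoC 0) = RtoC 1.
Proof.
  unfold Cexp. simpl. rewrite exp_0, cos_0, sin_0. apply injective_projections; simpl; ring.
Qed.

Lemma Cexp_plus z w : Cexp (z + w)%C = (Cexp z * Cexp w)%C.
Proof.
  unfold Cexp. destruct z as [x y]. destruct w as [u v]. simpl. rewrite exp_plus, cos_plus, sin_plus.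
  apply injective_projections; simpl; ring.
Qed.

Lemma Cexp_opp z : (Cexp z * Cexp (- z) = RtoC 1)%C.
Proof. rewrite <- Cexp_plus. replace (z + - z)%C with (RtoC 0) by ring. apply Cexp_0. Qed.

Lemma Cexp_nonzero z : Cexp z <> RtoC 0.
Proof.
  intros H. assert (X := Cexp_opp z). rewrite H, Cmult_0_l in X. apply RtoC_inj in X. lra.
Qed.

Lemma Cexp_R x : Cexp (RtoC x) = RtoC (exp x).
Proof. unfold Cexp. simpl. rewrite cos_0, sin_0. apply injective_projections; simpl; ring. Qed.

Lemma Cexp_conj z : Cexp (Cconj z) = Cconj (Cexp z).
Proof.
  unfold Cexp, Cconj. destruct z as [x y]. simpl. rewrite cos_neg, sin_neg. f_equal. ring.
Qed.

(** From 1 + x <= exp x and 1 - x <= exp (- x). *)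
Lemma exp_second_order x : Rabs x <= 1 / 2 -> Rabs (exp x - 1 - x) <= 2 * x ^ 2.
Proof.
  intros Hx. apply Rabs_le_between in Hx.
  assert (H1 := exp_ineq1_le x). assert (H2 := exp_ineq1_le (- x)).
  assert (H3 : exp x * exp (- x) = 1) by (rewrite <- exp_plus, Rplus_opp_r; apply exp_0).
  rewrite Rabs_pos_eq by lra.
  assert (H4 : exp x * (1 - x) <= 1) by (assert (X := exp_pos x); nra).
  assert (H5 : (exp x - 1 - x - 2 * x ^ 2) * (1 - x) <= 0) by nra. nra.
Qed.

Lemma cos_second_order y : Rabs (cos y - 1) <= y ^ 2.
Proof.
  assert (H : Rabs (cos y - cos 0) <= Rabs y * Rabs (y - 0)).
  { apply (bounded_variation cos (fun t => - sin t)). intros t Ht. rewrite !Rminus_0_r in Ht.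
    split; [apply is_derive_cos|]. rewrite Rabs_Ropp. apply Rle_trans with (2 := Ht).
    assert (X : Rabs (sin t - sin 0) <= 1 * Rabs (t - 0)).
    { apply (bounded_variation sin cos). intros s _. split; [apply is_derive_sin|].
      apply Rabs_le, COS_bound. }
    rewrite sin_0, !Rminus_0_r in X. lra. }
  rewrite cos_0, Rminus_0_r, <- Rabs_mult in H. rewrite (Rabs_pos_eq (y * y)) in H by nra.
  replace (y ^ 2) with (y * y) by ring. exact H.
Qed.

Lemma sin_second_order y : Rabs y <= 1 -> Rabs (sin y - y) <= y ^ 2.
Proof.
  intros Hy.
  assert (H : Rabs ((sin y - y) - (sin 0 - 0)) <= y ^ 2 * Rabs (y - 0)).
  { apply (bounded_variation (fun t => sin t - t) (fun t => cos t - 1)). intros t Ht.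
    rewrite !Rminus_0_r in Ht. split; [auto_derive; [easy|ring]|].
    eapply Rle_trans; [apply cos_second_order|].
    rewrite <- (pow2_abs t), <- (pow2_abs y). apply pow_incr. split; [apply Rabs_pos|easy]. }
  rewrite sin_0, !Rminus_0_r in H. assert (X := pow2_ge_0 y). nra.
Qed.

Lemma Cmod_le_abs (x y : R) : Cmod (x, y) <= Rabs x + Rabs y.
Proof.
  replace (x, y) with (RtoC x + Ci * RtoC y)%C by (apply injective_projections; simpl; ring).
  eapply Rle_trans; [apply Cmod_triangle|]. rewrite Cmod_mult, Cmod_Ci, !Cmod_R. lra.
Qed.

Lemma cderiv_Cexp z : cderiv Cexp z (Cexp z).
Proof.
  apply cderiv_quadratic. exists (Cmod (Cexp z) * 8), (1 / 2). split; [lra|]. intros h Hh.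
  rewrite Cexp_plus. replace (Cexp z * Cexp h - Cexp z - Cexp z * h)%C with (Cexp z * (Cexp h - RtoC 1 - h))%C by ring.
  rewrite Cmod_mult, Rmult_assoc. apply Rmult_le_compat_l; [apply Cmod_ge_0|].
  destruct h as [x y]. assert (Hm := Rmax_Cmod (x, y)). simpl in Hm.
  assert (Hx : Rabs x <= 1 / 2) by (assert (X := Rmax_l (Rabs x) (Rabs y)); lra).
  assert (Hy : Rabs y <= 1 / 2) by (assert (X := Rmax_r (Rabs x) (Rabs y)); lra).
  rewrite Cmod2_alt. unfold Cexp. simpl Re. simpl Im.
  replace (((exp x * cos y)%R, (exp x * sin y)%R) - RtoC 1 - (x, y))%C with ((exp x * cos y - 1 - x, exp x * sin y - y) : C)
    by (apply injective_projections; simpl; ring).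
  eapply Rle_trans; [apply Cmod_le_abs|].
  assert (E1 := exp_second_order x Hx). assert (E2 := cos_second_order y). assert (E3 := sin_second_order y ltac:(lra)).
  assert (Ex : Rabs (exp x) <= 2).
  { rewrite Rabs_pos_eq by (left; apply exp_pos). apply Rabs_le_between in E1. apply Rabs_le_between in Hx. nra. }
  assert (E4 : Rabs (exp x - 1) <= 2 * Rabs x).
  { replace (exp x - 1) with ((exp x - 1 - x) + x) by ring. eapply Rle_trans; [apply Rabs_triang|].
    rewrite <- pow2_abs in E1. assert (X := Rabs_pos x). nra. }
  assert (F1 : Rabs (exp x * cos y - 1 - x) <= 2 * x ^ 2 + 2 * y ^ 2).
  { replace (exp x * cos y - 1 - x) with ((exp x - 1 - x) + exp x * (cos y - 1)) by ring.
    eapply Rle_trans; [apply Rabs_triang|]. rewrite Rabs_mult. apply Rplus_le_compat; [easy|].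
    apply Rmult_le_compat; try apply Rabs_pos; easy. }
  assert (F2 : Rabs (exp x * sin y - y) <= 2 * Rabs x * (2 * Rabs y) + y ^ 2).
  { replace (exp x * sin y - y) with ((exp x - 1) * sin y + (sin y - y)) by ring.
    eapply Rle_trans; [apply Rabs_triang|]. rewrite Rabs_mult. apply Rplus_le_compat; [|easy].
    apply Rmult_le_compat; try apply Rabs_pos; [easy|].
    replace (sin y) with ((sin y - y) + y) by ring. eapply Rle_trans; [apply Rabs_triang|].
    rewrite <- pow2_abs in E3. assert (X := Rabs_pos y). nra. }
  assert (F3 : 2 * Rabs x * Rabs y <= x ^ 2 + y ^ 2).
  { rewrite <- (pow2_abs x), <- (pow2_abs y). assert (X := pow2_ge_0 (Rabs x - Rabs y)). nra. }
  assert (X := pow2_ge_0 x). assert (Y := pow2_ge_0 y). lra.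
Qed.

Lemma Re_div_Cmod_bound w : w <> RtoC 0 -> -1 <= Re w / Cmod w <= 1.
Proof.
  intros Hw. assert (H : 0 < Cmod w) by now apply Cmod_gt_0.
  assert (X := re_le_Cmod w). apply Rabs_le_between in X. split.
  - apply (Rmult_le_reg_r (Cmod w)); [easy|]. unfold Rdiv. rewrite Rmult_assoc, Rinv_l; lra.
  - apply (Rmult_le_reg_r (Cmod w)); [easy|]. unfold Rdiv. rewrite Rmult_assoc, Rinv_l; lra.
Qed.

Lemma polar_form w : w <> RtoC 0 -> Re w = Cmod w * cos (Carg w) /\ Im w = Cmod w * sin (Carg w).
Proof.
  intros Hw. assert (H : 0 < Cmod w) by now apply Cmod_gt_0. assert (Hb := Re_div_Cmod_bound w Hw).
  assert (Hs : Cmod w * sqrt (1 - (Re w / Cmod w)²) = Rabs (Im w)).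
  { rewrite <- (Rabs_pos_eq (Cmod w)) at 1 by lra. rewrite <- sqrt_Rsqr_abs, <- sqrt_mult_alt by apply Rle_0_sqr.
    rewrite <- (sqrt_Rsqr_abs (Im w)). f_equal. assert (X := Cmod2_alt w). unfold Rsqr.
    replace (Cmod w * Cmod w * (1 - Re w / Cmod w * (Re w / Cmod w))) with (Cmod w ^ 2 - Re w ^ 2) by (field; lra).
    rewrite X. ring. }
  unfold Carg. destruct (Rle_dec 0 (Im w)) as [Hi|Hi].
  - rewrite cos_acos, sin_acos, Hs, Rabs_pos_eq by easy. split; [field; lra|easy].
  - rewrite cos_neg, sin_neg, cos_acos, sin_acos by easy. split; [field; lra|].
    rewrite Rabs_left in Hs by lra. lra.
Qed.

Lemma Cexp_Clog w : w <> RtoC 0 -> Cexp (Clog w) = w.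
Proof.
  intros Hw. destruct (polar_form w Hw) as [H1 H2]. unfold Cexp, Clog. simpl.
  rewrite exp_ln by now apply Cmod_gt_0. rewrite <- H1, <- H2. now destruct w.
Qed.

Lemma Carg_atan w : 0 < Re w -> Carg w = atan (Im w / Re w).
Proof.
  intros Hre. assert (Hw : w <> RtoC 0) by (intros E; rewrite E in Hre; simpl in Hre; lra).
  assert (H : 0 < Cmod w) by now apply Cmod_gt_0. assert (Hb := Re_div_Cmod_bound w Hw).
  assert (Hpos : 0 < Re w / Cmod w) by now apply Rdiv_lt_0_compat.
  assert (Hs : sqrt (1 - (Re w / Cmod w)²) / (Re w / Cmod w) = Rabs (Im w) / Re w).
  { replace (1 - (Re w / Cmod w)²) with ((Im w / Cmod w)²).
    - rewrite sqrt_Rsqr_abs, Rabs_div, (Rabs_pos_eq (Cmod w)) by lra. field. lra.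
    - assert (X := Cmod2_alt w). unfold Rsqr. replace (Im w / Cmod w * (Im w / Cmod w)) with (Im w ^ 2 / Cmod w ^ 2) by (field; lra).
      replace (Im w ^ 2) with (Cmod w ^ 2 - Re w ^ 2) by lra. field. lra. }
  unfold Carg. rewrite acos_atan, Hs by easy. destruct (Rle_dec 0 (Im w)) as [Hi|Hi].
  - now rewrite Rabs_pos_eq.
  - rewrite <- atan_opp, Rabs_left by lra. f_equal. field. lra.
Qed.

Lemma Clog_continuous w e : 0 < Re w -> 0 < e ->
  exists d, 0 < d /\ forall v, Cmod (v - w)%C < d -> Cmod (Clog v - Clog w)%C < e.
Proof.
  intros Hre He. assert (Hw : w <> RtoC 0) by (intros E; rewrite E in Hre; simpl in Hre; lra).
  assert (Hmod : 0 < Cmod w) by now apply Cmod_gt_0.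
  assert (C1 : @continuous C_UniformSpace R_UniformSpace (fun v : C => atan (snd v / fst v)) w).
  { apply (@continuous_comp C_UniformSpace R_UniformSpace R_UniformSpace (fun v : C => snd v / fst v) atan).
    - apply (@continuous_mult C_UniformSpace R_AbsRing (fun v : C => snd v) (fun v : C => / fst v)).
      + apply (@continuous_snd R_UniformSpace R_UniformSpace).
      + apply (@continuous_comp C_UniformSpace R_UniformSpace R_UniformSpace (fun v : C => fst v) Rinv).
        * apply (@continuous_fst R_UniformSpace R_UniformSpace).
        * apply continuous_Rinv. change (Re w <> 0). lra.
    - apply (@ex_derive_continuous R_AbsRing R_NormedModule). eexists. apply is_derive_atan. }
  assert (Hl : continuity_pt ln (Cmod w)).
  { apply derivable_continuous_pt. eexists. apply is_derive_Reals, is_derive_ln. easy. }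
  destruct (Hl (e / 2) ltac:(lra)) as (al & Hal & Hln).
  assert (HA := C1 (fun y => Rabs (y - atan (snd w / fst w)) < e / 2)).
  assert (HA' : @locally C_UniformSpace w (fun v : C => Rabs (atan (snd v / fst v) - atan (snd w / fst w)) < e / 2)).
  { apply HA. exists (mkposreal (e / 2) ltac:(lra)). intros y Hy. exact Hy. }
  apply locally_Cmod in HA'. destruct HA' as (d & Hd & HA').
  exists (Rmin (Rmin d al) (Rmin (Cmod w) (Re w))). split; [repeat apply Rmin_glb_lt; easy|].
  intros v Hv.
  destruct (Rlt_Rmin _ _ _ Hv) as [V1 V2].
  destruct (Rlt_Rmin _ _ _ V1) as [V3 V4].
  assert (V6 := Rlt_le_trans _ _ _ V2 (Rmin_r _ _)).
  assert (Hrev : 0 < Re v).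
  { assert (X := re_le_Cmod (v - w)%C). apply Rabs_le_between in X.
    unfold Cminus in X at 2. rewrite re_plus, re_opp in X. lra. }
  assert (Hv0 : v <> RtoC 0) by (intros E; rewrite E in Hrev; simpl in Hrev; lra).
  replace (Clog v - Clog w)%C with (ln (Cmod v) - ln (Cmod w), Carg v - Carg w) by easy.
  eapply Rle_lt_trans; [apply Cmod_le_abs|]. rewrite !Carg_atan by easy.
  assert (X := HA' v V3). change (Rabs (atan (Im v / Re v) - atan (Im w / Re w)) < e / 2) in X.
  assert (Y : Rabs (ln (Cmod v) - ln (Cmod w)) < e / 2); [|lra].
  destruct (Req_dec_T (Cmod v) (Cmod w)) as [E|E].
  - rewrite E, Rminus_diag, Rabs_R0. lra.
  - apply (Hln (Cmod v)). split; [split; [exact I|auto]|]. simpl. unfold R_dist.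
    assert (Z1 := Cmod_triangle_rev v w). assert (Z2 := Cmod_triangle_rev w v).
    rewrite (Cmod_minus_sym w v) in Z2. apply Rabs_def1; lra.
Qed.

(** As a right inverse of the exponential: for small v, the equation exp v = 1 + h / w determines
v up to an error quadratic in h. *)
Lemma cderiv_Clog w : 0 < Re w -> cderiv Clog w (/ w)%C.
Proof.
  intros Hre. assert (Hw : w <> RtoC 0) by (intros E; rewrite E in Hre; simpl in Hre; lra).
  assert (Hmod : 0 < Cmod w) by now apply Cmod_gt_0.
  destruct (proj1 (cderiv_quadratic _ _ _) (cderiv_Cexp (RtoC 0))) as (K & d & Hd & HK).
  assert (HK0 := Rabs_pos K). assert (HK1 := Rle_abs K).
  destruct (Clog_continuous w (Rmin d (/ (2 * (Rabs K + 1)))) Hre) as (d1 & Hd1 & Hc).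
  { apply Rmin_glb_lt; [easy|]. apply Rinv_0_lt_compat. lra. }
  apply cderiv_quadratic. exists ((Rabs K + 1) * 4 / Cmod w ^ 2), (Rmin d1 (Re w)).
  split; [now apply Rmin_glb_lt|]. intros h Hh.
  destruct (Rlt_Rmin _ _ _ Hh) as [Hh1 Hh2].
  assert (Hwh : (w + h)%C <> RtoC 0).
  { intros E. assert (X := re_le_Cmod h). apply Rabs_le_between in X.
    apply (f_equal Re) in E. rewrite re_plus in E. simpl in E. lra. }
  set (v := (Clog (w + h) - Clog w)%C).
  assert (Hv := Hc (w + h)%C). replace (w + h - w)%C with h in Hv by ring.
  assert (Hv' := Hv Hh1). fold v in Hv'.
  assert (Hv1 := Rlt_le_trans _ _ _ Hv' (Rmin_l _ _)). assert (Hv2 := Rlt_le_trans _ _ _ Hv' (Rmin_r _ _)).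
  assert (He : (Cexp v = RtoC 1 + h / w)%C).
  { assert (X := Cexp_plus v (Clog w)). unfold v in X at 1. replace (Clog (w + h) - Clog w + Clog w)%C with (Clog (w + h)) in X by ring.
    rewrite !Cexp_Clog in X by easy. replace (Cexp v) with (Cexp v * w / w)%C by (field; easy).
    rewrite <- X. field. easy. }
  assert (X := HK v Hv1). rewrite Cplus_0_l, Cexp_0, He in X.
  replace (RtoC 1 + h / w - RtoC 1 - RtoC 1 * v)%C with (- (v - h / w))%C in X by (unfold Cdiv; ring).
  rewrite Cmod_opp in X. replace (v - / w * h)%C with (v - h / w)%C by (unfold Cdiv; ring).
  assert (Hd0 : Cmod (h / w)%C = Cmod h / Cmod w) by (now apply Cmod_div).
  assert (Y := Cmod_triangle_rev v (v - h / w)%C). replace (v - (v - h / w))%C with (h / w)%C in Y by (unfold Cdiv; ring).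
  assert (V0 := Cmod_ge_0 v).
  assert (X' : Cmod (v - h / w)%C <= (Rabs K + 1) * Cmod v ^ 2).
  { eapply Rle_trans; [exact X|]. apply Rmult_le_compat_r; [apply pow2_ge_0|lra]. }
  assert (Z : (Rabs K + 1) * Cmod v ^ 2 <= Cmod v / 2).
  { assert ((Rabs K + 1) * Cmod v <= / 2).
    { apply Rle_trans with ((Rabs K + 1) * / (2 * (Rabs K + 1))); [apply Rmult_le_compat_l; lra|].
      right. field. lra. }
    replace ((Rabs K + 1) * Cmod v ^ 2) with ((Rabs K + 1) * Cmod v * Cmod v) by ring. nra. }
  assert (W : Cmod v <= 2 * (Cmod h / Cmod w)) by lra.
  eapply Rle_trans; [exact X'|].
  replace ((Rabs K + 1) * 4 / Cmod w ^ 2 * Cmod h ^ 2) with ((Rabs K + 1) * (2 * (Cmod h / Cmod w)) ^ 2) by (field; lra).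
  apply Rmult_le_compat_l; [lra|]. apply pow_incr. lra.
Qed.

(** * The extremal function *)

(** The logarithm of f0 (z) / z; its derivative (D - E) / (1 + E z) has the same form for E = 0
and E <> 0, so that the two cases are treated together. *)
Definition janowski_log (D E : R) (z : C) : C :=
  if Req_dec_T E 0 then (RtoC D * z)%C else (RtoC ((D - E) / E) * Clog (RtoC 1 + RtoC E * z))%C.

Lemma janowski_f0_log D E z : janowski_f0 D E z = (z * Cexp (janowski_log D E z))%C.
Proof. unfold janowski_f0, janowski_log, Cpower. now destruct (Req_dec_T E 0). Qed.

Lemma Re_one_plus_E_pos E z : -1 <= E <= 0 -> unit_disk z -> 0 < Re (RtoC 1 + RtoC E * z)%C.
Proof.
  intros HE Hz. unfold unit_disk in Hz. rewrite re_plus, re_scal_l, re_RtoC.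
  assert (X := re_le_Cmod z). apply Rabs_le_between in X. nra.
Qed.

Lemma cderiv_affine a b z : cderiv (fun z => RtoC a + RtoC b * z)%C z (RtoC b).
Proof.
  apply cderiv_quadratic. exists 0, 1. split; [lra|]. intros h _.
  replace (RtoC a + RtoC b * (z + h) - (RtoC a + RtoC b * z) - RtoC b * h)%C with (RtoC 0) by ring.
  rewrite Cmod_0. lra.
Qed.

Lemma cderiv_janowski_log D E z : -1 <= E <= 0 -> unit_disk z ->
  cderiv (janowski_log D E) z (RtoC (D - E) / (RtoC 1 + RtoC E * z))%C.
Proof.
  intros HE Hz. unfold janowski_log. destruct (Req_dec_T E 0) as [->|H0].
  - replace (RtoC (D - 0) / (RtoC 1 + RtoC 0 * z))%C with (RtoC D).
    + apply cderiv_ext with (f := fun z => (RtoC 0 + RtoC D * z)%C) (d := 1); [lra| |apply cderiv_affine].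
      intros h _. ring.
    + rewrite Rminus_0_r. replace (RtoC 1 + RtoC 0 * z)%C with (RtoC 1) by ring. field.
  - assert (X := cderiv_comp Clog (fun z => RtoC 1 + RtoC E * z)%C z _ _
                   (cderiv_Clog _ (Re_one_plus_E_pos E z HE Hz)) (cderiv_affine 1 E z)).
    assert (Y := cderiv_mult (fun _ => RtoC ((D - E) / E)) _ z _ _ (cderiv_const _ z) X).
    assert (Hn := one_plus_E_nonzero E z ltac:(lra) Hz).
    assert (HE0 : RtoC E <> RtoC 0) by (intros Z; apply RtoC_inj in Z; lra).
    replace (RtoC (D - E) / (RtoC 1 + RtoC E * z))%C with
     (RtoC 0 * Clog (RtoC 1 + RtoC E * z) + RtoC ((D - E) / E) * (/ (RtoC 1 + RtoC E * z) * RtoC E))%C; [exact Y|].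
    rewrite RtoC_div by easy. field. easy.
Qed.

Lemma zero_derivative_constant (Q : C -> C) rho : (forall z, Cmod z < rho -> cderiv Q z (RtoC 0)) ->
  forall z, Cmod z < rho -> Q z = Q (RtoC 0).
Proof.
  intros HQ z Hz.
  assert (Hd : forall t, 0 <= t <= 1 -> cderiv Q (RtoC 0 + RtoC t * z)%C (RtoC 0)).
  { intros t Ht. apply HQ. rewrite Cplus_0_l, Cmod_mult_R by lra. assert (X := Cmod_ge_0 z). nra. }
  assert (E1 : (RtoC 0 + RtoC 1 * z = z)%C) by ring.
  assert (E0 : (RtoC 0 + RtoC 0 * z = RtoC 0)%C) by ring.
  apply injective_projections.
  - assert (X := @eq_is_derive R_NormedModule (fun t : R => Re (Q (RtoC 0 + RtoC t * z)%C)) 0 1).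
    cbv beta in X. rewrite E1, E0 in X. symmetry. apply X; [|lra]. intros t Ht.
    destruct (is_derive_on_line Q (RtoC 0) z (RtoC 0) t (Hd t Ht)) as [H _].
    rewrite Cmult_0_l in H. exact H.
  - assert (X := @eq_is_derive R_NormedModule (fun t : R => Im (Q (RtoC 0 + RtoC t * z)%C)) 0 1).
    cbv beta in X. rewrite E1, E0 in X. symmetry. apply X; [|lra]. intros t Ht.
    destruct (is_derive_on_line Q (RtoC 0) z (RtoC 0) t (Hd t Ht)) as [_ H].
    rewrite Cmult_0_l in H. exact H.
Qed.

(** Coefficients of the solution of (s + E h) Y' (h) = (D - E) Y (h) with Y (0) = c0: up to
normalisation, the binomial series of (s + E h)^((D - E) / E). *)
Fixpoint binomial_coef (D E : R) (s c0 : C) (n : nat) : C :=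
  match n with
  | O => c0
  | S m => (RtoC (D - E - E * INR m) / (RtoC (INR (S m)) * s) * binomial_coef D E s c0 m)%C
  end.

(** The ratio of consecutive coefficients times |s| is at most (n + 2) / (n + 1), because
D - E <= 2 and - E <= 1. *)
Lemma binomial_coef_bound D E s c0 n : -1 <= E <= 0 -> E < D <= 1 -> s <> RtoC 0 ->
  Cmod (binomial_coef D E s c0 n) * Cmod s ^ n <= INR (S n) * Cmod c0.
Proof.
  intros HE HD Hs. assert (Hs' : 0 < Cmod s) by now apply Cmod_gt_0.
  induction n as [|n IH]; [simpl; lra|].
  assert (Hn := pos_INR n). assert (HSn : 0 < INR (S n)) by (rewrite S_INR; lra).
  assert (Hc : RtoC (INR (S n)) <> RtoC 0) by (intros X; apply RtoC_inj in X; lra).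
  change (binomial_coef D E s c0 (S n)) with
    (RtoC (D - E - E * INR n) / (RtoC (INR (S n)) * s) * binomial_coef D E s c0 n)%C.
  rewrite Cmod_mult, Cmod_div by now apply Cmult_neq_0.
  assert (HEn : 0 <= - E * INR n) by (apply Rmult_le_pos; lra).
  rewrite Cmod_mult_R, Cmod_R, Rabs_pos_eq by lra.
  simpl pow. set (B := Cmod (binomial_coef D E s c0 n)) in *.
  replace ((D - E - E * INR n) / (INR (S n) * Cmod s) * B * (Cmod s * Cmod s ^ n)) with
    ((D - E - E * INR n) / INR (S n) * (B * Cmod s ^ n)) by (field; lra).
  assert (Hq : 0 <= (D - E - E * INR n) / INR (S n)) by (apply Rdiv_le_0_compat; lra).
  eapply Rle_trans; [apply Rmult_le_compat_l; [exact Hq|exact IH]|].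
  replace ((D - E - E * INR n) / INR (S n) * (INR (S n) * Cmod c0)) with ((D - E - E * INR n) * Cmod c0) by (field; lra).
  apply Rmult_le_compat_r; [apply Cmod_ge_0|]. rewrite !S_INR. nra.
Qed.

(** (n + 1) q^n is at most 1 + q + ... + q^n. *)
Lemma linear_times_geometric q n : 0 <= q <= 1 -> INR (S n) * q ^ n * (1 - q) <= 1.
Proof.
  intros Hq.
  assert (H : INR (S n) * q ^ n * (1 - q) <= 1 - q ^ S n).
  { induction n as [|n IH]; [simpl; lra|].
    assert (X : 0 <= q ^ S n <= 1) by (split; [apply pow_le; lra|rewrite <- (pow1 (S n)); apply pow_incr; lra]).
    rewrite S_INR. replace ((INR (S n) + 1) * q ^ S n * (1 - q)) with
      (q * (INR (S n) * q ^ n * (1 - q)) + q ^ S n * (1 - q)) by (simpl; ring).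
    replace (q ^ S (S n)) with (q * q ^ S n) by (simpl; ring). nra. }
  assert (X : 0 <= q ^ S n) by (apply pow_le; lra). lra.
Qed.

Lemma binomial_coef_summable D E s c0 rho : -1 <= E <= 0 -> E < D <= 1 -> s <> RtoC 0 ->
  0 < rho < Cmod s -> forall n, Cmod (binomial_coef D E s c0 n) * rho ^ n <= Cmod c0 / (1 - rho / Cmod s).
Proof.
  intros HE HD Hs Hrho n. set (q := rho / Cmod s).
  assert (Hq : 0 < q < 1).
  { unfold q. split; [apply Rdiv_lt_0_compat; lra|]. apply (Rmult_lt_reg_r (Cmod s)); [lra|].
    unfold Rdiv. rewrite Rmult_assoc, Rinv_l; lra. }
  replace rho with (Cmod s * q) by (unfold q; field; lra). rewrite Rpow_mult_distr.
  assert (X := binomial_coef_bound D E s c0 n HE HD Hs).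
  assert (Y := linear_times_geometric q n ltac:(lra)). assert (Hc := Cmod_ge_0 c0).
  assert (Hqn : 0 < q ^ n) by (apply pow_lt; lra).
  apply (Rmult_le_reg_r (1 - q)); [lra|]. unfold Rdiv. rewrite (Rmult_assoc (Cmod c0)), Rinv_l, Rmult_1_r by lra.
  apply Rle_trans with (INR (S n) * Cmod c0 * q ^ n * (1 - q)).
  - apply Rmult_le_compat_r; [lra|]. rewrite <- Rmult_assoc. apply Rmult_le_compat_r; lra.
  - replace (INR (S n) * Cmod c0 * q ^ n * (1 - q)) with (Cmod c0 * (INR (S n) * q ^ n * (1 - q))) by ring.
    rewrite <- (Rmult_1_r (Cmod c0)) at 2. now apply Rmult_le_compat_l.
Qed.

(** The sum is obtained by choice at each point of convergence; the differential equation is the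
recursion of the coefficients. *)
Lemma binomial_series D E s c0 : -1 <= E <= 0 -> E < D <= 1 -> s <> RtoC 0 ->
  exists Y : C -> C, (forall h, Cmod h < Cmod s -> ps (binomial_coef D E s c0) h (Y h)) /\
    forall h, Cmod h < Cmod s -> exists l, cderiv Y h l /\ ((s + RtoC E * h) * l = RtoC (D - E) * Y h)%C.
Proof.
  intros HE HD Hs. assert (Hs' : 0 < Cmod s) by now apply Cmod_gt_0. set (c := binomial_coef D E s c0).
  assert (Hmid : forall h, Cmod h < Cmod s -> Cmod h < (Cmod h + Cmod s) / 2 /\ 0 < (Cmod h + Cmod s) / 2 < Cmod s).
  { intros h Hh. assert (X := Cmod_ge_0 h). lra. }
  assert (Hex : forall h, exists l : C, Cmod h < Cmod s -> ps c h l).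
  { intros h. destruct (Rlt_le_dec (Cmod h) (Cmod s)) as [Hh|Hh]; [|exists (RtoC 0); lra].
    destruct (Hmid h Hh) as [H1 H2].
    destruct (ps_geometric c _ _ h (proj1 H2) (binomial_coef_summable D E s c0 _ HE HD Hs H2) H1) as (l & Hl & _).
    now exists l. }
  set (Y := fun h => proj1_sig (constructive_indefinite_description _ (Hex h))).
  assert (HY : forall h, Cmod h < Cmod s -> ps c h (Y h)).
  { intros h. exact (proj2_sig (constructive_indefinite_description _ (Hex h))). }
  exists Y. split; [easy|]. intros h Hh. destruct (Hmid h Hh) as [H1 H2].
  destruct (ps_derivative c _ _ Y (proj1 H2) (binomial_coef_summable D E s c0 _ HE HD Hs H2)) with (z := h)
    as (l & Hl & Hd); [intros z Hz; apply HY; lra|easy|].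
  exists l. split; [easy|].
  assert (HL := @is_pseries_scal C_AbsRing C_NormedModule s _ h l (Cmult_comm h s) Hl).
  assert (HI := @is_pseries_incr_1 C_AbsRing C_NormedModule _ h l Hl).
  assert (HR := @is_pseries_minus C_AbsRing C_NormedModule _ _ h _ _
    (@is_pseries_scal C_AbsRing C_NormedModule (RtoC (D - E)) _ h (Y h) (Cmult_comm _ _) (HY h Hh))
    (@is_pseries_scal C_AbsRing C_NormedModule (RtoC E) _ h _ (Cmult_comm _ _) HI)).
  assert (Heq : (s * l = RtoC (D - E) * Y h + - (RtoC E * (h * l)))%C).
  { apply (ps_unique (fun k => s * (INR (S k) * c (S k)))%C h); [exact HL|].
    apply is_pseries_ext with (2 := HR). intros n. unfold PS_minus, PS_plus, PS_opp, PS_scal, PS_incr_1.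
    assert (HSn : RtoC (INR (S n)) <> RtoC 0).
    { intros X. apply RtoC_inj in X. rewrite S_INR in X. assert (Z := pos_INR n). lra. }
    change (c (S n)) with (RtoC (D - E - E * INR n) / (RtoC (INR (S n)) * s) * c n)%C.
    transitivity (RtoC (D - E - E * INR n) * c n)%C; [|Cfield; easy].
    destruct n as [|n].
    - change (RtoC (D - E) * c 0%nat + - (RtoC E * RtoC 0) = RtoC (D - E - E * INR 0) * c 0%nat)%C.
      replace (D - E - E * INR 0) with (D - E) by (simpl; ring). ring.
    - change (RtoC (D - E) * c (S n) + - (RtoC E * (INR (S n) * c (S n))) = RtoC (D - E - E * INR (S n)) * c (S n))%C.
      rewrite (RtoC_minus (D - E)), RtoC_mult. ring. }
  replace ((s + RtoC E * h) * l)%C with (s * l + RtoC E * (h * l))%C by ring. rewrite Heq. ring.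
Qed.

(** Both sides solve the same first-order linear equation and agree at h = 0: the product of
one with the inverse of the other has zero derivative. *)
Lemma h0_local_expansion D E z0 : -1 <= E <= 0 -> E < D <= 1 -> unit_disk z0 ->
  forall h, Cmod h < 1 - Cmod z0 ->
  ps (binomial_coef D E (RtoC 1 + RtoC E * z0) (Cexp (janowski_log D E z0))) h (Cexp (janowski_log D E (z0 + h)%C)).
Proof.
  intros HE HD Hz0. set (s := (RtoC 1 + RtoC E * z0)%C). set (c0 := Cexp (janowski_log D E z0)).
  assert (Hs : s <> RtoC 0) by (apply one_plus_E_nonzero; [lra|easy]).
  destruct (binomial_series D E s c0 HE HD Hs) as (Y & HY & Hode).
  assert (Hin : forall h, Cmod h < 1 - Cmod z0 -> unit_disk (z0 + h)%C).
  { intros h Hh. unfold unit_disk. eapply Rle_lt_trans; [apply Cmod_triangle|]. lra. }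
  assert (Hle : forall h, Cmod h < 1 - Cmod z0 -> Cmod h < Cmod s).
  { intros h Hh. eapply Rlt_le_trans; [exact Hh|].
    assert (X := Cmod_triangle_rev (RtoC 1) (- (RtoC E * z0))%C).
    replace (RtoC 1 - - (RtoC E * z0))%C with s in X by (unfold s; ring).
    rewrite Cmod_opp, Cmod_1, Cmod_mult, Cmod_R, Rabs_left1 in X by lra.
    assert (Z := Cmod_ge_0 z0). nra. }
  set (Q := fun h => (Y h * Cexp (- RtoC 1 * janowski_log D E (z0 + h)))%C).
  assert (HQ : forall h, Cmod h < 1 - Cmod z0 -> cderiv Q h (RtoC 0)).
  { intros h Hh. destruct (Hode h (Hle h Hh)) as (l & Hl & Heq).
    assert (Hg := cderiv_janowski_log D E _ HE (Hin h Hh)).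
    assert (Hsh : cderiv (fun h => z0 + h)%C h (RtoC 0 + RtoC 1)%C).
    { apply (cderiv_plus (fun _ => z0) (fun h => h)); [apply cderiv_const|apply cderiv_id]. }
    assert (H1 := cderiv_comp (janowski_log D E) (fun h => z0 + h)%C h _ _ Hg Hsh).
    assert (H2 := cderiv_mult (fun _ => - RtoC 1)%C _ h _ _ (cderiv_const _ h) H1).
    assert (H3 := cderiv_comp Cexp _ h _ _ (cderiv_Cexp _) H2).
    assert (H4 := cderiv_mult Y _ h _ _ Hl H3). cbv beta in H4.
    assert (Hn := one_plus_E_nonzero E _ ltac:(lra) (Hin h Hh)).
    replace (s + RtoC E * h)%C with (RtoC 1 + RtoC E * (z0 + h))%C in Heq by (unfold s; ring).
    set (X := Cexp (- RtoC 1 * janowski_log D E (z0 + h))%C) in *.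
    match type of H4 with cderiv _ _ ?d => replace (RtoC 0) with d; [exact H4|] end.
    transitivity (((RtoC 1 + RtoC E * (z0 + h)) * l - RtoC (D - E) * Y h) * X / (RtoC 1 + RtoC E * (z0 + h)))%C.
    - field. easy.
    - rewrite Heq. field. easy. }
  intros h Hh. replace (Cexp (janowski_log D E (z0 + h)%C)) with (Y h); [apply HY, Hle, Hh|].
  assert (X := zero_derivative_constant Q _ HQ h Hh). unfold Q in X. rewrite Cplus_0_r in X.
  rewrite (ps_at_0 _ (Y (RtoC 0)) (HY (RtoC 0) ltac:(rewrite Cmod_0; now apply Cmod_gt_0))) in X.
  simpl in X. unfold c0 in X.
  replace (- RtoC 1 * janowski_log D E z0)%C with (- janowski_log D E z0)%C in X by ring.
  replace (- RtoC 1 * janowski_log D E (z0 + h))%C with (- janowski_log D E (z0 + h))%C in X by ring.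
  rewrite Cexp_opp in X.
  transitivity (Y h * (Cexp (janowski_log D E (z0 + h)) * Cexp (- janowski_log D E (z0 + h))))%C.
  - rewrite Cexp_opp. ring.
  - transitivity ((Y h * Cexp (- janowski_log D E (z0 + h))) * Cexp (janowski_log D E (z0 + h)))%C; [ring|].
    rewrite X. ring.
Qed.

Lemma janowski_log_0 D E : janowski_log D E (RtoC 0) = RtoC 0.
Proof.
  unfold janowski_log. destruct (Req_dec_T E 0); [ring|].
  replace (RtoC 1 + RtoC E * RtoC 0)%C with (RtoC 1) by ring.
  unfold Clog, Carg. rewrite Cmod_1, ln_1. simpl. destruct (Rle_dec 0 0) as [_|H]; [|lra].
  rewrite Rdiv_1_r, acos_1. change (RtoC ((D - E) / E) * RtoC 0 = RtoC 0)%C. ring.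
Qed.

Lemma f0_local_expansion D E z0 : -1 <= E <= 0 -> E < D <= 1 -> unit_disk z0 ->
  forall h, Cmod h < 1 - Cmod z0 ->
  let c := binomial_coef D E (RtoC 1 + RtoC E * z0) (Cexp (janowski_log D E z0)) in
  ps (fun k => z0 * c k + match k with O => RtoC 0 | S m => c m end)%C h (janowski_f0 D E (z0 + h)).
Proof.
  intros HE HD Hz0 h Hh c. assert (X := h0_local_expansion D E z0 HE HD Hz0 h Hh). fold c in X.
  rewrite janowski_f0_log. replace ((z0 + h) * Cexp (janowski_log D E (z0 + h)))%C with
    (z0 * Cexp (janowski_log D E (z0 + h)) + h * Cexp (janowski_log D E (z0 + h)))%C by ring.
  exact (@is_pseries_plus C_AbsRing C_NormedModule _ _ h _ _
    (@is_pseries_scal C_AbsRing C_NormedModule z0 _ h _ (Cmult_comm h z0) X)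
    (@is_pseries_incr_1 C_AbsRing C_NormedModule _ h _ X)).
Qed.

(** The coefficient of z^n in f0 (z) / z, that is t_(n+1). *)
Fixpoint f0_coef (D E : R) (n : nat) : R :=
  match n with
  | O => 1
  | S m => (D - E - E * INR m) / INR (S m) * f0_coef D E m
  end.

Lemma f0_coef_pos D E n : -1 <= E <= 0 -> E < D -> 0 < f0_coef D E n.
Proof.
  intros HE HD. induction n as [|n IH]; [simpl; lra|].
  change (0 < (D - E - E * INR n) / INR (S n) * f0_coef D E n).
  apply Rmult_lt_0_compat; [|easy]. assert (X := pos_INR n). rewrite S_INR.
  apply Rdiv_lt_0_compat; nra.
Qed.

Lemma f0_expansion D E : -1 <= E <= 0 -> E < D <= 1 ->
  expansion (janowski_f0 D E) (fun k => match k with O => RtoC 0 | S m => RtoC (f0_coef D E m) end).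
Proof.
  intros HE HD z Hz.
  assert (X := f0_local_expansion D E (RtoC 0) HE HD unit_disk_0 z ltac:(rewrite Cmod_0; unfold unit_disk in Hz; lra)).
  cbv zeta in X. rewrite Cplus_0_l in X. apply is_pseries_ext with (2 := X). intros n.
  rewrite Cmult_0_l, Cplus_0_l. destruct n as [|n]; [easy|].
  rewrite janowski_log_0, Cexp_0. replace (RtoC 1 + RtoC E * RtoC 0)%C with (RtoC 1) by ring.
  induction n as [|n IH]; [easy|].
  assert (HSn : INR (S n) <> 0) by (apply not_0_INR; lia).
  assert (HSn' : RtoC (INR (S n)) <> RtoC 0) by (intros Z; apply RtoC_inj in Z; lra).
  change (binomial_coef D E (RtoC 1) (RtoC 1) (S n)) with
    (RtoC (D - E - E * INR n) / (RtoC (INR (S n)) * RtoC 1) * binomial_coef D E (RtoC 1) (RtoC 1) n)%C.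
  rewrite IH. change (f0_coef D E (S n)) with ((D - E - E * INR n) / INR (S n) * f0_coef D E n). rewrite RtoC_mult, RtoC_div by easy.
  Cfield. easy.
Qed.

Lemma series_zero : @is_series C_AbsRing C_NormedModule (fun _ => RtoC 0) (RtoC 0).
Proof.
  destruct (series_ex (fun _ => RtoC 0) (fun n => 0 * 0 ^ n)) as [l Hl].
  - intros k. rewrite Cmod_0. rewrite Rmult_0_l; lra.
  - exists (0 * / (1 - 0)). apply (@is_series_scal R_AbsRing R_NormedModule). apply is_series_geom.
    rewrite Rabs_R0. lra.
  - assert (X := @is_series_scal C_AbsRing C_NormedModule (RtoC 0) _ _ Hl).
    assert (E : @scal C_AbsRing C_NormedModule (RtoC 0) l = RtoC 0) by apply Cmult_0_l. rewrite E in X.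
    apply is_series_ext with (2 := X). intros _. apply Cmult_0_l.
Qed.

Lemma analytic_id : analytic_on unit_disk (fun z => z).
Proof.
  intros z0 _. exists (fun k => match k with O => z0 | S O => RtoC 1 | _ => RtoC 0 end).
  apply locally_Cmod. exists 1. split; [lra|]. intros w _. set (h := (w - z0)%C).
  apply ps_eq_series. apply is_series_decr_1. apply is_series_decr_1.
  match goal with |- is_series _ ?l => replace l with (RtoC 0) end.
  - apply is_series_ext with (2 := series_zero). intros n. symmetry. apply Cmult_0_l.
  - change (RtoC 0 = w + - (z0 * RtoC 1) + - (RtoC 1 * (h * RtoC 1)))%C. unfold h. ring.
Qed.

Lemma f0_nonzero D E z : z <> RtoC 0 -> janowski_f0 D E z <> RtoC 0.
Proof. intros Hz. rewrite janowski_f0_log. apply Cmult_neq_0; [easy|apply Cexp_nonzero]. Qed.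

Lemma f0_analytic D E : -1 <= E <= 0 -> E < D <= 1 -> analytic_on unit_disk (janowski_f0 D E).
Proof.
  intros HE HD z0 Hz0. eexists. apply locally_Cmod. exists (1 - Cmod z0).
  split; [unfold unit_disk in Hz0; lra|]. intros w Hw.
  assert (X := f0_local_expansion D E z0 HE HD Hz0 (w - z0)%C Hw). cbv zeta in X.
  replace (z0 + (w - z0))%C with w in X by ring. exact X.
Qed.

Lemma f0_starlike_quotient D E z : -1 <= E <= 0 -> unit_disk z ->
  starlike_quotient (janowski_f0 D E) z = janowski D E z.
Proof.
  intros HE Hz. assert (Hn := one_plus_E_nonzero E z ltac:(lra) Hz). unfold starlike_quotient, janowski.
  destruct (Ceq_dec z (RtoC 0)) as [->|Hz0].
  - replace (RtoC 1 + RtoC D * RtoC 0)%C with (RtoC 1) by ring.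
    replace (RtoC 1 + RtoC E * RtoC 0)%C with (RtoC 1) by ring. field.
  - assert (H1 := cderiv_comp Cexp _ z _ _ (cderiv_Cexp _) (cderiv_janowski_log D E z HE Hz)).
    assert (H2 := cderiv_mult (fun z => z) _ z _ _ (cderiv_id z) H1). cbv beta in H2.
    assert (H3 : cderiv (janowski_f0 D E) z
       (RtoC 1 * Cexp (janowski_log D E z) + z * (Cexp (janowski_log D E z) * (RtoC (D - E) / (RtoC 1 + RtoC E * z))))%C).
    { apply cderiv_ext with (3 := H2) (d := 1); [lra|]. intros h _. now rewrite janowski_f0_log. }
    rewrite (cderiv_C_derive _ _ _ H3), janowski_f0_log, RtoC_minus.
    assert (HX := Cexp_nonzero (janowski_log D E z)). field. repeat split; easy.
Qed.

Lemma f0_class_Sstar D E : -1 <= E <= 0 -> E < D <= 1 -> class_Sstar (janowski D E) (janowski_f0 D E).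
Proof.
  intros HE HD. split; [|split].
  - split; [now apply f0_analytic|]. eexists. split; [|split; [|now apply f0_expansion]]; easy.
  - intros z _. apply f0_nonzero.
  - exists (fun z => z). split; [apply analytic_id|]. split; [easy|]. split; [easy|].
    intros z Hz. now apply f0_starlike_quotient.
Qed.

Lemma f0_class_S D E : -1 <= E <= 0 -> E < D <= 1 -> class_S (janowski_f0 D E) (janowski_f0 D E).
Proof.
  intros HE HD. split; [now apply f0_analytic|]. split.
  - eexists. split; [|now apply f0_expansion]. easy.
  - exists (fun z => z). split; [apply analytic_id|]. easy.
Qed.

Lemma Carg_positive y : 0 < y -> Carg (RtoC y) = 0.
Proof.
  intros Hy. rewrite Carg_atan by easy. simpl. unfold Rdiv. rewrite Rmult_0_l. apply atan_0.
Qed.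

Lemma f0_R D E x : -1 <= E <= 0 -> -1 < x < 1 -> janowski_f0 D E (RtoC x) = RtoC (x * eta D E x).
Proof.
  intros HE Hx. rewrite janowski_f0_log. unfold janowski_log, eta, Rpower.
  destruct (Req_dec_T E 0) as [E0|E0].
  - rewrite <- RtoC_mult, Cexp_R, <- RtoC_mult. easy.
  - rewrite <- RtoC_mult, <- RtoC_plus. assert (Hp : 0 < 1 + E * x) by nra.
    unfold Clog. rewrite Carg_positive, Cmod_R, Rabs_pos_eq by lra.
    change (ln (1 + E * x), 0) with (RtoC (ln (1 + E * x))). rewrite <- RtoC_mult, Cexp_R, <- RtoC_mult. easy.
Qed.

(** The coefficients of f0 are positive, so its majorant at r is f0 (r). *)
Lemma f0_majorant D E a r : -1 <= E <= 0 -> E < D <= 1 -> expansion (janowski_f0 D E) a -> 0 <= r < 1 ->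
  Defs.majorant a r = r * eta D E r.
Proof.
  intros HE HD Ha Hr. set (b := fun k => match k with O => RtoC 0 | S m => RtoC (f0_coef D E m) end).
  assert (Hb := f0_expansion D E HE HD). fold b in Hb.
  assert (Hab : forall k, a k = b k).
  { intros k. apply (jet_unique (S k) (janowski_f0 D E) (janowski_f0 D E) a b 1); [lra|easy| | |lia];
      now apply expansion_jet. }
  assert (Hru : unit_disk (RtoC r)) by (unfold unit_disk; rewrite Cmod_R, Rabs_pos_eq; lra).
  assert (Hs := proj1 (ps_eq_series _ _ _) (Hb _ Hru)). rewrite f0_R in Hs by lra.
  unfold Defs.majorant. apply is_lim_seq_unique.
  (* the series of f0 at r has nonnegative terms: its partial sums are those of the majorant *)
  assert (Hre : is_lim_seq (fun n => Re (sum_n (fun k => b k * RtoC r ^ k)%C n)) (r * eta D E r)).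
  { apply (filterlim_comp _ _ _ (sum_n (fun k => b k * RtoC r ^ k)%C) (fun z : C => fst z) eventually
       (@locally C_UniformSpace (RtoC (r * eta D E r))) (Rbar_locally (r * eta D E r))); [exact Hs|].
    apply (@continuous_fst R_UniformSpace R_UniformSpace (r * eta D E r) 0). }
  apply is_lim_seq_ext with (2 := Hre). intros n.
  assert (Hterm : forall k, (b k * RtoC r ^ k)%C = RtoC (Cmod (a k) * r ^ k)).
  { intros k. rewrite Hab, RtoC_mult, RtoC_pow. f_equal. destruct k as [|k]; simpl.
    - now rewrite Cmod_0.
    - rewrite Cmod_R, Rabs_pos_eq; [easy|]. left. apply f0_coef_pos; lra. }
  assert (Hsum : forall n, sum_n (fun k => b k * RtoC r ^ k)%C n = RtoC (sum_n (fun k => Cmod (a k) * r ^ k) n)).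
  { induction n0 as [|m IH].
    - rewrite !sum_O. apply Hterm.
    - rewrite !sum_Sn, IH, Hterm. symmetry. apply RtoC_plus. }
  rewrite Hsum, re_RtoC. unfold sum_n at 1. rewrite sum_Sn_m by lia.
  rewrite Hab. simpl b. rewrite Cmod_0, Rmult_0_l. apply Rplus_0_l.
Qed.

Lemma is_derive_x_eta D E x : 0 < 1 + E * x ->
  is_derive (fun x => x * eta D E x) x ((1 + D * x) / (1 + E * x) * eta D E x).
Proof.
  intros Hx. assert (X := is_derive_mult (fun x => x) (eta D E) x _ _ (@is_derive_id R_AbsRing x)
     (is_derive_eta D E x Hx) Rmult_comm).
  replace ((1 + D * x) / (1 + E * x) * eta D E x) with
    (plus (mult one (eta D E x)) (mult x ((D - E) / (1 + E * x) * eta D E x))); [exact X|].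
  change (1 * eta D E x + x * ((D - E) / (1 + E * x) * eta D E x) = (1 + D * x) / (1 + E * x) * eta D E x).
  field. lra.
Qed.

Lemma one_plus_E_pos E c : -1 <= E <= 0 -> c < 1 -> 0 < 1 + E * c.
Proof. intros HE Hc. destruct (Rle_lt_dec 0 c); nra. Qed.

Lemma x_eta_increasing D E x y : -1 <= E <= 0 -> -1 <= D <= 1 -> -1 <= x -> x < y -> y < 1 ->
  x * eta D E x < y * eta D E y.
Proof.
  intros HE HD Hx Hxy Hy.
  destruct (MVT_cor2 (fun x => x * eta D E x) (fun x => (1 + D * x) / (1 + E * x) * eta D E x) x y Hxy) as (c & Hc & Hcb).
  - intros c Hc. apply is_derive_Reals, is_derive_x_eta, one_plus_E_pos; lra.
  - assert (H1 : 0 < 1 + E * c) by (apply one_plus_E_pos; lra).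
    assert (H2 : 0 < 1 + D * c) by (destruct (Rle_lt_dec 0 c); nra).
    assert (H3 := eta_pos D E c).
    assert (0 < (1 + D * c) / (1 + E * c) * eta D E c).
    { apply Rmult_lt_0_compat; [now apply Rdiv_lt_0_compat|easy]. }
    nra.
Qed.

(** * The image of the extremal function *)

(** The difference vanishes at g = 0 and has derivative e (cos (e g) - cos g) >= 0. *)
Lemma sin_contraction e g : 0 <= e <= 1 -> 0 <= g <= PI -> e * sin g <= sin (e * g).
Proof.
  intros He Hg.
  assert (H : sin (e * 0) - e * sin 0 <= sin (e * g) - e * sin g).
  { apply (monotone_of_derive (fun x => sin (e * x) - e * sin x) (fun x => e * (cos (e * x) - cos x))).
    - lra.
    - intros x _. auto_derive; [easy|ring].
    - intros x Hx. apply Rmult_le_pos; [lra|].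
      assert (cos x <= cos (e * x)); [|lra]. apply cos_decr_1; nra. }
  rewrite Rmult_0_r, sin_0 in H. lra.
Qed.

(** In the triangle with vertices 0, 1 and the point of modulus e m and argument theta, the angles
at 0 and 1 are theta and beta, and M is the side facing 0.  With gamma the third
angle, the law of sines gives sin beta = e m sin gamma < e sin gamma <= sin (e gamma),
hence beta < e gamma. *)
Lemma triangle_angles e m M theta beta : 0 < e <= 1 -> 0 < m < 1 ->
  0 < theta < PI -> 0 < beta < PI / 2 ->
  M * cos beta = 1 - e * m * cos theta -> M * sin beta = e * m * sin theta ->
  theta + beta + beta / e < PI.
Proof.
  intros He Hm Hth Hbe Hcos Hsin. assert (Hpi := PI_RGT_0).
  assert (Hsb : 0 < sin beta) by (apply sin_gt_0; lra).
  assert (Hlaw : e * m * sin (theta + beta) = sin beta).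
  { rewrite sin_plus. replace (e * m * (sin theta * cos beta + cos theta * sin beta)) with
      ((e * m * sin theta) * cos beta + (e * m * cos theta) * sin beta) by ring.
    rewrite <- Hsin. replace (e * m * cos theta) with (1 - M * cos beta) by lra. ring. }
  assert (Hem : 0 < e * m) by nra.
  assert (Hs : 0 < sin (theta + beta)) by nra.
  assert (Hlt : theta + beta < PI).
  { apply Rnot_le_lt. intros Hle. assert (X := sin_le_0 (theta + beta) Hle ltac:(lra)). lra. }
  set (g := PI - theta - beta).
  assert (Hg : 0 < g < PI) by (unfold g; lra).
  assert (Hsg : sin (theta + beta) = sin g) by (unfold g; rewrite <- sin_PI_x; f_equal; ring).
  rewrite Hsg in *.
  assert (X := sin_contraction e g ltac:(lra) ltac:(lra)).
  assert (Hlt2 : sin beta < sin (e * g)) by nra.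
  assert (Hb : beta < e * g).
  { apply Rnot_le_lt. intros Hle. assert (0 <= e * g) by nra.
    assert (Y := sin_incr_1 (e * g) beta ltac:(lra) ltac:(lra) ltac:(lra) ltac:(lra) Hle). lra. }
  assert (beta / e < g).
  { apply (Rmult_lt_reg_r e); [lra|]. unfold Rdiv. rewrite Rmult_assoc, Rinv_l by lra. lra. }
  unfold g in *. lra.
Qed.

(** The argument of f0 z is that of z plus (D - E) / E times that of 1 + E z.  It is positive, and
it is less than PI because (D - E) / (- E) <= 1 + 1 / (- E) and by [triangle_angles]; for E = 0
it is theta + D |z| sin theta < theta + (PI - theta). *)
Lemma f0_upper_half_plane D E z : -1 <= E <= 0 -> E < D <= 1 -> unit_disk z -> 0 < Im z ->
  0 < Im (janowski_f0 D E z).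
Proof.
  intros HE HD Hz Hi. assert (Hpi := PI_RGT_0). unfold unit_disk in Hz.
  assert (Hz0 : z <> RtoC 0) by (intros X; rewrite X in Hi; simpl in Hi; lra).
  assert (Hm : 0 < Cmod z) by now apply Cmod_gt_0.
  destruct (polar_form z Hz0) as [Hre Him]. set (th := Carg z) in *.
  assert (Hth : 0 <= th <= PI).
  { unfold th, Carg. destruct (Rle_dec 0 (Im z)) as [_|X]; [apply acos_bound|lra]. }
  assert (Hth' : 0 < th < PI).
  { split.
    - destruct (Rle_lt_or_eq_dec _ _ (proj1 Hth)) as [X|X]; [easy|]. rewrite <- X, sin_0 in Him. lra.
    - destruct (Rle_lt_or_eq_dec _ _ (proj2 Hth)) as [X|X]; [easy|]. rewrite X, sin_PI in Him. lra. }
  (* with log (f0 z / z) = A + i B, the argument of f0 z is th + B *)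
  assert (Hkey : forall A B, janowski_log D E z = (A, B) -> 0 < th + B < PI -> 0 < Im (janowski_f0 D E z)).
  { intros A B HAB HB. rewrite janowski_f0_log, HAB, im_mult, Hre, Him. unfold Cexp. simpl Re. simpl Im.
    replace (Cmod z * cos th * (exp A * sin B) + Cmod z * sin th * (exp A * cos B)) with
      (Cmod z * exp A * sin (th + B)) by (rewrite sin_plus; ring).
    apply Rmult_lt_0_compat; [apply Rmult_lt_0_compat; [easy|apply exp_pos]|apply sin_gt_0; lra]. }
  unfold janowski_log in Hkey. destruct (Req_dec_T E 0) as [E0|E0].
  - apply (Hkey (D * Re z) (D * Im z)).
    + destruct z as [x y]. apply injective_projections; simpl; ring.
    + assert (Hlt : sin th < PI - th) by (rewrite <- sin_PI_x; apply sin_lt_x; lra).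
      assert (Hs : 0 < sin th) by (apply sin_gt_0; lra).
      assert (H1 : D * Im z <= sin th).
      { rewrite Him. replace (D * (Cmod z * sin th)) with ((D * Cmod z) * sin th) by ring.
        rewrite <- (Rmult_1_l (sin th)) at 2. apply Rmult_le_compat_r; [lra|]. nra. }
      assert (0 < D * Im z) by nra. lra.
  - set (w := (RtoC 1 + RtoC E * z)%C) in *.
    assert (HEn : E < 0) by lra.
    assert (Hw : 0 < Re w) by now apply Re_one_plus_E_pos.
    assert (Hw0 : w <> RtoC 0) by (intros X; rewrite X in Hw; simpl in Hw; lra).
    destruct (polar_form w Hw0) as [Hwre Hwim].
    assert (Hwi : Im w = E * Im z) by (unfold w; rewrite im_plus, im_scal_l, im_RtoC; ring).
    assert (Hwr : Re w = 1 + E * Re z) by (unfold w; rewrite re_plus, re_scal_l, re_RtoC; ring).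
    set (be := - Carg w).
    assert (Hca : Carg w = - be) by (unfold be; ring).
    assert (Hbe : 0 < be < PI / 2).
    { unfold be. rewrite Carg_atan by easy. assert (X := atan_bound (Im w / Re w)).
      assert (Y : atan (Im w / Re w) < atan 0).
      { apply atan_increasing. assert (Hinv : 0 < / Re w) by now apply Rinv_0_lt_compat.
        assert (Hneg : Im w < 0) by (rewrite Hwi; nra). unfold Rdiv. nra. }
      rewrite atan_0 in Y. lra. }
    rewrite Hca, cos_neg in Hwre. rewrite Hca, sin_neg in Hwim.
    assert (T := triangle_angles (- E) (Cmod z) (Cmod w) th be ltac:(lra) ltac:(lra) Hth' Hbe).
    assert (T' : th + be + be / - E < PI).
    { apply T.
      - rewrite <- Hwre, Hwr, Hre. ring.
      - replace (- E * Cmod z * sin th) with (- (E * Im z)) by (rewrite Him; ring). lra. }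
    apply (Hkey ((D - E) / E * ln (Cmod w)) ((D - E) / E * - be)).
    + unfold Clog. rewrite Hca. apply injective_projections; simpl; ring.
    + replace ((D - E) / E * - be) with ((D - E) * (be / - E)) by (field; lra).
      assert (Hq : 0 < be / - E) by (apply Rdiv_lt_0_compat; lra).
      assert (H1 : (D - E) * (be / - E) <= (1 - E) * (be / - E)) by (apply Rmult_le_compat_r; lra).
      replace ((1 - E) * (be / - E)) with (be + be / - E) in H1 by (field; lra).
      assert (0 < (D - E) * (be / - E)) by (apply Rmult_lt_0_compat; lra). lra.
Qed.

Lemma f0_conj D E z : -1 <= E <= 0 -> unit_disk z ->
  janowski_f0 D E (Cconj z) = Cconj (janowski_f0 D E z).
Proof.
  intros HE Hz. rewrite !janowski_f0_log, Cmult_conj, <- Cexp_conj. f_equal. f_equal.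
  assert (HR : forall x, Cconj (RtoC x) = RtoC x) by (intros x; unfold Cconj, RtoC; simpl; f_equal; ring).
  unfold janowski_log. destruct (Req_dec_T E 0); rewrite Cmult_conj, HR; [easy|]. f_equal.
  assert (Hw := Re_one_plus_E_pos E z HE Hz).
  replace (RtoC 1 + RtoC E * Cconj z)%C with (Cconj (RtoC 1 + RtoC E * z)) by (now rewrite Cplus_conj, Cmult_conj, !HR).
  set (w := (RtoC 1 + RtoC E * z)%C) in *. unfold Clog. rewrite !Carg_atan by (rewrite ?re_conj; easy).
  rewrite Cmod_conj, re_conj, im_conj. unfold Cconj. simpl. f_equal.
  rewrite <- atan_opp. f_equal. unfold Rdiv. ring.
Qed.

(** A real value is taken only at real points, by the sign of the imaginary part and symmetry, and
x eta (x) is increasing. *)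
Lemma f0_omits D E z v : -1 <= E <= 0 -> E < D <= 1 -> unit_disk z ->
  janowski_f0 D E z = RtoC v -> - eta D E (-1) < v.
Proof.
  intros HE HD Hz Hv. destruct (Rtotal_order (Im z) 0) as [Hi|[Hi|Hi]].
  - assert (Hz' : unit_disk (Cconj z)) by (unfold unit_disk; now rewrite Cmod_conj).
    assert (X := f0_upper_half_plane D E (Cconj z) HE HD Hz' ltac:(rewrite im_conj; lra)).
    rewrite f0_conj, Hv, im_conj, im_RtoC in X by easy. lra.
  - assert (Ez : z = RtoC (Re z)) by (destruct z as [x y]; simpl in Hi; rewrite Hi; easy).
    set (x := Re z) in *. rewrite Ez in Hv, Hz. unfold unit_disk in Hz. rewrite Cmod_R in Hz.
    apply Rabs_def2 in Hz. rewrite f0_R in Hv by (lra || easy). apply RtoC_inj in Hv.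
    assert (X := x_eta_increasing D E (-1) x HE ltac:(lra) ltac:(lra) ltac:(lra) ltac:(lra)). lra.
  - assert (X := f0_upper_half_plane D E z HE HD Hz Hi). rewrite Hv, im_RtoC in X. lra.
Qed.

(** The point - eta (-1) is the limit of f0 (- x) as x tends to 1, and real points below it are
omitted. *)
Theorem f0_bohr_distance_le D E : -1 <= E <= 0 -> E < D <= 1 ->
  Rbar_le (bohr_distance (janowski_f0 D E)) (eta D E (-1)).
Proof.
  intros HE HD. unfold bohr_distance, distance. set (f0 := janowski_f0 D E).
  assert (Hp := eta_pos D E (-1)).
  assert (Hf0 : f0 (RtoC 0) = RtoC 0) by (exact (expansion_at_0 _ _ (f0_expansion D E HE HD))).
  destruct (Glb_Rbar_correct (fun x : R => exists w : C, boundary (disk_image f0) w /\ x = Cmod (w - f0 (RtoC 0))%C))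
    as [Hlb _].
  apply Hlb. exists (RtoC (- eta D E (-1))). split.
  - split; intros Hloc; apply locally_Cmod in Hloc; destruct Hloc as (d & Hd & H).
    + destruct (H (RtoC (- eta D E (-1) - d / 2))) as (z & Hz & Hzv).
      * rewrite <- RtoC_minus, Cmod_R. replace (- eta D E (-1) - d / 2 - - eta D E (-1)) with (- (d / 2)) by ring.
        rewrite Rabs_Ropp, Rabs_pos_eq; lra.
      * assert (X := f0_omits D E z _ HE HD Hz (eq_sym Hzv)). lra.
    + destruct (radial_limit D E d HE Hd) as (x & Hx & Hlim).
      apply (H (f0 (RtoC (- x)))).
      * unfold f0. rewrite f0_R by (lra || easy). rewrite <- RtoC_minus, Cmod_R.
        replace (- x * eta D E (- x) - - eta D E (-1)) with (- (x * eta D E (- x) - eta D E (-1))) by ring.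
        now rewrite Rabs_Ropp.
      * exists (RtoC (- x)). split; [|easy]. unfold unit_disk. rewrite Cmod_R, Rabs_Ropp, Rabs_pos_eq; lra.
  - rewrite Hf0. replace (RtoC (- eta D E (-1)) - RtoC 0)%C with (RtoC (- eta D E (-1))) by ring.
    rewrite Cmod_R, Rabs_Ropp, Rabs_pos_eq; lra.
Qed.

(** * The Bohr radius *)

Lemma janowski_t_step D E m : (1 <= m)%nat ->
  janowski_t D E (S m) = janowski_t D E m * ((D - INR m * E) / INR m).
Proof.
  intros Hm. unfold janowski_t. destruct m as [|m]; [lia|].
  replace (S (S m) - 1)%nat with (S m) by lia. replace (S m - 1)%nat with m by lia.
  rewrite seq_S, map_app, fold_right_app.
  assert (H : forall l x, fold_right Rmult x l = fold_right Rmult 1 l * x).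
  { induction l as [|y l IH]; intros x; simpl; [ring|]. rewrite IH. ring. }
  rewrite H. f_equal. change (2 + m)%nat with (S (S m)). cbn [map fold_right].
  replace (INR (S (S m)) - 1) with (INR (S m)) by (rewrite (S_INR (S m)); ring). apply Rmult_1_r.
Qed.

(** If E > 0, the factor D - (k - 1) E of t_k is eventually nonpositive. *)
Lemma positive_products_E_nonpos D E : (forall n : nat, (2 <= n)%nat -> 0 < janowski_t D E n) -> E <= 0.
Proof.
  intros ht. apply Rnot_lt_le. intros HE.
  destruct (INR_unbounded (Rmax 1 (D / E))) as [m Hm].
  assert (H1 := Rmax_l 1 (D / E)). assert (H2 := Rmax_r 1 (D / E)).
  assert (Hm1 : (1 <= m)%nat) by (apply INR_le; simpl; lra).
  assert (HDm : D < INR m * E).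
  { replace D with (D / E * E) by (field; lra). apply Rmult_lt_compat_r; lra. }
  assert (Htm : 0 < janowski_t D E m).
  { destruct (Nat.eq_dec m 1) as [->|Hne]; [unfold janowski_t; simpl; lra|]. apply ht. lia. }
  assert (X := ht (S m) ltac:(lia)). rewrite janowski_t_step in X by easy.
  assert (Hinv : 0 < / INR m) by (apply Rinv_0_lt_compat; lra).
  assert (Y : (D - INR m * E) / INR m < 0) by (unfold Rdiv; nra). nra.
Qed.

Lemma radius_exists D E : -1 <= E <= 0 -> 3 * eta D E (-1) <= eta D E (1 / 3) ->
  exists r, 0 < r <= 1 / 3 /\ r * eta D E r = eta D E (-1).
Proof.
  intros HE H. assert (Hp := eta_pos D E (-1)).
  destruct (Rle_lt_or_eq_dec _ _ H) as [Hlt|Heq]; [|exists (1 / 3); lra].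
  destruct (IVT_interv (fun x => x * eta D E x - eta D E (-1)) 0 (1 / 3)) as (r & Hr & Hr0).
  - intros x Hx. apply derivable_continuous_pt. eexists. apply is_derive_Reals.
    apply (is_derive_minus (fun x => x * eta D E x) (fun _ => eta D E (-1))).
    + apply is_derive_x_eta, one_plus_E_pos; lra.
    + apply (@is_derive_const R_AbsRing R_NormedModule).
  - lra.
  - lra.
  - lra.
  - exists r. split; [|lra]. split; [|lra].
    destruct (Rle_lt_or_eq_dec _ _ (proj1 Hr)) as [X|X]; [easy|]. rewrite <- X in Hr0. lra.
Qed.

Lemma exp_nondecreasing x y : x <= y -> exp x <= exp y.
Proof. intros [H| ->]; [left; now apply exp_increasing|lra]. Qed.

(** For r <= r0 the majorants are at most r eta (r) <= eta (-1), a lower bound for the distance;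
for f0 both bounds are equalities. *)
Theorem bohr_phenomenon D E r0 : -1 <= E <= 0 -> E < D <= 1 -> 0 < r0 <= 1 / 3 ->
  r0 * eta D E r0 = eta D E (-1) ->
  (forall f, class_Sstar (janowski D E) f -> bohr_S f r0) /\
  bohr_Sstar (janowski D E) r0 /\ sharp_for (janowski D E) (janowski_f0 D E) r0.
Proof.
  intros HE HD Hr0 Heq.
  assert (Hmono : forall r, 0 <= r <= r0 -> r * eta D E r <= eta D E (-1)).
  { intros r Hr. rewrite <- Heq. destruct (Req_dec_T r r0) as [->|Hne]; [lra|].
    left. apply x_eta_increasing; lra. }
  assert (Hall : forall f a, class_Sstar (janowski D E) f -> expansion f a ->
    forall n r, 0 <= r <= r0 -> partial_majorant n r a <= eta D E (-1)).
  { intros f a Hf Ha n r Hr. eapply Rle_trans; [|exact (Hmono r Hr)].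
    apply (starlike_majorant D E f); (easy || lra). }
  split; [|split].
  - intros f Hf g b (_ & _ & Hgf) Hb r Hr.
    assert (Ha : exists a, expansion f a) by (destruct Hf as ((_ & a & _ & _ & Ha) & _); now exists a).
    destruct Ha as [a Ha].
    eapply Rbar_le_trans; [|exact (bohr_distance_ge D E f HE HD Hf)].
    apply majorant_le. intros n. eapply Rle_trans; [|exact (Hall f a Hf Ha n r Hr)].
    apply (subordinate_partial_majorant f g); (easy || lra).
  - intros f a Hf Ha r Hr.
    eapply Rbar_le_trans; [|exact (bohr_distance_ge D E f HE HD Hf)].
    apply majorant_le. intros n. exact (Hall f a Hf Ha n r Hr).
  - split; [now apply f0_class_Sstar|]. split; [now apply f0_class_S|].
    intros a Ha r Hr Hle. assert (X := Rbar_le_trans _ _ _ Hle (f0_bohr_distance_le D E HE HD)).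
    rewrite (f0_majorant D E a r) in X by (easy || lra). simpl in X.
    assert (Y := x_eta_increasing D E r0 r HE ltac:(lra) ltac:(lra) ltac:(lra) ltac:(lra)). lra.
Qed.

Theorem corollary5p4 (D E : R)
  (hE : -1 <= E) (hED : E < D) (hD : D <= 1)
  (ht : forall n : nat, (2 <= n)%nat -> 0 < janowski_t D E n) :
  (E = 0 -> 3 / 4 * ln 3 <= D ->
    exists r0 : R,
      unique (fun r : R => 1 - r * exp (D * (1 + r)) = 0) r0 /\
      (forall f : C -> C, class_Sstar (janowski D E) f -> bohr_S f r0) /\
      bohr_Sstar (janowski D E) r0 /\
      sharp_for (janowski D E) (janowski_f0 D E) r0)
  /\
  (E <> 0 ->
    3 * Rpower (1 - E) ((D - E) / E) <= Rpower (1 + E / 3) ((D - E) / E) ->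
    exists r0 : R,
      unique (fun r : R => 0 < r < 1 /\
        Rpower (1 - E) ((D - E) / E)
          - r * Rpower (1 + E * r) ((D - E) / E) = 0) r0 /\
      (forall f : C -> C, class_Sstar (janowski D E) f -> bohr_S f r0) /\
      bohr_Sstar (janowski D E) r0 /\
      sharp_for (janowski D E) (janowski_f0 D E) r0).
Proof.
  assert (HE : -1 <= E <= 0) by (split; [easy|exact (positive_products_E_nonpos D E ht)]).
  split.
  - intros HE0 HD.
    assert (Heta : forall x, eta D E x = exp (D * x)).
    { intros x. unfold eta. now destruct (Req_dec_T E 0). }
    destruct (radius_exists D E HE) as (r0 & Hr0 & Heq).
    { rewrite !Heta. rewrite <- (exp_ln 3) at 1 by lra. rewrite <- exp_plus.
      apply exp_nondecreasing. lra. }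
    exists r0. split; [|apply bohr_phenomenon; (easy || lra)].
    assert (Hexp : forall r, exp (D * (1 + r)) = exp D * exp (D * r)).
    { intros r. rewrite <- exp_plus. f_equal. ring. }
    assert (HexpD : exp D * exp (D * -1) = 1).
    { rewrite <- exp_plus. replace (D + D * -1) with 0 by ring. apply exp_0. }
    rewrite !Heta in Heq. split.
    + rewrite Hexp. replace (r0 * (exp D * exp (D * r0))) with (exp D * (r0 * exp (D * r0))) by ring.
      rewrite Heq, HexpD. ring.
    + intros r Hr. rewrite Hexp in Hr.
      assert (HpD := exp_pos D). assert (Hpr := exp_pos (D * r)).
      assert (Heq' : r * exp (D * r) = r0 * exp (D * r0)).
      { rewrite Heq. apply (Rmult_eq_reg_l (exp D)); [|lra]. rewrite HexpD. lra. }
      assert (Hrpos : 0 < r).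
      { apply Rnot_le_lt. intros Hle. assert (0 < exp D * exp (D * r)) by now apply Rmult_lt_0_compat. nra. }
      assert (Hinc : forall x y, 0 < x -> x < y -> x * exp (D * x) < y * exp (D * y)).
      { intros x y Hx Hxy. assert (Hxp := exp_pos (D * x)).
        assert (exp (D * x) <= exp (D * y)) by (apply exp_nondecreasing, Rmult_le_compat_l; lra). nra. }
      destruct (Rtotal_order r0 r) as [Hlt|[H|Hlt]]; [|easy|].
      * assert (X := Hinc r0 r ltac:(lra) Hlt). lra.
      * assert (X := Hinc r r0 Hrpos Hlt). lra.
  - intros HE0 Hcond.
    assert (Heta : forall x, eta D E x = Rpower (1 + E * x) ((D - E) / E)).
    { intros x. unfold eta. now destruct (Req_dec_T E 0). }
    assert (Heta1 : Rpower (1 - E) ((D - E) / E) = eta D E (-1)).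
    { rewrite Heta. f_equal. ring. }
    destruct (radius_exists D E HE) as (r0 & Hr0 & Heq).
    { rewrite <- Heta1, Heta. replace (1 + E * (1 / 3)) with (1 + E / 3) by field. easy. }
    exists r0. split; [|apply bohr_phenomenon; (easy || lra)].
    rewrite Heta1. split.
    + rewrite <- Heta. lra.
    + intros r [Hr Hr']. rewrite <- Heta in Hr'.
      destruct (Rtotal_order r0 r) as [Hlt|[H|Hlt]]; [|easy|].
      * assert (X := x_eta_increasing D E r0 r HE ltac:(lra) ltac:(lra) Hlt ltac:(lra)). lra.
      * assert (X := x_eta_increasing D E r r0 HE ltac:(lra) ltac:(lra) Hlt ltac:(lra)). lra.
Qed.
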